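(* The energy $E(K)$ of Legendrian knots attains its minimum value $0$ exactly at $\mathbb{R}$-circles.
   Context: $\mathcal{H}=\mathbb{C}\times\mathbb{R}$ is the 3-dimensional Heisenberg group with coordinates $(z,u)=(x,y,u)$, group law $(z,u)\cdot(z',u')=(z+z',u+u'-\tfrac{1}{2}\Im(z\overline{z'}))$, horizontal distribution spanned by $X=\partial_x-\tfrac12 y\,\partial_u$, $Y=\partial_y+\tfrac12 x\,\partial_u$ (orthonormal, norm $|\cdot|$). The Korányi distance is $d_{\mathcal{H}}(p,q)=\|p^{-1}q\|_{\mathcal{H}}$, $\|(x,y,u)\|_{\mathcal{H}}=\sqrt[4]{(x^2+y^2)^2+16u^2}$, with balls $\mathbb{B}_{\mathcal{H}}(p;\varepsilon)$. Legendrian knots are smooth embedded closed Legendrian curves in $\mathcal{H}\cup\{\infty\}\cong S^3$ (possibly through $\infty$). Energy: $E(K)=\int_KV(K;p)\,dp$ with $V(K;p)=\lim_{\varepsilon\to+0}\bigl(\int_{K\setminus\mathbb{B}_{\mathcal{H}}(p;\varepsilon)}\frac{dq}{d_{\mathcal{H}}(p,q)^2}-\frac{2}{\varepsilon}\bigr)$ (arc-length measures; for finite $K$ equal to $B_K(-2)$, the regularized value of $\iint_{K\times K}d_{\mathcal{H}}(p,q)^{\zeta}\,dp\,dq$ at $\zeta=-2$). An $\mathbb{R}$-circle is the intersection of $\partial B^2_{\mathbb{C}}\cong\mathcal{H}\cup\{\infty\}$ with the closure of a complete totally geodesic totally real surface in the complex hyperbolic unit ball $B^2_{\mathbb{C}}$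 (e.g., Legendrian lifts of affine lines in $\mathbb{C}$ through $\infty$, and their images under $\mathrm{PU}(2,1)$). *)

(* Defs.v *)
From HB Require Import structures.
From mathcomp Require Import all_boot all_order all_algebra.
From mathcomp Require Import all_classical all_reals all_analysis.
Set Implicit Arguments. Unset Strict Implicit. Unset Printing Implicit Defensive.
Import Order.TTheory GRing.Theory Num.Theory.
Import numFieldNormedType.Exports.
Local Open Scope classical_set_scope.
Local Open Scope ring_scope.

Section Heis.
Variable R : realType.

Definition cpx := (R * R)%type.
Definition cadd (a b : cpx) : cpx := (a.1 + b.1, a.2 + b.2).
Definition cmul (a b : cpx) : cpx := (a.1 * b.1 - a.2 * b.2, a.1 * b.2 + a.2 * b.1).
Definition cconj (a : cpx) : cpx := (a.1, - a.2).
Definition cnorm2 (a : cpx) : R := a.1 ^+ 2 + a.2 ^+ 2.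
Definition cinv (a : cpx) : cpx := (a.1 / cnorm2 a, - a.2 / cnorm2 a).
Definition cdiv (a b : cpx) : cpx := cmul a (cinv b).
Definition czero : cpx := (0, 0).

(* <v,w> = v1 conj(w3) + v2 conj(w2) + v3 conj(w1)  (Siegel-domain model) *)
Definition C3 := (cpx * cpx * cpx)%type.
Definition c3_1 (v : C3) : cpx := v.1.1.
Definition c3_2 (v : C3) : cpx := v.1.2.
Definition c3_3 (v : C3) : cpx := v.2.
Definition c3zero : C3 := (czero, czero, czero).
Definition c3add (v w : C3) : C3 :=
  (cadd (c3_1 v) (c3_1 w), cadd (c3_2 v) (c3_2 w), cadd (c3_3 v) (c3_3 w)).
Definition c3scale (c : cpx) (v : C3) : C3 :=
  (cmul c (c3_1 v), cmul c (c3_2 v), cmul c (c3_3 v)).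
Definition c3rscale (a : R) (v : C3) : C3 := c3scale (a, 0) v.
Definition herm (v w : C3) : cpx :=
  cadd (cmul (c3_1 v) (cconj (c3_3 w)))
       (cadd (cmul (c3_2 v) (cconj (c3_2 w))) (cmul (c3_3 v) (cconj (c3_1 w)))).
Definition is_null (v : C3) : Prop := herm v v = czero.

Definition heis := (R * R * R)%type.
Definition hx (p : heis) : R := p.1.1.
Definition hy (p : heis) : R := p.1.2.
Definition hu (p : heis) : R := p.2.
Definition im_z_cz (p q : heis) : R := hy p * hx q - hx p * hy q.
Definition hmul (p q : heis) : heis :=
  (hx p + hx q, hy p + hy q, hu p + hu q - (im_z_cz p q) / 2).
Definition hinv (p : heis) : heis := (- hx p, - hy p, - hu p).
Definition koranyi_norm (p : heis) : R :=
  Num.sqrt (Num.sqrt ((hx p ^+ 2 + hy p ^+ 2) ^+ 2 + 16 * hu p ^+ 2)).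
Definition dH (p q : heis) : R := koranyi_norm (hmul (hinv p) q).

Definition heis_inf := option heis.

(* Identification of H u {oo} with the boundary of complex hyperbolic space
   (projectivised null vectors of C^3):
     (z,u) <-> [ -|z|^2/2 - 2 i u : z : 1 ],   oo <-> [1 : 0 : 0].
   This identification is Heisenberg-equivariant and maps the horizontal
   distribution span(X,Y) to the complex tangencies of the null cone.
   [bdry_pt v] is the point of H u {oo} represented by the null vector v. *)
Definition bdry_pt (v : C3) : heis_inf :=
  if c3_3 v == czero then None
  else let w1 := cdiv (c3_1 v) (c3_3 v) in
       let w2 := cdiv (c3_2 v) (c3_3 v) in
       Some (w2.1, w2.2, - w1.2 / 2).

Definition smooth (f : R -> R) : Prop :=
  forall (n : nat) (t : R), derivable (derive1n n f) t 1.
Definition comps (g : R -> C3) : seq (R -> R) :=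
  [:: (fun t => (c3_1 (g t)).1); (fun t => (c3_1 (g t)).2);
      (fun t => (c3_2 (g t)).1); (fun t => (c3_2 (g t)).2);
      (fun t => (c3_3 (g t)).1); (fun t => (c3_3 (g t)).2)].
Definition smooth_curve (g : R -> C3) : Prop := forall f, f \in comps g -> smooth f.
Definition dcurve (g : R -> C3) (t : R) : C3 :=
  (( derive1 (fun s => (c3_1 (g s)).1) t, derive1 (fun s => (c3_1 (g s)).2) t),
   ( derive1 (fun s => (c3_2 (g s)).1) t, derive1 (fun s => (c3_2 (g s)).2) t),
   ( derive1 (fun s => (c3_3 (g s)).1) t, derive1 (fun s => (c3_3 (g s)).2) t)).

(* A T-periodic homogeneous lift [g] parametrises a smooth embedded closed
   Legendrian curve in H u {oo} = S^3:
   - g smooth, T-periodic, never zero, always null (so [g t] lies on the sphere);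
   - immersion: g'(t) is not a complex multiple of g(t) (projective velocity /= 0);
   - Legendrian: <g'(t), g(t)> = 0 (tangent to the contact distribution);
   - embedded: t |-> bdry_pt (g t) injective on [0,T). *)
Definition legendrian_knot_param (g : R -> C3) (T : R) : Prop :=
  0 < T /\
  smooth_curve g /\
  (forall t, g (t + T) = g t) /\
  (forall t, g t <> c3zero /\ is_null (g t)) /\
  (forall t (c : cpx), dcurve g t <> c3scale c (g t)) /\
  (forall t, herm (dcurve g t) (g t) = czero) /\
  (forall s t, 0 <= s < T -> 0 <= t < T -> bdry_pt (g s) = bdry_pt (g t) -> s = t).

Definition knot_of (g : R -> C3) : set heis_inf := [set bdry_pt (g t) | t in [set: R]].

Definition legendrian_knot (K : set heis_inf) : Prop :=
  exists g T, legendrian_knot_param g T /\ K = knot_of g.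

(* Heisenberg point of the parameter t (meaningful when g t is finite) *)
Definition hpt (g : R -> C3) (t : R) : heis :=
  let w1 := cdiv (c3_1 (g t)) (c3_3 (g t)) in
  let w2 := cdiv (c3_2 (g t)) (c3_3 (g t)) in
  (w2.1, w2.2, - w1.2 / 2).
Definition finite_param (g : R -> C3) : set R := [set t | c3_3 (g t) <> czero].
(* arc-length density w.r.t. the sub-Riemannian norm |.| (X, Y orthonormal):
   for a Legendrian curve the velocity is x' X + y' Y, so |gamma'| = |z'|. *)
Definition speed (g : R -> C3) (t : R) : R :=
  Num.sqrt ((derive1 (fun s => hx (hpt g s)) t) ^+ 2 +
            (derive1 (fun s => hy (hpt g s)) t) ^+ 2).

Local Open Scope ereal_scope.
(* one period of parameters, with the (null) set of parameters at oo removed *)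
Definition period_dom (g : R -> C3) (T : R) : set R := `[0%R, T[ `&` finite_param g.

Definition V_eps (g : R -> C3) (T : R) (t : R) (eps : R) : \bar R :=
  (\int[lebesgue_measure]_(s in period_dom g T `&` [set s | (eps <= dH (hpt g t) (hpt g s))%R])
      ((speed g s / (dH (hpt g t) (hpt g s)) ^+ 2)%R)%:E) - (2 / eps)%:E.

Definition V_K (g : R -> C3) (T : R) (t : R) : \bar R :=
  lim (V_eps g T t @ 0%R^'+).

Definition energy (g : R -> C3) (T : R) : \bar R :=
  \int[lebesgue_measure]_(t in period_dom g T) (V_K g T t * (speed g t)%:E).
Local Close Scope ereal_scope.

(* A complete totally geodesic totally real surface in complex hyperbolic
   2-space is (the projectivisation of the negative vectors of) a real form
   W = span_R(e1,e2,e3) of C^3 on which the Hermitian form is real; its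
   boundary at infinity is the set of points represented by nonzero null
   vectors of W. *)
Definition c_indep3 (e1 e2 e3 : C3) : Prop :=
  forall c1 c2 c3 : cpx,
    c3add (c3scale c1 e1) (c3add (c3scale c2 e2) (c3scale c3 e3)) = c3zero ->
    [/\ c1 = czero, c2 = czero & c3 = czero].
Definition real_form (e1 e2 e3 : C3) : Prop :=
  c_indep3 e1 e2 e3 /\
  (forall v w, v \in [:: e1; e2; e3] -> w \in [:: e1; e2; e3] -> (herm v w).2 = 0).
Definition R_circle (K : set heis_inf) : Prop :=
  exists e1 e2 e3 : C3, real_form e1 e2 e3 /\
    K = [set bdry_pt v | v in
          [set v | exists a1 a2 a3 : R,
             v = c3add (c3rscale a1 e1) (c3add (c3rscale a2 e2) (c3rscale a3 e3)) /\
             v <> c3zero /\ is_null v]].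

End Heis.

(* Main.v *)
Require Import Defs.
From HB Require Import structures.
From mathcomp Require Import all_boot all_order all_algebra.
From mathcomp Require Import all_classical all_reals all_analysis.
From mathcomp Require Import measurable_realfun.
From mathcomp Require Import ring lra complex.
(* [all_analysis] also defines a [cmul]; the one of [Defs] must prevail. *)
Import Defs.
Set Implicit Arguments. Unset Strict Implicit. Unset Printing Implicit Defensive.
Import Order.TTheory GRing.Theory Num.Theory.
Import numFieldNormedType.Exports.
Local Open Scope classical_set_scope.
Local Open Scope ring_scope.

(* Write [f(s,t) = <g(s), g(t)>] for the Hermitian products of a null lift [g].
   The four vectors [g s, g' s, g t, g' t] of C^3 have vanishing Gram
   determinant, which gives
     speed(s) speed(t) / d(s,t)^2 = |w(s,t)| / 2,  where w = d_s d_t log f.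
   The real part of [w] is an exact derivative: its integral outside a Koranyi
   ball of radius [eps] is [2 / eps + o(1)], up to the factor [speed(t)].  Hence
   the energy is [1/2] of the double integral of [|w| - Re w], which is
   nonnegative and vanishes iff [w] is everywhere real and positive.  The latter
   means that all the triple products <a,b><b,c><c,a> of points of the knot are
   real; then three points of the knot span a real form containing all of the
   others up to phase.  The knot thus lies in an R-circle, parametrised by its
   projection to a circle, and fills it since it is a closed injective curve. *)

(** Homogeneous lifts let knots through infinity be treated like the others: off the diagonal [kf]
    and [ww] stay regular there, and infinity enters only through the zeros of [c3_3], at most one
    parameter per period. Two gaps shape the rigidity part. Reality of [w] controls only derivatives
    of the arguments of triple products; the constant of integration is fixed at the diagonal, where
    <g s, g t> is to leading order a negative real multiple of (s - t)^2. Conversely, real triple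
    products give a real [w] but leave its sign open; as [w] never vanishes off the diagonal and
    behaves there like 2 / (s - t)^2, it is positive. The energy is bounded below without
    measurability of the potential in t: a positive constant below the integrand on an interval
    suffices. The parameter 0, at which a window around t would be cut by the end of the period, is
    discarded as a null set. *)

Lemma gram4 (K : comNzRingType) (a1 a2 a3 b1 b2 b3 c1 c2 c3 d1 d2 d3
   p1 p2 p3 q1 q2 q3 r1 r2 r3 s1 s2 s3 : K) :
  let ap := a1 * p1 + a2 * p2 + a3 * p3 in let aq := a1 * q1 + a2 * q2 + a3 * q3 in
  let ar := a1 * r1 + a2 * r2 + a3 * r3 in let as_ := a1 * s1 + a2 * s2 + a3 * s3 in
  let bp := b1 * p1 + b2 * p2 + b3 * p3 in let bq := b1 * q1 + b2 * q2 + b3 * q3 in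
  let br := b1 * r1 + b2 * r2 + b3 * r3 in let bs := b1 * s1 + b2 * s2 + b3 * s3 in
  let cp := c1 * p1 + c2 * p2 + c3 * p3 in let cq := c1 * q1 + c2 * q2 + c3 * q3 in
  let cr := c1 * r1 + c2 * r2 + c3 * r3 in let cs := c1 * s1 + c2 * s2 + c3 * s3 in
  let dp := d1 * p1 + d2 * p2 + d3 * p3 in let dq := d1 * q1 + d2 * q2 + d3 * q3 in
  let dr := d1 * r1 + d2 * r2 + d3 * r3 in let ds := d1 * s1 + d2 * s2 + d3 * s3 in
  (ap * bq - aq * bp) * (cr * ds - cs * dr) - (ap * br - ar * bp) * (cq * ds - cs * dq)
  + (ap * bs - as_ * bp) * (cq * dr - cr * dq) + (aq * br - ar * bq) * (cp * ds - cs * dp)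
  - (aq * bs - as_ * bq) * (cp * dr - cr * dp) + (ar * bs - as_ * br) * (cp * dq - cq * dp) = 0.
Proof. cbv zeta; ring. Qed.

(** * The Hermitian form of signature (2,1), null vectors and the Koranyi distance *)

Section HermitianAlgebra.
Variable R : realType.
Implicit Types (a b c : cpx R) (u v w : C3 R).

Definition csub a b : cpx R := (a.1 - b.1, a.2 - b.2).

Definition complex_of a : R[i] := Complex a.1 a.2.

Lemma complex_of_mul a b : complex_of (cmul a b) = complex_of a * complex_of b.
Proof. by []. Qed.

Lemma complex_of_add a b : complex_of (cadd a b) = complex_of a + complex_of b.
Proof. by []. Qed.

Lemma complex_of_herm u v : complex_of (herm u v) =
  complex_of (c3_1 u) * complex_of (cconj (c3_3 v)) +
  complex_of (c3_2 u) * complex_of (cconj (c3_2 v)) +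
  complex_of (c3_3 u) * complex_of (cconj (c3_1 v)).
Proof. by rewrite /herm !complex_of_add !complex_of_mul addrA. Qed.

Lemma hermC u v : herm v u = cconj (herm u v).
Proof. by rewrite /herm /cconj /cadd /cmul /=; congr pair; ring. Qed.

(** A 4 by 4 matrix of products factors through C^3, so its determinant is zero; this is its Laplace
    expansion along the first two rows. Rows and columns may come from different families of
    vectors. *)
Lemma herm_gram (u1 u2 u3 u4 v1 v2 v3 v4 : C3 R) :
  let h u v := complex_of (herm u v) in
  (h u1 v1 * h u2 v2 - h u1 v2 * h u2 v1) * (h u3 v3 * h u4 v4 - h u3 v4 * h u4 v3)
  - (h u1 v1 * h u2 v3 - h u1 v3 * h u2 v1) * (h u3 v2 * h u4 v4 - h u3 v4 * h u4 v2)
  + (h u1 v1 * h u2 v4 - h u1 v4 * h u2 v1) * (h u3 v2 * h u4 v3 - h u3 v3 * h u4 v2)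
  + (h u1 v2 * h u2 v3 - h u1 v3 * h u2 v2) * (h u3 v1 * h u4 v4 - h u3 v4 * h u4 v1)
  - (h u1 v2 * h u2 v4 - h u1 v4 * h u2 v2) * (h u3 v1 * h u4 v3 - h u3 v3 * h u4 v1)
  + (h u1 v3 * h u2 v4 - h u1 v4 * h u2 v3) * (h u3 v1 * h u4 v2 - h u3 v2 * h u4 v1) = 0.
Proof. by move=> h; rewrite /h !complex_of_herm; exact: gram4. Qed.

Lemma herm_self_im v : (herm v v).2 = 0.
Proof. by rewrite /herm /=; ring. Qed.

Lemma cnorm2_ge0 a : 0 <= cnorm2 a.
Proof. by rewrite addr_ge0 ?sqr_ge0. Qed.

Lemma cnorm2_eq0 a : cnorm2 a = 0 -> a = czero R.
Proof.
move=> /eqP; rewrite paddr_eq0 ?sqr_ge0// !sqrf_eq0 => /andP[/eqP a1 /eqP a2].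
by rewrite [a]surjective_pairing a1 a2.
Qed.

Lemma cnorm2_gt0 a : a <> czero R -> 0 < cnorm2 a.
Proof.
move=> a0; rewrite lt_neqAle cnorm2_ge0 andbT eq_sym.
by apply/eqP => /cnorm2_eq0.
Qed.

Lemma cnorm2M a b : cnorm2 (cmul a b) = cnorm2 a * cnorm2 b.
Proof. by rewrite /cnorm2 /cmul /=; ring. Qed.

Lemma cmul_eq0 a b : cmul a b = czero R -> a = czero R \/ b = czero R.
Proof.
move=> ab0; have := cnorm2M a b; rewrite ab0.
have -> : cnorm2 (czero R) = 0 by rewrite /cnorm2 /=; ring.
move=> /esym/eqP; rewrite mulf_eq0 => /orP[] /eqP /cnorm2_eq0; [by left|by right].
Qed.

(* The Gram determinant of [a, a', b, b'] vanishes because they live in C^3;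
   with the Legendrian conditions most of its entries are zero. *)
Lemma herm_velocity_det (a a' b b' : C3 R) :
  is_null a -> herm a' a = czero R -> is_null b -> herm b' b = czero R ->
  cnorm2 (csub (cmul (herm a' b') (herm a b)) (cmul (herm a' b) (herm a b'))) =
  (herm a' a').1 * (herm b' b').1 * cnorm2 (herm a b).
Proof.
rewrite /is_null => aa a'a bb b'b.
have := herm_gram a a' b b' a a' b b'; cbv beta zeta.
rewrite (hermC a' a) (hermC a b) (hermC a b') (hermC a' b) (hermC a' b') (hermC b' b).
rewrite aa a'a bb b'b.
have := herm_self_im a'; have := herm_self_im b'.
case: (herm a' a') => al ?; case: (herm b' b') => be ? /= -> ->.
case: (herm a b) => x1 x2; case: (herm a' b) => z1 z2; case: (herm a b') => y1 y2.
case: (herm a' b') => w1 w2.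
rewrite /complex_of /csub /cmul /cconj /cnorm2 /czero /= => /(congr1 (@complex.Re R)) /= H.
by apply/eqP; rewrite -subr_eq0; apply/eqP; rewrite -[RHS]H; ring.
Qed.

Lemma hermZl c u v : herm (c3scale c u) v = cmul c (herm u v).
Proof. by rewrite /herm /c3scale /cmul /cadd /cconj /=; congr pair; ring. Qed.

Lemma hermZr c u v : herm u (c3scale c v) = cmul (cconj c) (herm u v).
Proof. by rewrite /herm /c3scale /cmul /cadd /cconj /=; congr pair; ring. Qed.

Lemma hermDl u v w : herm (c3add u v) w = cadd (herm u w) (herm v w).
Proof. by rewrite /herm /c3add /cmul /cadd /cconj /=; congr pair; ring. Qed.

Lemma hermDr u v w : herm w (c3add u v) = cadd (herm w u) (herm w v).
Proof. by rewrite /herm /c3add /cmul /cadd /cconj /=; congr pair; ring. Qed.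

Lemma cdivK a b : b <> czero R -> cmul (cdiv a b) b = a.
Proof.
move=> /cnorm2_gt0 b0; rewrite /cdiv /cinv /cmul /= [RHS]surjective_pairing.
have : cnorm2 b != 0 by rewrite gt_eqF.
rewrite /cnorm2 => bn.
by congr pair; field.
Qed.

Lemma is_null_re v : is_null v ->
  (c3_2 v).1 ^+ 2 + (c3_2 v).2 ^+ 2 +
  2 * ((c3_1 v).1 * (c3_3 v).1 + (c3_1 v).2 * (c3_3 v).2) = 0.
Proof. by move=> /(congr1 fst) /=; rewrite -[in RHS]/(0:R) => <-; ring. Qed.

Lemma null_inf v : is_null v -> c3_3 v = czero R -> c3_2 v = czero R.
Proof.
move=> /is_null_re v0 v3; apply: cnorm2_eq0; move: v0.
by rewrite v3 /= !mulr0 addr0 mulr0 addr0.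
Qed.

(** In signature (2,1) the form is positive definite on the quotient of the orthogonal complement of
    a null vector by the line of that vector. *)
Lemma null_self_gt0 (a a' : C3 R) : a <> c3zero R -> is_null a ->
  herm a' a = czero R -> (forall c, a' <> c3scale c a) -> 0 < (herm a' a').1.
Proof.
move=> a0 an a'a aind.
have [a3|a3] := pselect (c3_3 a = czero R).
  have a2 := null_inf an a3.
  have a1 : c3_1 a <> czero R.
    move=> a1; apply: a0; move: a1 a2 a3; rewrite /c3_1 /c3_2 /c3_3.
    by case: a {an a'a aind} => [[? ?] ?] /= -> -> ->.
  have a'3 : c3_3 a' = czero R.
    have : cmul (c3_3 a') (cconj (c3_1 a)) = czero R.
      rewrite -a'a /herm a2 a3 /cmul /cadd /cconj /=; congr pair; ring.
    case/cmul_eq0 => // c0; exfalso; apply: a1; move: c0; rewrite /cconj /czero => -[].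
    by case: (c3_1 a) => x y /= -> /eqP; rewrite oppr_eq0 => /eqP ->.
  have a'2 : c3_2 a' <> czero R.
    move=> a'2; apply: (aind (cdiv (c3_1 a') (c3_1 a))).
    rewrite /c3scale cdivK// a2 a3.
    have m0 x : cmul x (czero R) = czero R.
      by rewrite /cmul /czero /= !mulr0 subrr addr0.
    rewrite m0 -{1}a'2 -a'3; by case: (a') => [[]].
  rewrite (_ : _.1 = cnorm2 (c3_2 a')) ?cnorm2_gt0//.
  by rewrite /herm a'3 /cnorm2 /=; ring.
(* Subtracting a multiple of [a] changes neither the orthogonality to [a] nor the self-product;
   killing the third coordinate reduces the latter to [cnorm2 (c3_2 b)]. *)
pose k := cdiv (c3_3 a') (c3_3 a).
pose b := c3add a' (c3scale (- k.1, - k.2) a).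
have b3 : c3_3 b = czero R.
  rewrite /b /c3add /c3scale {1}/c3_3; have := cdivK (c3_3 a') a3; rewrite -/k.
  clearbody k; move=> k3; rewrite [_.2]/= -k3.
  by rewrite /cmul /cadd /czero /=; congr pair; ring.
have ba : herm b a = czero R.
  rewrite /b hermDl hermZl a'a an /cmul /cadd /czero /=; congr pair; ring.
have bb : herm b b = herm a' a'.
  rewrite {2}/b hermDr hermZr ba /b hermDl hermZl (hermC a' a) a'a.
  by rewrite [RHS]surjective_pairing /cmul /cadd /cconj /czero /=; congr pair; ring.
rewrite -bb (_ : _.1 = cnorm2 (c3_2 b)); last by rewrite /herm b3 /cnorm2 /=; ring.
apply: cnorm2_gt0 => b2; apply: (aind k).
have b1 : c3_1 b = czero R.
  have : cmul (c3_1 b) (cconj (c3_3 a)) = czero R.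
    by rewrite -ba /herm b2 b3 /cmul /cadd /cconj /=; congr pair; ring.
  case/cmul_eq0 => // c0; exfalso; apply: a3; move: c0; rewrite /cconj /czero => -[].
  by case: (c3_3 a) => x y /= -> /eqP; rewrite oppr_eq0 => /eqP ->.
have E x y : cadd x (cmul (- k.1, - k.2) y) = czero R -> x = cmul k y.
  rewrite /cadd /cmul /czero /= => -[/eqP]; rewrite addr_eq0 => /eqP h1 /eqP.
  rewrite addr_eq0 => /eqP h2; rewrite [x]surjective_pairing h1 h2.
  by congr pair; ring.
move: b1 b2 b3; rewrite /b /c3add /c3scale /c3_1 /c3_2 /c3_3 /= => /E h1 /E h2 /E h3.
by rewrite -h1 -h2 -h3; case: (a') => [[]].
Qed.

(** The pointwise version of [hpt]: [hpt g t] is convertible to [affine (g t)]. *)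
Definition affine (v : C3 R) : heis R :=
  let w1 := cdiv (c3_1 v) (c3_3 v) in
  let w2 := cdiv (c3_2 v) (c3_3 v) in
  (w2.1, w2.2, - w1.2 / 2).

Lemma bdry_pt_fin v : c3_3 v <> czero R -> bdry_pt v = Some (affine v).
Proof. by move=> /eqP v3; rewrite /bdry_pt (negbTE v3). Qed.

Lemma bdry_pt_inf v : c3_3 v = czero R -> bdry_pt v = None.
Proof. by move=> v3; rewrite /bdry_pt v3 eqxx. Qed.

Lemma dH_ge0 (p q : heis R) : 0 <= dH p q.
Proof. exact: sqrtr_ge0. Qed.

Lemma dH4 (p q : heis R) : dH p q ^+ 4 =
  ((hx q - hx p) ^+ 2 + (hy q - hy p) ^+ 2) ^+ 2
  + 16 * (hu q - hu p + (hy p * hx q - hx p * hy q) / 2) ^+ 2.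
Proof.
rewrite /dH /koranyi_norm (exprM _ 2 2) sqr_sqrtr ?sqrtr_ge0// sqr_sqrtr.
  by rewrite /hmul /hinv /im_z_cz /hx /hy /hu /=; field.
by rewrite addr_ge0 ?sqr_ge0// mulr_ge0 ?sqr_ge0.
Qed.

Definition lift (p : heis R) : C3 R :=
  ((- (hx p ^+ 2 + hy p ^+ 2) / 2, - (2 * hu p)), (hx p, hy p), (1, 0)).

(** [affine] forgets the real part of the first affine coordinate; nullity restores it as minus half
    of |z|^2. *)
Lemma null_affine (a : C3 R) : is_null a -> c3_3 a <> czero R ->
  a = c3scale (c3_3 a) (lift (affine a)).
Proof.
move=> /is_null_re an a3.
have [w1 [w2 [E e1 e2]]] : exists w1 w2 : cpx R, [/\ affine a = (w2.1, w2.2, - w1.2 / 2),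
    cmul w1 (c3_3 a) = c3_1 a & cmul w2 (c3_3 a) = c3_2 a].
  by exists (cdiv (c3_1 a) (c3_3 a)), (cdiv (c3_2 a) (c3_3 a)); split=> //; exact: cdivK.
rewrite E /lift /hx /hy /hu.
have N := cnorm2_gt0 a3.
have w1E : w1.1 = - (w2.1 ^+ 2 + w2.2 ^+ 2) / 2.
  apply: (mulIf (lt0r_neq0 N)); move: an; rewrite -e1 -e2 /cmul /cnorm2 /= => an.
  by apply: (mulfI (lt0r_neq0 (ltr0Sn R 1))); lra.
rewrite [_.1.1]/= [_.1.2]/= [_.2]/=.
have -> : (- (w2.1 ^+ 2 + w2.2 ^+ 2) / 2, - (2 * (- w1.2 / 2))) = w1.
  by rewrite [RHS]surjective_pairing w1E; congr pair; field.
have mC : cmul (c3_3 a) w1 = cmul w1 (c3_3 a).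
  by rewrite /cmul; congr pair; ring.
have mC2 : cmul (c3_3 a) (w2.1, w2.2) = cmul w2 (c3_3 a).
  by rewrite /cmul; congr pair; rewrite /=; ring.
have m1 : cmul (c3_3 a) (1, 0) = c3_3 a.
  by rewrite [RHS]surjective_pairing /cmul; congr pair; rewrite /=; ring.
have -> : c3scale (c3_3 a) (w1, (w2.1, w2.2), (1, 0)) = (c3_1 a, c3_2 a, c3_3 a).
  transitivity (cmul (c3_3 a) w1, cmul (c3_3 a) (w2.1, w2.2), cmul (c3_3 a) (1, 0)) => //.
  by rewrite mC mC2 m1 e1 e2.
by case: (a) => [[]].
Qed.

(** The product of the two lifts has real part -|z - z'|^2 / 2, and its imaginary part is twice the
    vertical coordinate of p^-1 q; the factor 4 turns the squares of these into the weights 1 and 16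
    of the Koranyi norm. *)
Lemma herm_lift (p q : heis R) : 4 * cnorm2 (herm (lift p) (lift q)) = dH p q ^+ 4.
Proof.
by rewrite dH4 /herm /lift /cnorm2 /cadd /cmul /cconj /c3_1 /c3_2 /c3_3 /=; field.
Qed.

Lemma dH4_herm (a b : C3 R) : is_null a -> is_null b ->
  c3_3 a <> czero R -> c3_3 b <> czero R ->
  dH (affine a) (affine b) ^+ 4 * (cnorm2 (c3_3 a) * cnorm2 (c3_3 b)) =
  4 * cnorm2 (herm a b).
Proof.
move=> an bn a3 b3; rewrite [in RHS](null_affine an a3) [in RHS](null_affine bn b3).
rewrite hermZl hermZr !cnorm2M -herm_lift.
have -> : cnorm2 (cconj (c3_3 b)) = cnorm2 (c3_3 b) by rewrite /cnorm2 /= sqrrN.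
ring.
Qed.

Lemma dH_eq0 (p q : heis R) : dH p q = 0 -> p = q.
Proof.
move=> pq; have := dH4 p q; rewrite pq expr0n /= => /esym/eqP.
rewrite paddr_eq0; [|exact: sqr_ge0|by apply: mulr_ge0 => //; exact: sqr_ge0].
move=> /andP[].
rewrite sqrf_eq0 paddr_eq0 ?sqr_ge0// !sqrf_eq0 !subr_eq0 => /andP[/eqP x /eqP y].
rewrite mulf_eq0 pnatr_eq0 sqrf_eq0 /= x y => /eqP u; move: x y.
have {u} : hu p = hu q by lra.
rewrite /hx /hy /hu; clear pq; case: p => [[? ?] ?]; case: q => [[? ?] ?] /=.
by move=> -> -> ->.
Qed.

Lemma null_neq0 (a : C3 R) : a <> c3zero R -> is_null a -> c3_3 a = czero R ->
  c3_1 a <> czero R.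
Proof.
move=> a0 an a3 a1; apply: a0; have := null_inf an a3; move: a1 a3.
rewrite /c3_1 /c3_2 /c3_3; case: a {an} => [[? ?] ?] /= -> -> ->.
by [].
Qed.

Lemma cconj_eq0 c : cconj c = czero R -> c = czero R.
Proof. by case: c => x y [/= -> /eqP]; rewrite oppr_eq0 => /eqP ->. Qed.

(** Signature (2,1) has no isotropic plane. For finite points this is read off from [dH4_herm]: a
    zero product means distance zero. *)
Lemma null_orthogonal (a b : C3 R) : a <> c3zero R -> is_null a ->
  b <> c3zero R -> is_null b -> herm a b = czero R -> bdry_pt a = bdry_pt b.
Proof.
have inf u v : u <> c3zero R -> is_null u -> herm u v = czero R ->
    c3_3 u = czero R -> c3_3 v = czero R.
  move=> u0 un uv u3; have u2 := null_inf un u3; have u1 := null_neq0 u0 un u3.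
  have : cmul (c3_1 u) (cconj (c3_3 v)) = czero R.
    by rewrite -uv /herm u3 u2 /cmul /cadd /czero /=; congr pair; ring.
  by case/cmul_eq0 => // /cconj_eq0.
move=> a0 an b0 bn ab.
have ba : herm b a = czero R by rewrite (hermC a) ab /cconj /czero /= oppr0.
have [a3|a3] := pselect (c3_3 a = czero R).
  by rewrite !bdry_pt_inf//; exact: inf a3.
have b3 : c3_3 b <> czero R by move=> b3; apply: a3; exact: inf b3.
rewrite !bdry_pt_fin//; congr Some; apply: dH_eq0.
have := dH4_herm an bn a3 b3; rewrite ab /cnorm2 /= expr0n /= addr0 mulr0 => /eqP.
have Na := cnorm2_gt0 a3; have Nb := cnorm2_gt0 b3.
rewrite mulf_eq0 orbC gt_eqF/= ?mulr_gt0//.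
by rewrite expf_eq0 /= => /eqP.
Qed.

Lemma c3scaleA (c d : cpx R) v : c3scale c (c3scale d v) = c3scale (cmul c d) v.
Proof. by rewrite /c3scale /cmul; congr (_, _, _); congr pair; rewrite /=; ring. Qed.

Lemma c3scale1 v : c3scale (1, 0) v = v.
Proof.
case: v => [[[? ?] [? ?]] [? ?]]; rewrite /c3scale /cmul /c3_1 /c3_2 /c3_3 /=.
by congr (_, _, _); congr pair; ring.
Qed.

Lemma bdry_pt_eq (a b : C3 R) : a <> c3zero R -> is_null a ->
  b <> c3zero R -> is_null b -> bdry_pt a = bdry_pt b ->
  exists c : cpx R, a = c3scale c b.
Proof.
move=> a0 an b0 bn.
have [a3|a3] := pselect (c3_3 a = czero R).
  rewrite bdry_pt_inf// => /esym.
  have [b3 _|b3] := pselect (c3_3 b = czero R); last by rewrite bdry_pt_fin.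
  exists (cdiv (c3_1 a) (c3_1 b)); rewrite /c3scale cdivK; last exact: null_neq0.
  have m0 x : cmul x (czero R) = czero R by rewrite /cmul /czero /= !mulr0 subrr addr0.
  rewrite (null_inf bn b3) b3 m0 -{1}(null_inf an a3) -a3.
  by case: (a) => [[]].
rewrite bdry_pt_fin//.
have [b3|b3] := pselect (c3_3 b = czero R); first by rewrite bdry_pt_inf.
rewrite bdry_pt_fin// => E; have ab : affine a = affine b by exact: (Some_inj E).
exists (cdiv (c3_3 a) (c3_3 b)).
by rewrite [X in c3scale _ X](null_affine bn b3) c3scaleA cdivK// -ab -null_affine.
Qed.

Lemma bdry_pt_scale (c : cpx R) (a : C3 R) : c <> czero R ->
  bdry_pt (c3scale c a) = bdry_pt a.
Proof.
move=> c0; have E : c3_3 (c3scale c a) = cmul c (c3_3 a) by [].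
have [a3|a3] := pselect (c3_3 a = czero R).
  by rewrite !bdry_pt_inf// E a3 /cmul /czero /= !mulr0 subrr addr0.
have ca3 : cmul c (c3_3 a) <> czero R by case/cmul_eq0.
rewrite !bdry_pt_fin// /affine E.
have D (x : cpx R) : cdiv (cmul c x) (cmul c (c3_3 a)) = cdiv x (c3_3 a).
  have := cnorm2_gt0 c0; have := cnorm2_gt0 a3 => /lt0r_neq0 n1 /lt0r_neq0 n2.
  have : cnorm2 (cmul c (c3_3 a)) != 0 by rewrite cnorm2M mulf_neq0.
  move: n1 n2; rewrite /cdiv /cinv /cnorm2 /cmul /= => n1 n2 n3.
  by congr pair; field; rewrite n1 n3.
by rewrite (_ : c3_1 (c3scale c a) = cmul c (c3_1 a))// (_ : c3_2 (c3scale c a) = cmul c (c3_2 a))// !D.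
Qed.

Lemma is_null_scale (c : cpx R) (a : C3 R) : is_null a -> is_null (c3scale c a).
Proof.
rewrite /is_null hermZl hermZr => ->.
by rewrite /cmul /czero /=; congr pair; ring.
Qed.

Lemma c3scale_neq0 (c : cpx R) (a : C3 R) : c <> czero R -> a <> c3zero R ->
  c3scale c a <> c3zero R.
Proof.
move=> c0 a0 ca; apply: a0.
have := congr1 (@c3_1 R) ca; have := congr1 (@c3_2 R) ca; have := congr1 (@c3_3 R) ca.
move=> /cmul_eq0[//|h3] /cmul_eq0[//|h2] /cmul_eq0[//|h1].
have -> : a = (c3_1 a, c3_2 a, c3_3 a) by case: (a) => [[]].
by rewrite h1 h2 h3.
Qed.

Lemma herm_nondegenerate (u : C3 R) : (forall v, herm u v = czero R) -> u = c3zero R.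
Proof.
move=> u0.
have := u0 ((1, 0), czero R, czero R); have := u0 (czero R, (1, 0), czero R).
have := u0 (czero R, czero R, (1, 0)).
rewrite /herm /cadd /cmul /cconj /czero /c3zero /c3_1 /c3_2 /c3_3 /=.
case: u {u0} => [[[x1 x2] [y1 y2]] [z1 z2]] /=.
move=> -[a1 a2] [b1 b2] [c1 c2].
have -> : x1 = 0 by lra. have -> : x2 = 0 by lra. have -> : y1 = 0 by lra.
have -> : y2 = 0 by lra. have -> : z1 = 0 by lra. have -> : z2 = 0 by lra.
by [].
Qed.

(* Three pairwise non-orthogonal null vectors with real Gram matrix
   [[0,x,y],[x,0,z],[y,z,0]], of determinant 2xyz. *)
Lemma null_triple_total (e1 e2 e3 u : C3 R) (x y z : R) :
  is_null e1 -> is_null e2 -> is_null e3 ->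
  herm e1 e2 = (x, 0) -> herm e1 e3 = (y, 0) -> herm e2 e3 = (z, 0) ->
  x != 0 -> y != 0 -> z != 0 ->
  herm u e1 = czero R -> herm u e2 = czero R -> herm u e3 = czero R -> u = c3zero R.
Proof.
rewrite /is_null => n1 n2 n3 h12 h13 h23 x0 y0 z0 u1 u2 u3.
apply: herm_nondegenerate => v.
have := herm_gram e1 e2 e3 u e1 e2 e3 v; cbv beta zeta.
rewrite (hermC e1 e2) (hermC e1 e3) (hermC e2 e3) n1 n2 n3 h12 h13 h23 u1 u2 u3.
case: (herm u v) => a b; case: (herm e1 v) => ? ?; case: (herm e2 v) => ? ?; case: (herm e3 v) => ? ?; rewrite /complex_of /cconj /czero /= => H.
have := congr1 (@complex.Re R) H; have := congr1 (@complex.Im R) H; rewrite /= => Hi Hr.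
have xyz : 2 * (x * y * z) != 0 by rewrite !mulf_neq0.
by congr pair; apply: (mulfI xyz); rewrite mulr0; [rewrite -[RHS]Hr|rewrite -[RHS]Hi]; ring.
Qed.

Lemma null_triple_coord (e1 e2 e3 v : C3 R) (x y z d1 d2 d3 : R) :
  is_null e1 -> is_null e2 -> is_null e3 ->
  herm e1 e2 = (x, 0) -> herm e1 e3 = (y, 0) -> herm e2 e3 = (z, 0) ->
  x != 0 -> y != 0 -> z != 0 ->
  herm v e1 = (d1, 0) -> herm v e2 = (d2, 0) -> herm v e3 = (d3, 0) ->
  exists a1 a2 a3 : R,
    v = c3add (c3rscale a1 e1) (c3add (c3rscale a2 e2) (c3rscale a3 e3)).
Proof.
move=> n1 n2 n3 h12 h13 h23 x0 y0 z0 v1 v2 v3.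
(* These coordinates are the inverse of the Gram matrix applied to (d1, d2, d3); the difference with
   [v] is then orthogonal to the whole triple, hence zero. *)
exists ((- (z ^+ 2 * d1) + y * z * d2 + x * z * d3) / (2 * (x * y * z))).
exists ((y * z * d1 - y ^+ 2 * d2 + x * y * d3) / (2 * (x * y * z))).
exists ((x * z * d1 + x * y * d2 - x ^+ 2 * d3) / (2 * (x * y * z))).
set w := c3add _ _.
have h21 : herm e2 e1 = (x, 0) by rewrite (hermC e1) h12 /cconj /= oppr0.
have h31 : herm e3 e1 = (y, 0) by rewrite (hermC e1) h13 /cconj /= oppr0.
have h32 : herm e3 e2 = (z, 0) by rewrite (hermC e2) h23 /cconj /= oppr0.
have : c3add v (c3scale (-1, 0) w) = c3zero R.
  apply: (null_triple_total n1 n2 n3 h12 h13 h23) => //;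
  rewrite hermDl hermZl /w /c3rscale !hermDl !hermZl ?n1 ?n2 ?n3 ?h12 ?h13 ?h23 ?h21 ?h31 ?h32 ?v1 ?v2 ?v3;
  rewrite /cadd /cmul /czero /=; congr pair; field; by rewrite ?x0 ?y0 ?z0.
case: v {v1 v2 v3} => [[[? ?] [? ?]] [? ?]]; case: w => [[[? ?] [? ?]] [? ?]].
rewrite /c3add /c3scale /c3zero /cmul /cadd /czero /c3_1 /c3_2 /c3_3 /=.
by move=> [] *; congr (_, _, _); congr pair; lra.
Qed.

Lemma null_triple_indep (e1 e2 e3 : C3 R) (x y z : R) :
  is_null e1 -> is_null e2 -> is_null e3 ->
  herm e1 e2 = (x, 0) -> herm e1 e3 = (y, 0) -> herm e2 e3 = (z, 0) ->
  x != 0 -> y != 0 -> z != 0 -> c_indep3 e1 e2 e3.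
Proof.
move=> n1 n2 n3 h12 h13 h23 x0 y0 z0 c1 c2 c3 c0.
have h21 : herm e2 e1 = (x, 0) by rewrite (hermC e1) h12 /cconj /= oppr0.
have h31 : herm e3 e1 = (y, 0) by rewrite (hermC e1) h13 /cconj /= oppr0.
have h32 : herm e3 e2 = (z, 0) by rewrite (hermC e2) h23 /cconj /= oppr0.
have z0' v : herm (c3zero R) v = czero R.
  by rewrite /herm /cadd /cmul /czero /=; congr pair; ring.
have := z0' e1; have := z0' e2; have := z0' e3.
rewrite -c0 !hermDl !hermZl n1 n2 n3 h12 h13 h23 h21 h31 h32.
case: c1 {c0} => a1 b1; case: c2 => a2 b2; case: c3 => a3 b3.
rewrite /cadd /cmul /czero /= => -[p1 q1] [p2 q2] [p3 q3].
have sys (u1 u2 u3 : R) : y * u1 + z * u2 = 0 -> x * u1 + z * u3 = 0 ->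
    x * u2 + y * u3 = 0 -> [/\ u1 = 0, u2 = 0 & u3 = 0].
  move=> E1 E2 E3; have xyz : 2 * (x * y * z) != 0 by rewrite !mulf_neq0.
  split; apply: (mulfI xyz); rewrite mulr0.
  - transitivity (z * (x * (y * u1 + z * u2) - z * (x * u2 + y * u3) + y * (x * u1 + z * u3))).
      by ring.
    by rewrite E1 E2 E3; ring.
  - transitivity (y * (x * (y * u1 + z * u2) + z * (x * u2 + y * u3) - y * (x * u1 + z * u3))).
      by ring.
    by rewrite E1 E2 E3; ring.
  - transitivity (x * (- x * (y * u1 + z * u2) + z * (x * u2 + y * u3) + y * (x * u1 + z * u3))).
      by ring.
    by rewrite E1 E2 E3; ring.
have [|||-> -> ->] := sys a1 a2 a3; [lra..|].
by have [|||-> -> ->] := sys b1 b2 b3; [lra..|].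
Qed.

(* A null vector [n] of a real form is determined, up to scale, by the ratio
   of [<n,xi>] and [<n,om>]: projection of a conic from its point [om]. *)
Lemma conic_projection (n m om xi : C3 R) :
  is_null n -> is_null m -> is_null om -> herm om xi = czero R ->
  (herm xi xi).1 != 0 ->
  cmul (herm n xi) (herm m om) = cmul (herm m xi) (herm n om) ->
  (cmul (herm n m) (cmul (herm m om) (herm om n))).2 = 0 ->
  cmul (herm n m) (cmul (herm m om) (herm om n)) = czero R.
Proof.
rewrite /is_null => nn mm oo ox xx proj P0.
have := herm_gram n m om xi n m om xi; cbv beta zeta; move: P0 proj xx.
have := herm_self_im xi.
rewrite (hermC n m) (hermC n om) (hermC n xi) (hermC m om) (hermC m xi) (hermC om xi) nn mm oo ox.
case: (herm n m) => x1 x2; case: (herm m om) => p1 p2; case: (herm n om) => q1 q2.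
case: (herm n xi) => r1 r2; case: (herm m xi) => s1 s2; case: (herm xi xi) => e1 e2 /= ->.
rewrite /complex_of /cmul /cconj /czero /= => P0 [h1 h2] e0 H.
(* Since [om] is orthogonal to [xi], the Gram determinant of n, m, om, xi is 2 <xi,xi> times the
   real part of the triple product of n, m, om, plus |<n,xi><m,om> - <m,xi><n,om>|^2. The last
   square vanishes by hypothesis. *)
have := congr1 (@complex.Re R) H; rewrite /= => Hr.
rewrite P0; congr pair.
have k1 : (r1 * p1 - r2 * p2 - (s1 * q1 - s2 * q2)) ^+ 2 = 0 by rewrite h1 subrr expr0n.
have k2 : (r1 * p2 + r2 * p1 - (s1 * q2 + s2 * q1)) ^+ 2 = 0 by rewrite h2 subrr expr0n.
have e20 : 2 * e1 != 0 by rewrite mulf_neq0.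
apply: (mulfI e20); rewrite mulr0.
lra.
Qed.

End HermitianAlgebra.

(** * Derivatives and punctured limits of real functions *)

Section RealDerivatives.
Variable R : realType.
Implicit Types (f g : R -> R) (x t : R).

Lemma derC (c x : R) : is_derive x 1 (fun=> c : R) 0.
Proof. exact: is_derive_cst. Qed.

Lemma derI x : is_derive x 1 (fun s : R => s) 1.
Proof. exact: is_derive_id. Qed.

Lemma derD f g x a b : is_derive x 1 f a -> is_derive x 1 g b ->
  is_derive x 1 (fun s => f s + g s) (a + b).
Proof. exact: is_deriveD. Qed.

Lemma derB f g x a b : is_derive x 1 f a -> is_derive x 1 g b ->
  is_derive x 1 (fun s => f s - g s) (a - b).
Proof. exact: is_deriveB. Qed.

Lemma derN f x a : is_derive x 1 f a -> is_derive x 1 (fun s => - f s) (- a).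
Proof. exact: is_deriveN. Qed.

Lemma derM f g x a b : is_derive x 1 f a -> is_derive x 1 g b ->
  is_derive x 1 (fun s => f s * g s) (a * g x + f x * b).
Proof.
move=> fa gb; have := is_deriveM fa gb; move/is_derive_eq; apply.
by rewrite /GRing.scale /= addrC mulrC (mulrC a).
Qed.

Lemma derX f n x (a : R) : is_derive x 1 f a ->
  is_derive x 1 (fun s => f s ^+ n) (n%:R * f x ^+ n.-1 * a).
Proof. by move=> fa; have := is_deriveX n fa; rewrite exprfctE. Qed.

Lemma derV f x a : f x != 0 -> is_derive x 1 f a ->
  is_derive x 1 (fun s => (f s)^-1) (- a / f x ^+ 2).
Proof.
by move=> f0 fa; apply: is_derive_eq (is_deriveV f0 fa) _; rewrite /GRing.scale /= mulNr mulNr mulrC.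
Qed.

Lemma der_quot f g x a b : g x != 0 -> is_derive x 1 f a -> is_derive x 1 g b ->
  is_derive x 1 (fun s => f s / g s) ((a * g x - f x * b) / g x ^+ 2).
Proof.
move=> g0 fa gb; apply: is_derive_eq (derM fa (derV g0 gb)) _.
by field.
Qed.

Lemma der_comp f g x a b : is_derive (g x) 1 f a -> is_derive x 1 g b ->
  is_derive x 1 (fun s => f (g s)) (a * b).
Proof. exact: is_derive1_comp. Qed.

Lemma der_continuous f x a : is_derive x 1 f a -> {for x, continuous f}.
Proof. by move=> [fx _]; apply: differentiable_continuous; apply/derivable1_diffP. Qed.

Lemma der_quotient_cvg f t a : is_derive t 1 f a ->
  (f s - f t) / (s - t) @[s --> t^'] --> a.
Proof.
move=> /is_derive1_caratheodory[g [fg gc <-]].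
have /continuous_withinNx : {for t, continuous g} by [].
apply: cvg_trans; apply: near_eq_cvg.
near=> s; rewrite fg mulfK// subr_eq0.
by near: s; exact: nbhs_dnbhs_neq.
Unshelve. all: by end_near. Qed.

Lemma der_of_quotient_cvg f t a :
  (f s - f t) / (s - t) @[s --> t^'] --> a -> is_derive t 1 f a.
Proof.
move=> H; apply/is_derive1_caratheodory.
exists (fun s => if s == t then a else (f s - f t) / (s - t)); split.
- move=> z; case: eqVneq => [->|zt]; first by rewrite !subrr mulr0.
  by rewrite divfK// subr_eq0.
- apply/continuous_withinNx; rewrite eqxx; move: H.
  apply: cvg_trans; apply: near_eq_cvg.
  near=> s; rewrite ifN//.
  by near: s; exact: nbhs_dnbhs_neq.
- by rewrite eqxx.
Unshelve. all: by end_near. Qed.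

Lemma dnbhs_cvg_eq f g t (l : R) : (forall s, s != t -> f s = g s) ->
  f s @[s --> t^'] --> l -> g s @[s --> t^'] --> l.
Proof.
move=> fg; apply: cvg_trans; apply: near_eq_cvg; near=> s; rewrite fg//.
by near: s; exact: nbhs_dnbhs_neq.
Unshelve. all: by end_near. Qed.

Lemma dnbhs_cvg_eq_lim f g t (l l' : R) : (forall s, s != t -> f s = g s) -> l = l' ->
  f s @[s --> t^'] --> l -> g s @[s --> t^'] --> l'.
Proof. by move=> fg <-; exact: dnbhs_cvg_eq. Qed.

Lemma der_val f x a : is_derive x 1 f a -> f^`()%classic x = a.
Proof. by move=> fa; rewrite derive1E; exact: derive_val. Qed.

Lemma sqrt_sqrt4 (x : R) : 0 <= x -> Num.sqrt (Num.sqrt x) ^+ 4 = x.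
Proof. by move=> x0; rewrite (exprM _ 2 2) !sqr_sqrtr// sqrtr_ge0. Qed.

Lemma eq_pow4 (x y : R) : 0 <= x -> 0 <= y -> x ^+ 4 = y ^+ 4 -> x = y.
Proof. by move=> x0 y0 /eqP; rewrite eqrXn2// => /eqP. Qed.

(* L'Hopital's rule against a power of [s - t]: iterating it from the definition
   of the derivative gives Taylor expansions at [t]. *)
Lemma taylor_step f (df : R -> R) t n (l : R) : (forall s : R, is_derive s 1 f (df s)) -> f t = 0 ->
  df s / (s - t) ^+ n @[s --> t^'] --> l ->
  f s / (s - t) ^+ n.+1 @[s --> t^'] --> l / n.+1%:R.
Proof.
move=> fd f0 dfl.
pose g s := (s - t) ^+ n.+1; pose dg s := n.+1%:R * (s - t) ^+ n.
have gd (s : R) : is_derive s 1 g (dg s).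
  have h : is_derive s 1 (fun u : R => u - t) (1 - 0) := derB (derI s) (derC t s).
  by apply: is_derive_eq (derX n.+1 h) _; rewrite subr0 mulr1.
have H : df s / dg s @[s --> t^'] --> l / n.+1%:R.
  apply: dnbhs_cvg_eq (cvgM dfl (cvg_cst (n.+1%:R^-1 : R))) => s _.
  by rewrite /dg /= invfM; ring.
have fc : f s @[s --> t] --> 0 by rewrite -f0; exact: der_continuous (fd t).
have gc : g s @[s --> t] --> 0.
  rewrite -[X in _ --> X](_ : g t = 0); first exact: der_continuous (gd t).
  by rewrite /g subrr expr0n.
have gn0 s : s != t -> dg s != 0.
  by move=> st; rewrite mulf_neq0// expf_neq0// subr_eq0.
apply: (@cvg_at_right_left_dnbhs R R^o).
- apply: (@lhopital_at_right R f df g dg t (t + 1)); rewrite ?ltrDl//.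
  + exact: cvg_at_right_filter fc.
  + exact: cvg_at_right_filter gc.
  + by move=> s; rewrite in_itv/= => /andP[ts _]; rewrite gn0// gt_eqF.
  + exact: cvg_dnbhs_at_right.
- apply: (@lhopital_at_left R f df g dg (t - 1) t); rewrite ?gtrDl ?ltrN10//.
  + exact: cvg_at_left_filter fc.
  + exact: cvg_at_left_filter gc.
  + by move=> s; rewrite in_itv/= => /andP[_ ts]; rewrite gn0// lt_eqF.
  + exact: cvg_dnbhs_at_left.
Unshelve. all: by end_near. Qed.

Lemma der_sqrt f x a : 0 < f x -> is_derive x 1 f a ->
  is_derive x 1 (fun s => Num.sqrt (f s)) ((2 * Num.sqrt (f x))^-1 * a).
Proof. by move=> f0 fa; apply: der_comp fa; exact: is_derive1_sqrt. Qed.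

Lemma dnbhs_cvgW f t a : {for t, continuous f} -> f t = a -> f s @[s --> t^'] --> a.
Proof. by move=> /continuous_withinNx + <-. Qed.

Lemma dnbhs_lt (t : R) f (a c : R) : f s @[s --> t^'] --> a -> c < a ->
  exists2 eta : R, 0 < eta & forall s, s != t -> `|s - t| < eta -> c < f s.
Proof.
move=> /cvgrPdist_lt/(_ (a - c)); rewrite subr_gt0 => H ca; have := H ca.
move=> /nbhs_ballP[e /= e0 He]; exists e => // s st se.
have := He s; rewrite /ball /= distrC => /(_ se st) /=.
rewrite ltr_norml => /andP[_]; lra.
Qed.

Lemma dnbhs_dist (t : R) f (a e : R) : f s @[s --> t^'] --> a -> 0 < e ->
  exists2 eta : R, 0 < eta & forall s, s != t -> `|s - t| < eta -> `|f s - a| < e.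
Proof.
move=> /cvgrPdist_lt H e0; have := H _ e0.
move=> /nbhs_ballP[d /= d0 He]; exists d => // s st se.
by have := He s; rewrite /ball /= distrC => /(_ se st) /=; rewrite distrC.
Qed.

End RealDerivatives.

Ltac derive_step :=
  first [eassumption | exact: derC | exact: derI | eapply derD | eapply derB
        | eapply derM | eapply derN | eapply derX].
Ltac derive := repeat derive_step.

Ltac olra := repeat match goal with
  | H : ?P |- _ => lazymatch P with
    | is_true (_ <= _) => fail
    | is_true (_ < _) => fail
    | is_true (_ <= _ <= _) => fail
    | realType => fail
    | _ => clear H
    end
  end; lra.

(** * Superlevel sets of a function with a single valley *)

Lemma valley_superlevel (R : realType) (h : R -> R) (t eta a b e : R) :
  (forall x y, t <= x -> x < y -> y < t + eta -> h x < h y) ->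
  (forall x y, t - eta < x -> x < y -> y <= t -> h y < h x) ->
  t - eta < a < t -> t < b < t + eta -> h a = e -> h b = e ->
  forall s, t - eta < s < t + eta -> (e <= h s) = (s <= a) || (b <= s).
Proof.
move=> incr decr /andP[ta at_] /andP[tb bt] ha hb s /andP[ts st].
have [t_s|s_t] := leP t s.
  rewrite (lt_geF (lt_le_trans at_ t_s)) /=.
  have [bs|sb] := leP b s; last by rewrite leNgt -hb incr.
  have [->|bs'] := eqVneq s b; first by rewrite hb lexx.
  by rewrite -hb ltW// incr ?(ltW tb)// lt_neqAle eq_sym bs'.
rewrite (lt_geF (lt_trans s_t tb)) orbF.
have [sa|as_] := leP s a; last by rewrite leNgt -ha decr// ltW.
have [->|sa'] := eqVneq s a; first by rewrite ha lexx.
by rewrite -ha ltW// decr ?(ltW at_)// lt_neqAle sa'.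
Qed.

(** Near [t] the quotient N / m is a valley; at a fixed distance from [t], compactness bounds N
    below and m above, so a small level is not reached there. The inequality is written
    [e * m s <= N s], which keeps its meaning where [m] vanishes, that is at infinity. *)
Lemma sublevel_window (R : realType) (t T eta : R) (N m dN dm : R -> R) :
  0 < t < T -> 0 < eta ->
  (forall s : R, is_derive s 1 N (dN s)) -> (forall s : R, is_derive s 1 m (dm s)) ->
  (forall s, 0 <= N s) -> (forall s, 0 <= m s) -> N t = 0 ->
  (forall s, 0 <= s <= T -> s != t -> N s != 0) ->
  (forall s, `|s - t| < eta -> 0 < m s) ->
  (forall x y, t <= x -> x < y -> y < t + eta -> N x / m x < N y / m y) ->
  (forall x y, t - eta < x -> x < y -> y <= t -> N y / m y < N x / m x) ->
  forall eta0 : R, 0 < eta0 -> exists2 e0 : R, 0 < e0 &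
  forall e, 0 < e < e0 -> exists a b,
  [/\ 0 < a, t - eta0 < a < t, t < b < t + eta0, b < T &
  [/\ forall s, 0 <= s <= T -> (e * m s <= N s) = (s <= a) || (b <= s),
      0 < m a, 0 < m b, N a = e * m a & N b = e * m b]].
Proof.
move=> t0T eta_gt0 Nd md N_ge0 m_ge0 Nt N_neq0 mpos incr decr eta0.
have Nc : continuous N by move=> s; exact: der_continuous (Nd s).
have mcont : continuous m by move=> s; exact: der_continuous (md s).
move=> eta00; have /andP[t0 tT] := t0T.
pose NM s := N s / m s.
have [eta1 [eta1_gt0 l1 l2 l3 l4]] : exists eta1 : R,
    [/\ 0 < eta1, eta1 < eta, eta1 < eta0, eta1 < t & eta1 < T - t].
  exists (Num.min (Num.min eta eta0) (Num.min t (T - t)) / 2).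
  have : 0 < Num.min (Num.min eta eta0) (Num.min t (T - t)).
    by rewrite !lt_min eta_gt0 eta00 t0 subr_gt0.
  set M := Num.min _ _ => M0.
  have : M <= M by []. rewrite {2}/M !le_min => /andP[/andP[? ?] /andP[? ?]].
  by split; olra.
have NMt : NM t = 0 by rewrite /NM Nt mul0r.
have epos : 0 < NM (t + eta1) by rewrite -NMt; apply: incr => //; olra.
have eneg : 0 < NM (t - eta1) by rewrite -NMt; apply: decr => //; olra.
have i1 : 0 <= t - eta1 by olra.
have i2 : t + eta1 <= T by olra.
have [x1 + Hx1] := EVT_min i1 (continuous_subspaceT Nc).
rewrite in_itv/= => /andP[x10 x11].
have [x2 + Hx2] := EVT_min i2 (continuous_subspaceT Nc).
rewrite in_itv/= => /andP[x20 x21].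
have [x3 x3i Hx3] := EVT_max (ltW (lt_trans t0 tT)) (continuous_subspaceT mcont).
have c1 : 0 < N x1.
  rewrite lt_neqAle N_ge0 andbT eq_sym N_neq0 ?lt_eqF//; last by olra.
  by apply/andP; split; olra.
have c2 : 0 < N x2.
  rewrite lt_neqAle N_ge0 andbT eq_sym N_neq0 ?gt_eqF//; last by olra.
  by apply/andP; split; olra.
pose c := Num.min (N x1) (N x2); pose C := m x3 + 1.
have C0 : 0 < C by rewrite /C ltr_wpDl// m_ge0.
have c0 : 0 < c by rewrite lt_min c1 c2.
(* The first two bounds let the intermediate value theorem find [a] and [b] within [eta1] of [t].
   Below [c / C] one has e * m <= N farther away, as [c] bounds N from below there and [C] bounds m
   from above. *)
exists (Num.min (Num.min (NM (t + eta1)) (NM (t - eta1))) (c / C)).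
  by rewrite !lt_min epos eneg divr_gt0.
move=> e /andP[e0]; rewrite !lt_min => /andP[/andP[ep em] ec].
have NMcont x y : t - eta < x -> y < t + eta -> {within `[x, y], continuous NM}.
  move=> tx ty; apply: derivable_within_continuous => z; rewrite in_itv/= => /andP[xz zy].
  have mz : 0 < m z by apply: mpos; rewrite ltr_norml; apply/andP; split; olra.
  by have [] := der_quot (lt0r_neq0 mz) (Nd z) (md z).
have [b + NMb] : exists2 b, b \in `[t, t + eta1] & NM b = e.
  apply: IVT; [olra|by apply: NMcont; olra|].
  by rewrite NMt min_l ?max_r ?ltW.
rewrite in_itv/= => /andP[tb bE].
have [a + NMa] : exists2 a, a \in `[t - eta1, t] & NM a = e.
  apply: IVT; [olra|by apply: NMcont; olra|].
  by rewrite NMt min_r ?max_l ?ltW.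
rewrite in_itv/= => /andP[aE at_].
have {tb} tb : t < b.
  by rewrite lt_neqAle tb andbT; apply: contraTneq e0 => E; rewrite -NMb -E NMt ltxx.
have {at_} at_ : a < t.
  by rewrite lt_neqAle at_ andbT; apply: contraTneq e0 => E; rewrite -NMa E NMt ltxx.
have ma : 0 < m a by apply: mpos; rewrite ltr_norml; apply/andP; split; olra.
have mb : 0 < m b by apply: mpos; rewrite ltr_norml; apply/andP; split; olra.
exists a, b; split; [olra|apply/andP; split; olra|apply/andP; split; olra|olra|split=> //].
- move=> s /andP[s0 sT].
  have far : c <= N s -> e * m s <= N s.
    move=> cN; apply: le_trans cN.
    have : m s <= m x3 by apply: Hx3; rewrite in_itv/= s0.
    move=> ms; apply: (@le_trans _ _ (e * C)); first by rewrite ler_pM2l// /C; olra.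
    by move: ec; rewrite ltr_pdivlMr// => /ltW.
  have [s1|s1] := leP s (t - eta1).
    rewrite far; first by apply/esym/orP; left; olra.
    by rewrite ge_min Hx1// in_itv/= s0.
  have [s2|s2] := leP (t + eta1) s.
    rewrite far; first by apply/esym/orP; right; olra.
    by rewrite ge_min Hx2 ?orbT// in_itv/= s2.
  have ms : 0 < m s by apply: mpos; rewrite ltr_norml; apply/andP; split; olra.
  rewrite -ler_pdivlMr// -/(NM s).
  by apply: (valley_superlevel incr decr) => //; apply/andP; split; olra.
- by rewrite -NMa /NM divfK// gt_eqF.
- by rewrite -NMb /NM divfK// gt_eqF.
Qed.

(** * Asymptotics of distance and logarithmic derivative at the diagonal s = t *)

Section Diagonal.
Variable R : realType.
Variables (t sg : R) (F1 F2 G1 G2 m dF1 dF2 dm : R -> R).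
Hypothesis sg0 : 0 < sg.
Hypothesis dF1E : forall s : R, is_derive s 1 F1 (dF1 s).
Hypothesis dF2E : forall s : R, is_derive s 1 F2 (dF2 s).
Hypothesis dmE : forall s : R, is_derive s 1 m (dm s).
Hypothesis dm_cont : {for t, continuous dm}.
Hypothesis mt : 0 < m t.
Hypothesis m_ge0 : forall s, 0 <= m s.
Hypothesis F1t : F1 t = 0.
Hypothesis F2t : F2 t = 0.

Let v := sg / Num.sqrt (m t).
Let N s := F1 s ^+ 2 + F2 s ^+ 2.
(* In the application [F1 + i F2 = <g s, g t>], [G1 + i G2] is its derivative
   in [t], and [m s] is the squared modulus of the last coordinate of [g s]. *)
Definition log_dist_der s := (F1 s * G1 s + F2 s * G2 s) / N s.
Definition chart_dist s := Num.sqrt (Num.sqrt (4 * N s / (m t * m s))).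
(** At s = t the first term has the polar part -1 / (s - t), while [chart_dist] is equivalent to v
    |s - t|, so the second term has the polar part 1 / (s - t): the poles cancel. *)
Let Phi s := 2^-1 * log_dist_der s + Num.sg (s - t) * (v / chart_dist s).

Section Limit.
Variables (a1 a2 b1 b2 : R).
Hypothesis HF1 : (F1 s + sg ^+ 2 / 2 * (s - t) ^+ 2) / (s - t) ^+ 3 @[s --> t^'] --> a1.
Hypothesis HF2 : F2 s / (s - t) ^+ 3 @[s --> t^'] --> a2.
Hypothesis HG1 : (G1 s - sg ^+ 2 * (s - t)) / (s - t) ^+ 2 @[s --> t^'] --> b1.
Hypothesis HG2 : G2 s / (s - t) ^+ 2 @[s --> t^'] --> b2.

(** [Phi] is the difference quotient at [t] of a function [S] differentiable at [t] with S t = 0, so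
    its limit is the derivative of [S]. Third order expansions of F and second order ones of G are
    what this differentiability takes. *)
Lemma diagonal_limit : exists l : R, Phi s @[s --> t^'] --> l.
Proof.
(* The quotients by powers of s - t are extended to [t] by their limits; the Taylor hypotheses say
   exactly that these extensions are differentiable at [t]. *)
pose A1 s := if s == t then - (sg ^+ 2 / 2) else F1 s / (s - t) ^+ 2.
pose A2 s := if s == t then 0 else F2 s / (s - t) ^+ 2.
pose B1 s := if s == t then sg ^+ 2 else G1 s / (s - t).
pose B2 s := if s == t then 0 else G2 s / (s - t).
have A1d : is_derive t 1 A1 a1.
  apply: der_of_quotient_cvg; move: HF1; apply: cvg_trans; apply: near_eq_cvg.
  near=> s; have st : s != t by near: s; exact: nbhs_dnbhs_neq.
  rewrite /A1 eqxx (negbTE st); have : s - t != 0 by rewrite subr_eq0.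
  by move=> ?; field.
have A2d : is_derive t 1 A2 a2.
  apply: der_of_quotient_cvg; move: HF2; apply: cvg_trans; apply: near_eq_cvg.
  near=> s; have st : s != t by near: s; exact: nbhs_dnbhs_neq.
  rewrite /A2 eqxx (negbTE st); have : s - t != 0 by rewrite subr_eq0.
  by move=> ?; field.
have B1d : is_derive t 1 B1 b1.
  apply: der_of_quotient_cvg; move: HG1; apply: cvg_trans; apply: near_eq_cvg.
  near=> s; have st : s != t by near: s; exact: nbhs_dnbhs_neq.
  rewrite /B1 eqxx (negbTE st); have : s - t != 0 by rewrite subr_eq0.
  by move=> ?; field.
have B2d : is_derive t 1 B2 b2.
  apply: der_of_quotient_cvg; move: HG2; apply: cvg_trans; apply: near_eq_cvg.
  near=> s; have st : s != t by near: s; exact: nbhs_dnbhs_neq.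
  rewrite /B2 eqxx (negbTE st); have : s - t != 0 by rewrite subr_eq0.
  by move=> ?; field.
have A1t : A1 t = - (sg ^+ 2 / 2) by rewrite /A1 eqxx.
have A2t : A2 t = 0 by rewrite /A2 eqxx.
have B1t : B1 t = sg ^+ 2 by rewrite /B1 eqxx.
have B2t : B2 t = 0 by rewrite /B2 eqxx.
have sgn0 : sg != 0 by rewrite gt_eqF.
have mtn0 : m t != 0 by rewrite gt_eqF.
pose D s := A1 s * A1 s + A2 s * A2 s.
have Dt : D t = sg ^+ 4 / 4 by rewrite /D A1t A2t; field.
have D0 : D t != 0 by rewrite Dt mulf_neq0 ?expf_neq0 ?invr_eq0.
have [dD Dd] : exists dD, is_derive t 1 D dD by eexists; rewrite /D; derive.
have [l1 Q1] : exists l, is_derive t 1 (fun s => (A1 s * B1 s + A2 s * B2 s) / D s) l.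
  by eexists; apply: der_quot => //; derive.
(* [Q s] is the fourth power of v |s - t| / chart_dist s, written with the regular functions [m] and
   [D]. *)
pose Q s := (sg ^+ 4 * m s / m t) / (4 * D s).
have Qt : Q t = 1 by rewrite /Q Dt; field; rewrite mtn0 sgn0.
have [dQ Qd] : exists dQ, is_derive t 1 Q dQ.
  have dm' := dmE t.
  eexists; rewrite /Q; apply: der_quot; first by rewrite mulf_neq0.
have [l2 Q2] : exists l, is_derive t 1 (fun s => Num.sqrt (Num.sqrt (Q s))) l.
  eexists; apply: der_sqrt; first by rewrite Qt !sqrtr1.
  by apply: der_sqrt Qd; rewrite Qt.
(* Near [t] and away from it, [S s] is (s - t) * Phi s. *)
pose S s := 2^-1 * ((A1 s * B1 s + A2 s * B2 s) / D s) + Num.sqrt (Num.sqrt (Q s)).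
have [l Sd] : exists l, is_derive t 1 S l by eexists; rewrite /S; derive.
have St : S t = 0 by rewrite /S Dt Qt !sqrtr1 A1t A2t B1t B2t; field.
exists l; have := der_quotient_cvg Sd; apply: cvg_trans; apply: near_eq_cvg.
have := der_continuous (dmE t) => /cvgr_gt /(_ _ mt) mpos.
near=> s; have st : s != t by near: s; exact: nbhs_dnbhs_neq.
have ms : 0 < m s by near: s; exact: nbhs_dnbhs.
have rn0 : s - t != 0 by rewrite subr_eq0.
rewrite St subr0 /S /Phi mulrDl; congr (_ + _).
  rewrite /log_dist_der; have -> : D s = N s / (s - t) ^+ 4.
    by rewrite /D /N /A1 /A2 (negbTE st); field.
  rewrite /A1 /A2 /B1 /B2 (negbTE st).
  have [->|N0] := eqVneq (N s) 0; first by rewrite mul0r invr0 !mulr0 mul0r.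
  by field; rewrite N0.
have DE : D s = N s / (s - t) ^+ 4.
  by rewrite /D /N /A1 /A2 (negbTE st); field.
have N0 : 0 <= N s by rewrite addr_ge0 ?sqr_ge0.
have rE : (s - t)^-1 = Num.sg (s - t) / `|s - t|.
  have [h|h|h] := ltrgtP 0 (s - t); last by rewrite -h eqxx in rn0.
    by rewrite gtr0_sg// gtr0_norm// mul1r.
  by rewrite ltr0_sg// ltr0_norm// invrN mulN1r opprK.
rewrite rE mulrCA; congr (_ * _); apply: eq_pow4.
- by rewrite divr_ge0 ?sqrtr_ge0.
- by rewrite !divr_ge0 ?sqrtr_ge0// ltW.
rewrite /chart_dist /v expr_div_n sqrt_sqrt4; last first.
  have r4 : 0 <= (s - t) ^+ 4 by rewrite exprn_even_ge0.
  rewrite /Q DE; apply: divr_ge0; last by apply: mulr_ge0 => //; exact: divr_ge0.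
  by apply: divr_ge0 => //; apply: mulr_ge0 => //; apply: exprn_ge0; exact: ltW.
rewrite [in RHS]expr_div_n sqrt_sqrt4; last first.
  by apply: divr_ge0; apply: mulr_ge0.
rewrite expr_div_n (exprM (Num.sqrt (m t)) 2 2) sqr_sqrtr ?m_ge0//.
have -> : `|s - t| ^+ 4 = (s - t) ^+ 4 by rewrite (exprM _ 2 2) real_normK ?num_real// -exprM.
rewrite /Q DE; have [->|N1] := eqVneq (N s) 0.
  by rewrite !(mul0r, mulr0, invr0).
by field; rewrite N1 mtn0 rn0 gt_eqF.
Unshelve. all: by end_near. Qed.

End Limit.

Section Monotone.
Hypothesis Hd1 : dF1 s / (s - t) @[s --> t^'] --> - sg ^+ 2.
Hypothesis Hd2 : dF2 s / (s - t) @[s --> t^'] --> 0.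
Hypothesis Hq1 : F1 s / (s - t) ^+ 2 @[s --> t^'] --> - (sg ^+ 2 / 2).
Hypothesis Hq2 : F2 s / (s - t) ^+ 2 @[s --> t^'] --> 0.

Let NM s := N s / m s.

(** The numerator [K] of the derivative of N / m is equivalent to sg^4 * m t * (s - t)^3, hence has
    the sign of s - t. Up to the factor 4 / m t, the function N / m is the fourth power of the
    distance. *)
Lemma diagonal_monotone : exists2 eta : R, 0 < eta &
  [/\ forall s, `|s - t| < eta -> 0 < m s,
      forall x y, t <= x -> x < y -> y < t + eta -> NM x < NM y &
      forall x y, t - eta < x -> x < y -> y <= t -> NM y < NM x].
Proof.
pose K s := (2 * (F1 s * dF1 s + F2 s * dF2 s)) * m s - N s * dm s.
have NMd s : 0 < m s -> is_derive s 1 NM (K s / m s ^+ 2).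
  move=> ms; have h1 := dF1E s; have h2 := dF2E s; have h3 := dmE s.
  have : is_derive s 1 N (2 * (F1 s * dF1 s + F2 s * dF2 s)).
    apply: (is_derive_eq (derD (derX 2 h1) (derX 2 h2))).
    by rewrite /= !expr1; ring.
  by move=> /der_quot; apply => //; rewrite gt_eqF.
have mc : m s @[s --> t^'] --> m t by apply: dnbhs_cvgW => //; exact: der_continuous (dmE t).
have dmc : dm s @[s --> t^'] --> dm t by exact: dnbhs_cvgW.
have rc : s - t @[s --> t^'] --> 0.
  apply: dnbhs_cvgW; last by rewrite subrr.
  exact: der_continuous (derB (derI t) (derC t t)).
have Klim : K s / (s - t) ^+ 3 @[s --> t^'] --> sg ^+ 4 * m t.
  apply: (dnbhs_cvg_eq_lim _ _ (cvgB (cvgM (cvgM (cvg_cst (2 : R))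
    (cvgD (cvgM Hq1 Hd1) (cvgM Hq2 Hd2))) mc)
    (cvgM (cvgM (cvgD (cvgM Hq1 Hq1) (cvgM Hq2 Hq2)) rc) dmc))).
  - move=> s st; have : s - t != 0 by rewrite subr_eq0.
    by move=> rn0; rewrite !fctE /= /K /N; field.
  - by field.
have [e1 e10 He1] := dnbhs_lt Klim (mulr_gt0 (exprn_gt0 4 sg0) mt).
have [e2 e20 He2] := dnbhs_lt mc mt.
exists (Num.min e1 e2); first by rewrite lt_min e10 e20.
have mpos s : `|s - t| < Num.min e1 e2 -> 0 < m s.
  rewrite lt_min => /andP[_ se]; have [->//|st] := eqVneq s t; exact: He2.
have NMc x y : (forall s, x <= s <= y -> `|s - t| < Num.min e1 e2) ->
    {within `[x, y], continuous NM}.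
  move=> xy; apply: derivable_within_continuous => z; rewrite in_itv/= => /xy/mpos/NMd.
  by case.
split=> //.
- move=> x y tx xy ye.
  have H s : x <= s <= y -> `|s - t| < Num.min e1 e2.
    by move=> /andP[xs sy]; rewrite ger0_norm; lra.
  apply: (@gtr0_derive1_incr _ NM x y _ _ (NMc x y H) x y (lexx x) xy (lexx y)).
  + by move=> z; rewrite in_itv/= => /andP[/ltW xz /ltW zy]; case: (NMd z); rewrite ?mpos ?H ?xz.
  + move=> z; rewrite in_itv/= => /andP[xz zy].
    have zh : `|z - t| < Num.min e1 e2 by rewrite H// !ltW.
    have mz := mpos _ zh; rewrite (der_val (NMd z mz)) divr_gt0 ?exprn_gt0//.
    have tz : 0 < z - t by lra.
    have zt : z != t by rewrite -subr_eq0 gt_eqF.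
    move: zh; rewrite lt_min => /andP[zh _]; have := He1 z zt zh.
    by rewrite pmulr_lgt0// invr_gt0 exprn_gt0.
- move=> x y ex xy yt.
  have H s : x <= s <= y -> `|s - t| < Num.min e1 e2.
    by move=> /andP[xs sy]; rewrite ler0_norm; lra.
  apply: (@ltr0_derive1_decr _ NM x y _ _ (NMc x y H) x y (lexx x) xy (lexx y)).
  + by move=> z; rewrite in_itv/= => /andP[/ltW xz /ltW zy]; case: (NMd z); rewrite ?mpos ?H ?xz.
  + move=> z; rewrite in_itv/= => /andP[xz zy].
    have zh : `|z - t| < Num.min e1 e2 by rewrite H// !ltW.
    have mz := mpos _ zh; rewrite (der_val (NMd z mz)) ltr_pdivrMr ?exprn_gt0// mul0r.
    have tz : z - t < 0 by lra.
    have zt : z != t by rewrite -subr_eq0 lt_eqF.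
    move: zh; rewrite lt_min => /andP[zh _]; have := He1 z zt zh.
    rewrite nmulr_lgt0// invr_lt0 -oppr_gt0.
    rewrite (_ : - (z - t) ^+ 3 = (- (z - t)) ^+ 3); last by ring.
    by rewrite exprn_gt0// oppr_gt0.
Qed.

Variable T : R.
Hypothesis t0T : 0 < t < T.
Hypothesis N_neq0 : forall s, 0 <= s <= T -> s != t -> N s != 0.

Lemma level_sets (eta0 : R) : 0 < eta0 -> exists2 e0 : R, 0 < e0 &
  forall e, 0 < e < e0 -> exists a b,
  [/\ 0 < a, t - eta0 < a < t, t < b < t + eta0, b < T &
  [/\ forall s, 0 <= s <= T -> (e * m s <= N s) = (s <= a) || (b <= s),
      0 < m a, 0 < m b, N a = e * m a & N b = e * m b]].
Proof.
have [eta eta_gt0 [mpos incr decr]] := diagonal_monotone.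
apply: (sublevel_window t0T eta_gt0 _ dmE _ m_ge0 _ N_neq0 mpos incr decr).
- by move=> s; rewrite addr_ge0 ?sqr_ge0.
- by rewrite /N F1t F2t expr0n addr0.
Qed.

(** Both ends of the window lie at distance exactly [eps], so [Phi a - Phi b] is the quantity
    estimated here. Both values are within kap / 2 of the same limit [l], whose value is
    irrelevant. *)
Lemma truncation (l : R) : Phi s @[s --> t^'] --> l ->
  forall eta0 kap : R, 0 < eta0 -> 0 < kap ->
  exists2 eps0 : R, 0 < eps0 & forall eps, 0 < eps < eps0 -> exists a b,
  [/\ 0 < a, t - eta0 < a < t, t < b < t + eta0, b < T &
  (forall s, 0 <= s <= T -> (eps ^+ 4 * m t / 4 * m s <= N s) = (s <= a) || (b <= s)) /\
  `|2^-1 * (log_dist_der a - log_dist_der b) - 2 * v / eps| < kap].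
Proof.
move=> Phil eta0 kap eta00 kap0.
have [eta1 eta10 HPhi] := dnbhs_dist Phil (divr_gt0 kap0 (ltr0Sn R 1)).
have [|e0 e00 lev] := @level_sets (Num.min eta0 eta1); first by rewrite lt_min eta00.
(* For eps < 1 one has eps^4 <= eps, so the second bound puts the level eps^4 * m t / 4 below
   [e0]. *)
exists (Num.min 1 (4 * e0 / m t)).
  by rewrite lt_min ltr01 divr_gt0// mulr_gt0.
move=> eps /andP[eps0]; rewrite lt_min => /andP[eps1 epse].
have [|a [b [a0 /andP[]]]] := lev (eps ^+ 4 * m t / 4).
  apply/andP; split; first by rewrite divr_gt0// mulr_gt0// exprn_gt0.
  have : eps ^+ 4 <= eps by rewrite exprS ger_pMr// exprn_ile1// ltW.
  move: epse; rewrite ltr_pdivlMr// => h1 h2; rewrite ltr_pdivrMr//.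
  by have h3 := ler_wpM2r (ltW mt) h2; lra.
rewrite ltrBlDr -ltrBlDl lt_min => /andP[a1 a2] at_ /andP[tb].
rewrite -ltrBlDl lt_min => /andP[b1 b2] bT [levs ma mb Na Nb].
exists a, b; split=> //; [apply/andP; split; olra|apply/andP; split; olra|split=> //].
have cd s : 0 < m s -> N s = eps ^+ 4 * m t / 4 * m s -> chart_dist s = eps.
  move=> ms Ns; rewrite /chart_dist -/(N s) Ns.
  rewrite (_ : _ / _ = eps ^+ 4); last by field; rewrite !gt_eqF.
  by rewrite (exprM _ 2 2) sqrtr_sqr ger0_norm ?sqr_ge0// sqrtr_sqr gtr0_norm.
have := HPhi a; rewrite lt_eqF// ltr0_norm ?subr_lt0// => /(_ isT).
have := HPhi b; rewrite gt_eqF// gtr0_norm ?subr_gt0// => /(_ isT).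
rewrite /Phi (cd a)// (cd b)// gtr0_sg ?subr_gt0// ltr0_sg ?subr_lt0//.
move=> /(_ _)/[!(ltr_norml, ltrBlDr)] => h1 h2.
have b2' : b < eta1 + t by olra.
have a2' : - (a - t) < eta1 by olra.
have /andP[h3 h4] := h1 b2'; have /andP[h5 h6] := h2 a2'.
by apply/andP; split; olra.
Qed.

End Monotone.
End Diagonal.

(** * Derivatives of complex functions, of curves in C^3 and of their products *)

Section CurveDerivatives.
Variable R : realType.
Implicit Types (c d : R -> C3 R) (x t : R).

Definition is_der_cpx (a : R -> cpx R) (x : R) (a' : cpx R) : Prop :=
  is_derive x 1 (fun s => (a s).1) a'.1 /\ is_derive x 1 (fun s => (a s).2) a'.2.

Definition is_der_curve c d : Prop := forall x,
  [/\ is_der_cpx (fun s => c3_1 (c s)) x (c3_1 (d x)),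
      is_der_cpx (fun s => c3_2 (c s)) x (c3_2 (d x)) &
      is_der_cpx (fun s => c3_3 (c s)) x (c3_3 (d x))].

Lemma der_cpx_const (k : cpx R) x : is_der_cpx (fun=> k) x (czero R).
Proof. by split; exact: derC. Qed.

Lemma der_cpx_add a b x (a' b' : cpx R) : is_der_cpx a x a' -> is_der_cpx b x b' ->
  is_der_cpx (fun s => cadd (a s) (b s)) x (cadd a' b').
Proof. by move=> [a1 a2] [b1 b2]; split; apply: derD. Qed.

Lemma der_cpx_conj a x (a' : cpx R) : is_der_cpx a x a' ->
  is_der_cpx (fun s => cconj (a s)) x (cconj a').
Proof. by move=> [a1 a2]; split => //; exact: derN. Qed.

Lemma der_cpx_mul a b x (a' b' : cpx R) : is_der_cpx a x a' -> is_der_cpx b x b' ->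
  is_der_cpx (fun s => cmul (a s) (b s)) x (cadd (cmul a' (b x)) (cmul (a x) b')).
Proof.
move=> [a1 a2] [b1 b2]; split.
- by apply: is_derive_eq (derB (derM a1 b1) (derM a2 b2)) _; rewrite /=; ring.
- by apply: is_derive_eq (derD (derM a1 b2) (derM a2 b1)) _; rewrite /=; ring.
Qed.

Lemma der_cpx_eq a x (a' b' : cpx R) : is_der_cpx a x a' -> a' = b' -> is_der_cpx a x b'.
Proof. by move=> + <-. Qed.

Lemma der_cpx_div a b x (a' b' : cpx R) : b x <> czero R ->
  is_der_cpx a x a' -> is_der_cpx b x b' ->
  is_der_cpx (fun s => cdiv (a s) (b s)) x
    (cdiv (csub (cmul a' (b x)) (cmul (a x) b')) (cmul (b x) (b x))).
Proof.
move=> bx0 da [b1 b2].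
have n0 : cnorm2 (b x) != 0 by rewrite gt_eqF// cnorm2_gt0.
have dn : is_derive x 1 (fun s => cnorm2 (b s))
    (2%:R * (b x).1 ^+ 1 * b'.1 + 2%:R * (b x).2 ^+ 1 * b'.2).
  by exact: derD (derX 2 b1) (derX 2 b2).
have di : is_der_cpx (fun s => cinv (b s)) x
   (((b'.1 * cnorm2 (b x) - (b x).1 * (2%:R * (b x).1 ^+ 1 * b'.1 + 2%:R * (b x).2 ^+ 1 * b'.2)) / cnorm2 (b x) ^+ 2),
    ((- b'.2 * cnorm2 (b x) - (- (b x).2) * (2%:R * (b x).1 ^+ 1 * b'.1 + 2%:R * (b x).2 ^+ 1 * b'.2)) / cnorm2 (b x) ^+ 2)).
  split; first exact: der_quot.
  exact: der_quot (derN b2) dn.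
apply: der_cpx_eq (der_cpx_mul da di) _.
have : cnorm2 (cmul (b x) (b x)) != 0 by rewrite cnorm2M mulf_neq0.
move: n0; rewrite /cdiv /cinv /cnorm2 /cmul /cadd /csub /= => n1 n2.
by congr pair; field; rewrite n1 n2.
Qed.

Lemma herm_der c c' d d' x : is_der_curve c c' -> is_der_curve d d' ->
  is_der_cpx (fun s => herm (c s) (d s)) x
    (cadd (herm (c' x) (d x)) (herm (c x) (d' x))).
Proof.
move=> /(_ x)[c1 c2 c3] /(_ x)[d1 d2 d3].
apply: der_cpx_eq (der_cpx_add (der_cpx_mul c1 (der_cpx_conj d3))
  (der_cpx_add (der_cpx_mul c2 (der_cpx_conj d2)) (der_cpx_mul c3 (der_cpx_conj d1)))) _.
by rewrite /herm /cadd /=; congr pair; ring.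
Qed.

Lemma der_curve_const v : is_der_curve (fun=> v) (fun=> c3zero R).
Proof. by move=> x; split; exact: der_cpx_const. Qed.

Lemma herm0r (u : C3 R) : herm u (c3zero R) = czero R.
Proof. by rewrite /herm /cadd /cmul /=; congr pair; ring. Qed.

Lemma herm0l (u : C3 R) : herm (c3zero R) u = czero R.
Proof. by rewrite /herm /cadd /cmul /=; congr pair; ring. Qed.

Lemma cadd0r (a : cpx R) : cadd a (czero R) = a.
Proof. by rewrite /cadd /= !addr0 -surjective_pairing. Qed.

Lemma cadd0l (a : cpx R) : cadd (czero R) a = a.
Proof. by rewrite /cadd /= !add0r -surjective_pairing. Qed.

Lemma herm_der_l c c' v x : is_der_curve c c' ->
  is_der_cpx (fun s => herm (c s) v) x (herm (c' x) v).
Proof.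
by move=> cc; apply: der_cpx_eq (herm_der x cc (der_curve_const v)) _; rewrite herm0r cadd0r.
Qed.

Lemma herm_der_r c c' v x : is_der_curve c c' ->
  is_der_cpx (fun s => herm v (c s)) x (herm v (c' x)).
Proof.
by move=> cc; apply: der_cpx_eq (herm_der x (der_curve_const v) cc) _; rewrite herm0l cadd0l.
Qed.

Lemma smooth_dcurve c : smooth_curve c -> smooth_curve (dcurve c).
Proof.
move=> sc f; have -> : comps (dcurve c) = [seq derive1 h | h <- comps c] by [].
move=> /mapP[h /sc hs ->] n t.
by have := hs n.+1 t; rewrite /derive1n iterSr.
Qed.

Lemma smooth_is_der c : smooth_curve c -> is_der_curve c (dcurve c).
Proof.
move=> sc x.
have H h : h \in comps c -> is_derive x 1 h (derive1 h x).
  by move=> /sc /(_ 0%N x) hd; split => //; rewrite derive1E.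
by split; split; apply: H; rewrite /comps !inE eqxx ?orbT.
Qed.

Lemma taylor1 (f0 f1 : R -> R) t : (forall s : R, is_derive s 1 f0 (f1 s)) ->
  {for t, continuous f1} -> f0 t = 0 -> f0 s / (s - t) @[s --> t^'] --> f1 t.
Proof.
move=> d0 c f00.
have H : f1 s / (s - t) ^+ 0 @[s --> t^'] --> f1 t.
  apply: dnbhs_cvg_eq (dnbhs_cvgW c erefl) => s _.
  by rewrite expr0 invr1 mulr1.
by have := taylor_step d0 f00 H; rewrite divr1.
Qed.

Lemma taylor2 (f0 f1 f2 : R -> R) t : (forall s : R, is_derive s 1 f0 (f1 s)) ->
  (forall s : R, is_derive s 1 f1 (f2 s)) -> {for t, continuous f2} ->
  f0 t = 0 -> f1 t = 0 -> f0 s / (s - t) ^+ 2 @[s --> t^'] --> f2 t / 2.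
Proof.
move=> d0 d1 c f00 f10.
have H : f1 s / (s - t) ^+ 1 @[s --> t^'] --> f2 t by exact: taylor1 d1 c f10.
exact: taylor_step d0 f00 H.
Qed.

Lemma taylor3 (f0 f1 f2 f3 : R -> R) t : (forall s : R, is_derive s 1 f0 (f1 s)) ->
  (forall s : R, is_derive s 1 f1 (f2 s)) -> (forall s : R, is_derive s 1 f2 (f3 s)) ->
  {for t, continuous f3} -> f0 t = 0 -> f1 t = 0 -> f2 t = 0 ->
  f0 s / (s - t) ^+ 3 @[s --> t^'] --> f3 t / 2 / 3.
Proof.
by move=> d0 d1 d2 c f00 f10 f20; exact: (taylor_step d0 f00 (taylor2 d1 d2 c f10 f20)).
Qed.

End CurveDerivatives.

Section Algebra.
Variable R : realType.
Implicit Types (a : C3 R) (z w : cpx R).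

Lemma cmulC z w : cmul z w = cmul w z.
Proof. by rewrite /cmul; congr pair; ring. Qed.

Lemma cnorm2_div z w : w <> czero R -> cnorm2 (cdiv z w) = cnorm2 z / cnorm2 w.
Proof.
move=> w0; have n0 : cnorm2 w != 0 by rewrite gt_eqF// cnorm2_gt0.
by apply: (mulIf n0); rewrite -cnorm2M cdivK// divfK.
Qed.

(** On the left is the squared modulus of the numerator of the derivative of [c3_2 / c3_3], the
    horizontal coordinate z; this gives the arc-length speed in terms of the lift. *)
Lemma null_self_chart a (a' : C3 R) : is_null a -> herm a' a = czero R ->
  cnorm2 (csub (cmul (c3_2 a') (c3_3 a)) (cmul (c3_2 a) (c3_3 a'))) =
  (herm a' a').1 * cnorm2 (c3_3 a).
Proof.
move=> /is_null_re; case: a => [[[x1 y1] [x2 y2]] [x3 y3]].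
case: a' => [[[p1 q1] [p2 q2]] [p3 q3]].
rewrite /herm /csub /cmul /cadd /cconj /cnorm2 /c3_1 /c3_2 /c3_3 /czero /=.
move=> N [L1 L2].
apply/eqP; rewrite -subr_eq0; apply/eqP.
(* The difference of the two sides is a combination of the Legendrian relations [L1], [L2] and of
   the nullity relation [N]. *)
transitivity (- 2 * ((p1 * x3 - q1 * - y3 + (p2 * x2 - q2 * - y2 + (p3 * x1 - q3 * - y1)))
    * (x3 * p3 + y3 * q3) - (p1 * - y3 + q1 * x3 + (p2 * - y2 + q2 * x2 + (p3 * - y1 + q3 * x1)))
    * (y3 * p3 - x3 * q3)) + (p3 ^+ 2 + q3 ^+ 2) *
    (x2 ^+ 2 + y2 ^+ 2 + 2 * (x1 * x3 + y1 * y3))); first by ring.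
by rewrite N L1 L2; ring.
Qed.

End Algebra.

(** * The kernel <g s, g t> of a Legendrian knot and its derivatives *)

Section Knot.
Variables (R : realType) (g : R -> C3 R) (T : R).
Hypothesis gK : legendrian_knot_param g T.

Let g1 := dcurve g.
Let g2 := dcurve g1.
Let g3 := dcurve g2.

Lemma knot_period_gt0 : 0 < T. Proof. by case: gK. Qed.

Lemma knot_smooth : smooth_curve g. Proof. by case: gK => _ []. Qed.

Lemma knot_der1 : is_der_curve g g1.
Proof. exact: smooth_is_der knot_smooth. Qed.

Lemma knot_der2 : is_der_curve g1 g2.
Proof. exact: smooth_is_der (smooth_dcurve knot_smooth). Qed.

Lemma knot_der3 : is_der_curve g2 g3.
Proof. exact: smooth_is_der (smooth_dcurve (smooth_dcurve knot_smooth)). Qed.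

Lemma knot_der4 : is_der_curve g3 (dcurve g3).
Proof. exact: smooth_is_der (smooth_dcurve (smooth_dcurve (smooth_dcurve knot_smooth))). Qed.

Lemma knot_neq0 t : g t <> c3zero R. Proof. by case: gK => _ [_ [_ [/(_ t)[] ]]]. Qed.

Lemma knot_null t : is_null (g t). Proof. by case: gK => _ [_ [_ [/(_ t)[] ]]]. Qed.

Lemma knot_legendrian t : herm (g1 t) (g t) = czero R.
Proof. by case: gK => _ [_ [_ [_ [_ [] ]]]]. Qed.

Lemma knot_legendrian' t : herm (g t) (g1 t) = czero R.
Proof. by rewrite (hermC (g1 t)) knot_legendrian /cconj /= oppr0. Qed.

Lemma knot_periodic t : g (t + T) = g t.
Proof. by case: gK => _ [_ [+ _]]. Qed.

Lemma knot_gT : g T = g 0.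
Proof. by rewrite -[in LHS](add0r T) knot_periodic. Qed.

Lemma knot_inj s t : 0 <= s < T -> 0 <= t < T -> bdry_pt (g s) = bdry_pt (g t) -> s = t.
Proof. by case: gK => _ [_ [_ [_ [_ [_ +]]]]]; exact. Qed.

(** It depends on the lift: at a finite point it is the squared arc-length speed times |c3_3|^2
    ([speed_lift]), and it remains positive at infinity. *)
Definition speed2 t : R := (herm (g1 t) (g1 t)).1.

Lemma speed2_gt0 t : 0 < speed2 t.
Proof.
apply: (null_self_gt0 (@knot_neq0 t) (knot_null t) (knot_legendrian t)).
by case: gK => _ [_ [_ [_ [+ _]]]].
Qed.

Lemma herm_velocity t : herm (g1 t) (g1 t) = (speed2 t, 0).
Proof. by rewrite [LHS]surjective_pairing herm_self_im. Qed.

(** This is the derivative of the Legendrian condition <g', g> = 0. *)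
Lemma herm_acceleration t : herm (g2 t) (g t) = (- speed2 t, 0).
Proof.
have [d1 d2] := herm_der t knot_der2 knot_der1.
have c1 : is_derive t 1 (fun s => (herm (g1 s) (g s)).1) 0.
  by rewrite (_ : (fun _ => _) = fun=> 0); [exact: derC|apply/funext => s; rewrite knot_legendrian].
have c2 : is_derive t 1 (fun s => (herm (g1 s) (g s)).2) 0.
  by rewrite (_ : (fun _ => _) = fun=> 0); [exact: derC|apply/funext => s; rewrite knot_legendrian].
have := der_val d1; have := der_val d2; rewrite (der_val c1) (der_val c2).
rewrite herm_velocity; case: (herm (g2 t) (g t)) => x y /=; rewrite addr0 => <- /eqP.
by rewrite eq_sym addr_eq0 => /eqP ->.
Qed.

(* Subscripts denote partial derivatives of [kf]. *)
Definition kf s t := herm (g s) (g t).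
Definition kfs s t := herm (g1 s) (g t).
Definition kft s t := herm (g s) (g1 t).
Definition kfst s t := herm (g1 s) (g1 t).

Lemma kf_neq0_co s t : 0 <= s < T -> 0 <= t < T -> s != t -> kf s t <> czero R.
Proof.
move=> s0 t0 /eqP st f0; apply: st; apply: knot_inj => //.
by apply: null_orthogonal => //; [exact: knot_neq0|exact: knot_null|exact: knot_neq0|exact: knot_null].
Qed.

(** The endpoint s = T is reduced to s = 0 by periodicity, and the interior parameter [t] differs
    from both. The closed range of [s] is what integration over a period needs. *)
Lemma kf_neq0 s t : 0 <= s <= T -> 0 < t < T -> s != t -> kf s t <> czero R.
Proof.
move=> /andP[s0 sT] /andP[t0 tT] st.
have [sT'|] := ltP s T; first by apply: kf_neq0_co => //; rewrite ?s0 ?(ltW t0).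
move=> Ts; have -> : s = T by apply/eqP; rewrite eq_le sT.
rewrite /kf knot_gT; apply: kf_neq0_co; rewrite ?lexx ?knot_period_gt0 ?(ltW t0)//.
by rewrite lt_eqF.
Qed.

Lemma kf_diag t : kf t t = czero R.
Proof. exact: knot_null. Qed.

(* [ww] is the mixed logarithmic derivative of [kf]; it is, up to a phase of
   modulus one, the infinitesimal cross ratio of the knot, whose modulus is [kk]. *)
Definition ww s t := cdiv (csub (cmul (kfst s t) (kf s t)) (cmul (kfs s t) (kft s t)))
  (cmul (kf s t) (kf s t)).

Definition kk s t := Num.sqrt (speed2 s) * Num.sqrt (speed2 t) / Num.sqrt (cnorm2 (kf s t)).

Lemma kk_ge0 s t : 0 <= kk s t.
Proof. by rewrite divr_ge0 ?mulr_ge0 ?sqrtr_ge0. Qed.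

Lemma ww_norm s t : kf s t <> czero R -> (ww s t).1 ^+ 2 + (ww s t).2 ^+ 2 = kk s t ^+ 2.
Proof.
move=> f0; rewrite -/(cnorm2 (ww s t)) /ww cnorm2_div; last by case/cmul_eq0.
rewrite herm_velocity_det ?knot_null ?knot_legendrian//; last 2 first.
  exact: knot_null.
  exact: knot_null.
rewrite cnorm2M /kk !(expr_div_n, exprMn) !sqr_sqrtr ?(ltW (speed2_gt0 _)) ?cnorm2_ge0//.
rewrite -/(speed2 s) -/(speed2 t) -/(kf s t).
have : cnorm2 (kf s t) != 0 by rewrite gt_eqF// cnorm2_gt0.
by move: (speed2 s) (speed2 t) (cnorm2 (kf s t)) => p q n n0; field.
Qed.

Lemma ww_le_kk s t : kf s t <> czero R -> (ww s t).1 <= kk s t.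
Proof.
move=> /ww_norm H; apply: (le_trans (ler_norm _)).
rewrite -(ger0_norm (kk_ge0 s t)) -ler_sqr ?nnegrE// !real_normK ?num_real//.
by rewrite -H lerDl sqr_ge0.
Qed.

Lemma ww_eq_kk s t : kf s t <> czero R -> kk s t <= (ww s t).1 -> (ww s t).2 = 0.
Proof.
move=> f0 h; have E : (ww s t).1 = kk s t by apply/eqP; rewrite eq_le ww_le_kk.
apply/eqP; rewrite -sqrf_eq0; apply/eqP; apply: (addrI (kk s t ^+ 2)).
by rewrite addr0 -[in LHS]E ww_norm.
Qed.

Lemma kk_eq_ww s t : kf s t <> czero R -> (ww s t).2 = 0 -> 0 <= (ww s t).1 ->
  kk s t = (ww s t).1.
Proof.
move=> f0 w2 w1; apply/eqP; rewrite -(eqrXn2 (isT : (0 < 2)%N)) ?kk_ge0// -ww_norm//.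
by rewrite w2 expr0n addr0.
Qed.

Lemma kk_gt0 s t : kf s t <> czero R -> 0 < kk s t.
Proof.
by move=> /cnorm2_gt0 f0; rewrite divr_gt0 ?mulr_gt0 ?sqrtr_gt0 ?speed2_gt0.
Qed.

Lemma log_der_s s t : kf s t <> czero R ->
  is_der_cpx (fun s => cdiv (kft s t) (kf s t)) s (ww s t).
Proof.
move=> f0.
have d1 : is_der_cpx (fun s => kft s t) s (kfst s t) by exact: herm_der_l knot_der1.
have d2 : is_der_cpx (fun s => kf s t) s (kfs s t) by exact: herm_der_l knot_der1.
have := @der_cpx_div R (kft^~ t) (kf^~ t) s _ _ f0 d1 d2; rewrite (cmulC (kft s t)).
exact.
Qed.

Lemma log_der_t s t : kf s t <> czero R ->
  is_der_cpx (fun t => cdiv (kfs s t) (kf s t)) t (ww s t).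
Proof.
move=> f0.
have d1 : is_der_cpx (fun t => kfs s t) t (kfst s t) by exact: herm_der_r knot_der1.
have d2 : is_der_cpx (fun t => kf s t) t (kft s t) by exact: herm_der_r knot_der1.
exact: (der_cpx_div f0 d1 d2).
Qed.

Lemma speed_lift t : c3_3 (g t) <> czero R ->
  speed g t = Num.sqrt (speed2 t) / Num.sqrt (cnorm2 (c3_3 (g t))).
Proof.
move=> t3; have [d1 d2 d3] := knot_der1 t.
have [e1 e2] := der_cpx_div t3 d2 d3.
rewrite /speed (_ : (fun s => hx (hpt g s)) = (fun s => (cdiv (c3_2 (g s)) (c3_3 (g s))).1))//.
rewrite (_ : (fun s => hy (hpt g s)) = (fun s => (cdiv (c3_2 (g s)) (c3_3 (g s))).2))//.
rewrite (der_val e1) (der_val e2) -/(cnorm2 _) cnorm2_div; last by case/cmul_eq0.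
rewrite null_self_chart; [|exact: knot_null|exact: knot_legendrian].
have n0 : 0 < cnorm2 (c3_3 (g t)) by exact: cnorm2_gt0.
rewrite cnorm2M -mulf_div divff ?gt_eqF// mulr1 sqrtrM ?sqrtrV//; first exact: ltW.
exact/ltW/speed2_gt0.
Qed.

Lemma speed_gt0 t : c3_3 (g t) <> czero R -> 0 < speed g t.
Proof.
by move=> t3; rewrite speed_lift// divr_gt0// sqrtr_gt0 ?speed2_gt0 ?cnorm2_gt0.
Qed.

Let F1 t s := (kf s t).1.
Let F2 t s := (kf s t).2.
Let G1 t s := (kft s t).1.
Let G2 t s := (kft s t).2.
Let m s := cnorm2 (c3_3 (g s)).

Lemma dH_chart_dist s t : c3_3 (g s) <> czero R -> c3_3 (g t) <> czero R ->
  dH (hpt g t) (hpt g s) = chart_dist t (F1 t) (F2 t) m s.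
Proof.
move=> s3 t3; have := dH4_herm (knot_null t) (knot_null s) t3 s3.
have ms : 0 < m s by exact: cnorm2_gt0.
have mt : 0 < m t by exact: cnorm2_gt0.
move=> H; apply: eq_pow4; [exact: dH_ge0|exact: sqrtr_ge0|].
rewrite [in RHS]/chart_dist [in RHS]sqrt_sqrt4; last first.
  by rewrite divr_ge0 ?mulr_ge0 ?addr_ge0 ?sqr_ge0// ltW.
apply: (mulIf (lt0r_neq0 (mulr_gt0 mt ms))); rewrite divfK ?gt_eqF ?mulr_gt0//.
rewrite -[RHS]/(4 * cnorm2 (kf s t)) /kf (hermC (g t)) -[LHS]/(dH (affine (g t)) (affine (g s)) ^+ 4 * (m t * m s)) H.
by rewrite /cnorm2 /= sqrrN.
Qed.

Lemma log_dist_derE s t : log_dist_der (F1 t) (F2 t) (G1 t) (G2 t) s = (cdiv (kft s t) (kf s t)).1.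
Proof.
rewrite /log_dist_der /F1 /F2 /G1 /G2; case: (kf s t) => ? ?; case: (kft s t) => ? ?.
by rewrite /cdiv /cinv /cmul /cnorm2 /=; ring.
Qed.

(** As a function of [s], <g s, g t> vanishes at [t] together with its first derivative, and its
    second derivative there is the real number -<g', g'>. *)
Lemma diagonal_quotients t :
  (kf s t).1 / (s - t) ^+ 2 @[s --> t^'] --> - (speed2 t / 2) /\
  (kf s t).2 / (s - t) ^+ 2 @[s --> t^'] --> 0.
Proof.
have fL := knot_legendrian t; have fA := herm_acceleration t.
split.
- have -> : - (speed2 t / 2) = (herm (g2 t) (g t)).1 / 2 by rewrite fA /= mulNr.
  notypeclasses refine (@taylor2 R (fun s => (kf s t).1) (fun s => (kfs s t).1)
    (fun s => (herm (g2 s) (g t)).1) _ _ _ _ _ _).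
  - by move=> s; have [] := herm_der_l (g t) s knot_der1.
  - by move=> s; have [] := herm_der_l (g t) s knot_der2.
  - by have [h _] := herm_der_l (g t) t knot_der3; exact: der_continuous h.
  - by rewrite kf_diag.
  - by rewrite /kfs fL.
- have -> : 0 = (herm (g2 t) (g t)).2 / 2 by rewrite fA /= mul0r.
  notypeclasses refine (@taylor2 R (fun s => (kf s t).2) (fun s => (kfs s t).2)
    (fun s => (herm (g2 s) (g t)).2) _ _ _ _ _ _).
  - by move=> s; have [] := herm_der_l (g t) s knot_der1.
  - by move=> s; have [] := herm_der_l (g t) s knot_der2.
  - by have [_ h] := herm_der_l (g t) t knot_der3; exact: der_continuous h.
  - by rewrite kf_diag.
  - by rewrite /kfs fL.
Qed.

(* Truncating the arc-length integral at Koranyi distance [eps] removes a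
   parameter window ]a, b[; the boundary terms of the exact part cancel
   against the counterterm [2 / eps] as [eps] tends to 0. *)
Lemma knot_truncation t eta0 kap : 0 < t < T -> c3_3 (g t) <> czero R ->
  0 < eta0 -> 0 < kap ->
  exists2 eps0 : R, 0 < eps0 & forall eps, 0 < eps < eps0 -> exists a b,
  [/\ 0 < a, t - eta0 < a < t, t < b < t + eta0, b < T &
  (forall s, 0 <= s <= T -> c3_3 (g s) <> czero R ->
     (eps <= dH (hpt g t) (hpt g s)) = (s <= a) || (b <= s)) /\
  `|2^-1 * ((cdiv (kft a t) (kf a t)).1 - (cdiv (kft b t) (kf b t)).1)
    - 2 * speed g t / eps| < kap].
Proof.
move=> t0T t3 eta00 kap0.
pose sg := Num.sqrt (speed2 t).
have sg0 : 0 < sg by rewrite sqrtr_gt0 speed2_gt0.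
have sg2 : sg ^+ 2 = speed2 t by rewrite sqr_sqrtr// ltW// speed2_gt0.
have mt : 0 < m t by exact: cnorm2_gt0.
have dF v c c' : is_der_curve c c' -> forall s : R, is_derive s 1 (fun s => (herm (c s) v).1) (herm (c' s) v).1.
  by move=> cc s; have [] := herm_der_l v s cc.
have dF' v c c' : is_der_curve c c' -> forall s : R, is_derive s 1 (fun s => (herm (c s) v).2) (herm (c' s) v).2.
  by move=> cc s; have [] := herm_der_l v s cc.
pose dm s := 2%:R * (c3_3 (g s)).1 ^+ 1 * (c3_3 (g1 s)).1 + 2%:R * (c3_3 (g s)).2 ^+ 1 * (c3_3 (g1 s)).2.
have dmE (s : R) : is_derive s 1 m (dm s).
  by have [_ _ [e1 e2]] := knot_der1 s; exact: derD (derX 2 e1) (derX 2 e2).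
have dmc : {for t, continuous dm}.
  have [_ _ [e1 e2]] := knot_der1 t; have [_ _ [h1 h2]] := knot_der2 t.
  exact: der_continuous (derD (derM (derM (derC 2%:R t) (derX 1 e1)) h1)
    (derM (derM (derC 2%:R t) (derX 1 e2)) h2)).
have m_ge0 s : 0 <= m s by exact: cnorm2_ge0.
have F1t : F1 t t = 0 by rewrite /F1 kf_diag.
have F2t : F2 t t = 0 by rewrite /F2 kf_diag.
have fL := knot_legendrian t; have fL' := knot_legendrian' t.
have fA := herm_acceleration t; have fV := herm_velocity t.
have [l Phil] : exists l : R, 2^-1 * log_dist_der (F1 t) (F2 t) (G1 t) (G2 t) s +
    Num.sg (s - t) * (sg / Num.sqrt (m t) / chart_dist t (F1 t) (F2 t) m s) @[s --> t^'] --> l.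
  (* Removing the leading terms, sg^2 / 2 * (s - t)^2 with its sign from [F1] and sg^2 * (s - t)
     from [G1], leaves functions vanishing at [t] to the order that [taylor3] and [taylor2]
     require. *)
  have q (s : R) : is_derive s 1 (fun s => sg ^+ 2 / 2 * (s - t) ^+ 2) (sg ^+ 2 * (s - t)).
    by apply: is_derive_eq (derM (derC _ s) (derX 2 (derB (derI s) (derC t s)))) _; field.
  have q1 (s : R) : is_derive s 1 (fun s => sg ^+ 2 * (s - t)) (sg ^+ 2).
    by apply: is_derive_eq (derM (derC _ s) (derB (derI s) (derC t s))) _; ring.
  have HF1 : (F1 t s + sg ^+ 2 / 2 * (s - t) ^+ 2) / (s - t) ^+ 3 @[s --> t^'] -->
      ((herm (g3 t) (g t)).1 + 0) / 2 / 3.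
    notypeclasses refine (@taylor3 R (fun s => F1 t s + sg ^+ 2 / 2 * (s - t) ^+ 2)
      (fun s => (kfs s t).1 + sg ^+ 2 * (s - t))
      (fun s => (herm (g2 s) (g t)).1 + sg ^+ 2) (fun s => (herm (g3 s) (g t)).1 + 0) _ _ _ _ _ _ _ _).
    + by move=> s; exact: derD (dF _ _ _ knot_der1 s) (q s).
    + by move=> s; exact: derD (dF _ _ _ knot_der2 s) (q1 s).
    + by move=> s; exact: derD (dF _ _ _ knot_der3 s) (derC _ s).
    + exact: der_continuous (derD (dF (g t) _ _ knot_der4 t) (derC 0 t)).
    + by rewrite F1t subrr expr0n mulr0 addr0.
    + by rewrite /kfs fL subrr mulr0 addr0.
    + by rewrite fA /= sg2 addNr.
  have HF2 : F2 t s / (s - t) ^+ 3 @[s --> t^'] --> (herm (g3 t) (g t)).2 / 2 / 3.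
    notypeclasses refine (@taylor3 R (F2 t) (fun s => (kfs s t).2) (fun s => (herm (g2 s) (g t)).2)
      (fun s => (herm (g3 s) (g t)).2) _ _ _ _ _ _ _ _).
    + exact: dF' knot_der1.
    + exact: dF' knot_der2.
    + exact: dF' knot_der3.
    + exact: der_continuous (dF' (g t) _ _ knot_der4 t).
    + exact: F2t.
    + by rewrite /kfs fL.
    + by rewrite fA.
  have HG1 : (G1 t s - sg ^+ 2 * (s - t)) / (s - t) ^+ 2 @[s --> t^'] -->
      ((herm (g2 t) (g1 t)).1 - 0) / 2.
    notypeclasses refine (@taylor2 R (fun s => G1 t s - sg ^+ 2 * (s - t))
      (fun s => (kfst s t).1 - sg ^+ 2) (fun s => (herm (g2 s) (g1 t)).1 - 0) _ _ _ _ _ _).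
    + by move=> s; exact: derB (dF _ _ _ knot_der1 s) (q1 s).
    + by move=> s; exact: derB (dF _ _ _ knot_der2 s) (derC _ s).
    + exact: der_continuous (derB (dF (g1 t) _ _ knot_der3 t) (derC 0 t)).
    + by rewrite /G1 /kft fL' subrr mulr0 subr0.
    + by rewrite /kfst fV /= sg2 subrr.
  have HG2 : G2 t s / (s - t) ^+ 2 @[s --> t^'] --> (herm (g2 t) (g1 t)).2 / 2.
    notypeclasses refine (@taylor2 R (G2 t) (fun s => (kfst s t).2) (fun s => (herm (g2 s) (g1 t)).2) _ _ _ _ _ _).
    + exact: dF' knot_der1.
    + exact: dF' knot_der2.
    + exact: der_continuous (dF' (g1 t) _ _ knot_der3 t).
    + by rewrite /G2 /kft fL'.
    + by rewrite /kfst fV.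
  exact: (diagonal_limit sg0 dmE mt m_ge0 HF1 HF2 HG1 HG2).
have Hd1 : (kfs s t).1 / (s - t) @[s --> t^'] --> - sg ^+ 2.
  have -> : - sg ^+ 2 = (herm (g2 t) (g t)).1 by rewrite fA sg2.
  notypeclasses refine (@taylor1 R (fun s => (kfs s t).1) (fun s => (herm (g2 s) (g t)).1) _ _ _ _); [exact: dF knot_der2| |by rewrite /kfs fL].
  exact: der_continuous (dF _ _ _ knot_der3 t).
have Hd2 : (kfs s t).2 / (s - t) @[s --> t^'] --> 0.
  have -> : 0 = (herm (g2 t) (g t)).2 by rewrite fA.
  notypeclasses refine (@taylor1 R (fun s => (kfs s t).2) (fun s => (herm (g2 s) (g t)).2) _ _ _ _); [exact: dF' knot_der2| |by rewrite /kfs fL].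
  exact: der_continuous (dF' _ _ _ knot_der3 t).
have [Hq1 Hq2] := diagonal_quotients t.
rewrite -sg2 in Hq1.
have Nn0 s : 0 <= s <= T -> s != t -> F1 t s ^+ 2 + F2 t s ^+ 2 != 0.
  by move=> s0 st; rewrite gt_eqF// cnorm2_gt0//; exact: kf_neq0.
have [eps0 eps00 H] := truncation sg0 (dF _ _ _ knot_der1) (dF' _ _ _ knot_der1) dmE dmc
  mt m_ge0 F1t F2t Hd1 Hd2 Hq1 Hq2 t0T Nn0 Phil eta00 kap0.
exists eps0 => // eps /[dup] /andP[e0 _] /H[a [b [a0 at_ tb bT [H1 H2]]]].
exists a, b; split=> //; split; last first.
  by move: H2; rewrite !log_dist_derE (speed_lift t3).
move=> s sT s3; rewrite -H1// dH_chart_dist//.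
have ms : 0 < m s by exact: cnorm2_gt0.
set N := F1 t s ^+ 2 + F2 t s ^+ 2.
(* Fourth powers turn the condition on the distance into the polynomial level condition of
   [truncation]. *)
have -> : (eps <= chart_dist t (F1 t) (F2 t) m s) = (eps ^+ 4 <= chart_dist t (F1 t) (F2 t) m s ^+ 4).
  have c0 : 0 <= chart_dist t (F1 t) (F2 t) m s by exact: sqrtr_ge0.
  by apply/esym; rewrite ler_pXn2r// nnegrE// ltW.
rewrite /chart_dist sqrt_sqrt4; last first.
  by rewrite divr_ge0 ?mulr_ge0 ?addr_ge0 ?sqr_ge0.
rewrite ler_pdivlMr ?mulr_gt0// -/N -[RHS](ler_pM2l (_ : 0 < 4 :> R))//.
by congr (_ <= _); field.
Qed.

End Knot.


(* [f] may be non-measurable: the integral of a nonnegative function is a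
   supremum over the simple functions below it. *)
Lemma integral_ge_cst d (S : measurableType d) (R : realType)
  (nu : {measure set S -> \bar R}) (D A : set S) (f : S -> \bar R) (c : R) :
  (forall x, D x -> (0 <= f x)%E) -> measurable A -> A `<=` D -> 0 <= c ->
  (forall x, A x -> (c%:E <= f x)%E) -> (c%:E * nu A <= \int[nu]_(x in D) f x)%E.
Proof.
move=> f0 mA AD c0 fc; rewrite integral_mkcond ge0_integralTE; last first.
  by move=> x; rewrite patchE; case: ifPn => // /set_mem; exact: f0.
apply: ereal_sup_ubound; exists (scale_nnsfun (indic_nnsfun R mA) c0).
  move=> x /=; rewrite patchE; case: ifPn => [/set_mem Dx|xD].
    rewrite mindicE; have [/set_mem Ax|xA] := boolP (x \in A); last by rewrite mulr0 f0.
    by rewrite mulr1; exact: fc.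
  rewrite mindicE (negbTE (_ : x \notin A)) ?mulr0//.
  by apply: contraNN xD => /set_mem /AD Dx; rewrite inE.
transitivity (sintegral nu (cst c \* HBNNSimple.NonNegSimpleFun.sort (indic_nnsfun R mA))) => //.
by rewrite sintegralrM sintegral_indic.
Qed.

Section LowerIntegral.
Variable R : realType.
Local Notation mu := (@lebesgue_measure R).
Local Open Scope ereal_scope.

(** A single point is Lebesgue null. This disposes of the parameter 0, about which the interior
    estimates say nothing. *)
Lemma integral_point (D : set R) (f : R -> \bar R) (p : R) :
  (forall x, D x -> x != p -> f x = 0) -> \int[mu]_(x in D) f x = 0.
Proof.
move=> f0; rewrite integral_mkcond.
rewrite (_ : f \_ D = (f \_ D) \_ [set p]); first by rewrite -integral_mkcond integral_set1.
apply/funext => x; rewrite !patchE; case: ifPn => [/set_mem Dx|_]; last by case: ifP.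
case: ifPn => // xp; apply: f0 => //; move: xp.
by apply: contraNN => /eqP ->; rewrite inE.
Qed.

End LowerIntegral.

Lemma dHxx (R : realType) (p : heis R) : dH p p = 0.
Proof.
have := dH4 p p; rewrite !subrr (mulrC (hy p) (hx p)) subrr mul0r !expr0n addr0 expr0n mulr0 addr0.
by move=> /eqP; rewrite expf_eq0 => /eqP.
Qed.

(** * The regularised potential at an interior finite parameter *)

Section Potential.
Variables (R : realType) (g : R -> C3 R) (T : R).
Hypothesis gK : legendrian_knot_param g T.
Local Notation mu := (@lebesgue_measure R).

Lemma speed2_der (s : R) : exists d : R, is_derive s 1 (speed2 g) d.
Proof.
have [d _] := herm_der s (knot_der2 gK) (knot_der2 gK).
by eexists; exact: d.
Qed.

Lemma kk_der (s t : R) : kf g s t <> czero R -> exists d : R, is_derive s 1 (fun s => kk g s t) d.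
Proof.
move=> f0; have n0 := cnorm2_gt0 f0.
have [d1 H1] := speed2_der s.
have [e1 e2] := herm_der_l (g t) s (knot_der1 gK).
have H2 := derD (derX 2 e1) (derX 2 e2).
have H3 := der_sqrt (speed2_gt0 gK s) H1.
have H4 := @der_sqrt R (fun s => cnorm2 (kf g s t)) s _ n0 H2.
have n1 : Num.sqrt (cnorm2 (kf g s t)) != 0 by rewrite gt_eqF// sqrtr_gt0.
have H5 := derM H3 (derC (Num.sqrt (speed2 g t)) s).
eexists.
exact: (@der_quot R (fun s => Num.sqrt (speed2 g s) * Num.sqrt (speed2 g t))
  (fun s => Num.sqrt (cnorm2 (kf g s t))) s _ _ n1 H5 H4).
Qed.

Lemma der_cpx_sub (a b : R -> cpx R) x (a' b' : cpx R) : is_der_cpx a x a' -> is_der_cpx b x b' ->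
  is_der_cpx (fun s => csub (a s) (b s)) x (csub a' b').
Proof. by move=> [a1 a2] [b1 b2]; split; apply: derB. Qed.

Lemma ww_der s t : kf g s t <> czero R -> exists d, is_der_cpx (fun s => ww g s t) s d.
Proof.
move=> f0.
have d1 : is_der_cpx (fun s => kfst g s t) s _ := herm_der_l (dcurve g t) s (knot_der2 gK).
have d2 : is_der_cpx (fun s => kf g s t) s _ := herm_der_l (g t) s (knot_der1 gK).
have d3 : is_der_cpx (fun s => kfs g s t) s _ := herm_der_l (g t) s (knot_der2 gK).
have d4 : is_der_cpx (fun s => kft g s t) s _ := herm_der_l (dcurve g t) s (knot_der1 gK).
have n0 : cmul (kf g s t) (kf g s t) <> czero R by case/cmul_eq0.
have H := @der_cpx_div R (fun s => csub (cmul (kfst g s t) (kf g s t)) (cmul (kfs g s t) (kft g s t)))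
  (fun s => cmul (kf g s t) (kf g s t)) s _ _ n0
  (der_cpx_sub (der_cpx_mul d1 d2) (der_cpx_mul d3 d4)) (der_cpx_mul d2 d2).
by eexists; exact: H.
Qed.

(** Embeddedness: infinity is visited at most once per period. If it is not visited, the condition
    is vacuous and 0 serves as [tau]. *)
Lemma inf_param_unique : exists tau : R, forall s, 0 <= s < T -> c3_3 (g s) = czero R -> s = tau.
Proof.
have [[tau t0 t3]|H] := pselect (exists2 tau, 0 <= tau < T & c3_3 (g tau) = czero R).
  exists tau => s s0 s3; apply: (knot_inj gK) => //.
  by rewrite !bdry_pt_inf.
by exists 0 => s s0 s3; exfalso; apply: H; exists s.
Qed.

Lemma measurable_period_dom : measurable (period_dom g T).
Proof.
rewrite /period_dom; apply: measurableI => //.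
pose m s := cnorm2 (c3_3 (g s)).
have -> : finite_param g = m @^-1` (~` [set 0]).
  apply/seteqP; split => s /= s3 => [m0|s0]; first by apply: s3; exact: cnorm2_eq0.
  by apply: s3; rewrite /m s0 /cnorm2 /= expr0n addr0.
have mc : continuous m.
  move=> s; have [_ _ [e1 e2]] := knot_der1 gK s.
  exact: der_continuous (derD (derX 2 e1) (derX 2 e2)).
have mm : measurable_fun setT m by exact: continuous_measurable_fun.
rewrite -[X in measurable X]setTI; apply: mm => //.
by apply: measurableC; exact: measurable_set1.
Qed.

Variable t : R.
Hypothesis t0T : 0 < t < T.
Hypothesis t3 : c3_3 (g t) <> czero R.
Let v := speed g t.

Let v_gt0 : 0 < v. Proof. exact: (speed_gt0 gK). Qed.

(** What remains of the integrand speed / dH^2, equal to kk / (2 v), once the exact part Re w / (2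
    v) is removed. *)
Definition defect s := (kk g s t - (ww g s t).1) / (2 * v).

Lemma defect_ge0 s : 0 <= s <= T -> s != t -> 0 <= defect s.
Proof.
move=> s0 st; rewrite divr_ge0 ?mulr_ge0 ?(ltW v_gt0)// subr_ge0.
by apply: (ww_le_kk gK); exact: (kf_neq0 gK).
Qed.

Definition far_params eps := period_dom g T `&` [set s | eps <= dH (hpt g t) (hpt g s)].

Definition defect_int eps := (\int[mu]_(s in far_params eps) (defect s)%:E)%E.

Lemma speed_over_dH s : c3_3 (g s) <> czero R ->
  speed g s / dH (hpt g t) (hpt g s) ^+ 2 = kk g s t / (2 * v).
Proof.
move=> s3; rewrite /v !(speed_lift gK)//.
have mt := cnorm2_gt0 t3; have ms := cnorm2_gt0 s3.
have /= := dH4_herm (knot_null gK t) (knot_null gK s) t3 s3.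
have -> : cnorm2 (herm (g t) (g s)) = cnorm2 (kf g s t).
  by rewrite (hermC (g s)) /cnorm2 /= sqrrN.
rewrite -/(hpt g t) -/(hpt g s) /kk => H.
set A := Num.sqrt (cnorm2 (c3_3 (g s))); set B := Num.sqrt (cnorm2 (c3_3 (g t))).
have A0 : 0 < A by rewrite sqrtr_gt0.
have B0 : 0 < B by rewrite sqrtr_gt0.
set F := Num.sqrt (cnorm2 (kf g s t)).
have F0 : 0 <= F by exact: sqrtr_ge0.
have E : dH (hpt g t) (hpt g s) ^+ 2 = 2 * F / (A * B).
  apply/eqP; rewrite -(eqrXn2 (isT : (0 < 2)%N)) ?sqr_ge0//; last first.
    by rewrite divr_ge0 ?mulr_ge0// ltW.
  rewrite -exprM !(expr_div_n, exprMn) !sqr_sqrtr ?cnorm2_ge0//.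
  rewrite -[X in _ == X](mulfK (_ : cnorm2 (c3_3 (g t)) * cnorm2 (c3_3 (g s)) != 0)); last first.
    by rewrite mulf_neq0// gt_eqF.
  apply/eqP; apply: (mulIf (_ : cnorm2 (c3_3 (g t)) * cnorm2 (c3_3 (g s)) != 0)).
    by rewrite mulf_neq0// gt_eqF.
  by rewrite H; field; rewrite !gt_eqF.
have st0 : 0 < Num.sqrt (speed2 g t) by rewrite sqrtr_gt0 (speed2_gt0 gK).
(* At coinciding points both sides are 0 through the convention 0^-1 = 0. *)
rewrite E; have [->|F1] := eqVneq F 0; first by rewrite !(mulr0, mul0r, invr0).
by field; rewrite F1 !gt_eqF.
Qed.

Lemma within_kk a b : (forall s, a <= s <= b -> 0 <= s <= T /\ s != t) ->
  {within `[a, b], continuous (fun s => kk g s t / (2 * v))} /\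
  {within `[a, b], continuous (fun s => (ww g s t).1 / (2 * v))}.
Proof.
move=> ab; split; apply: derivable_within_continuous => s; rewrite in_itv/= => /ab[s0 st].
  have [d H] := kk_der (kf_neq0 gK s0 t0T st).
  by have [] := derM H (derC (2 * v)^-1 s).
have [d [H _]] := ww_der (kf_neq0 gK s0 t0T st).
by have [] := derM H (derC (2 * v)^-1 s).
Qed.

Lemma ww_integral a b : a < b -> (forall s, a <= s <= b -> 0 <= s <= T /\ s != t) ->
  (\int[mu]_(s in `[a, b]) ((ww g s t).1 / (2 * v))%:E =
   (((cdiv (kft g b t) (kf g b t)).1 - (cdiv (kft g a t) (kf g a t)).1) / (2 * v))%:E)%E.
Proof.
move=> ab H; pose L s := (cdiv (kft g s t) (kf g s t)).1 / (2 * v).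
have Ld s : a <= s <= b -> is_derive s 1 L ((ww g s t).1 / (2 * v)).
  move=> /H[s0 st]; have [d _] := log_der_s gK (kf_neq0 gK s0 t0T st).
  by apply: (is_derive_eq (derM d (derC (2 * v)^-1 s))); rewrite mulr0 addr0.
rewrite mulrBl EFinB; have [_ wc] := within_kk H.
apply: (@continuous_FTC2 R _ L) => //.
- split.
  + by move=> s; rewrite in_itv/= => /andP[/ltW as_ /ltW sb]; case: (Ld s); rewrite ?as_.
  + apply: cvg_at_right_filter; apply: der_continuous (Ld a _); by rewrite lexx ltW.
  + apply: cvg_at_left_filter; apply: der_continuous (Ld b _); by rewrite lexx ltW.
- move=> s; rewrite in_itv/= => /andP[/ltW as_ /ltW sb]; apply: der_val; apply: Ld.
  by rewrite as_.
Qed.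

Section Window.
Variables (eps a b : R).
Hypothesis a_gt0 : 0 < a.
Hypothesis a_lt : a < t.
Hypothesis b_gt : t < b.
Hypothesis b_lt : b < T.
Hypothesis win : forall s, 0 <= s <= T -> c3_3 (g s) <> czero R ->
  (eps <= dH (hpt g t) (hpt g s)) = (s <= a) || (b <= s).

Let B : set R := `[0, a] `|` `[b, T].

Lemma far_params_window : far_params eps = `[0, T[ `&` finite_param g `&` B.
Proof.
apply/seteqP; split => s.
- move=> [[s0 s3] /= h]; split => //; move: s0; rewrite /= in_itv/= => /andP[s0 sT].
  have := win _ s3; rewrite h s0 (ltW sT) => /(_ isT)/esym/orP[sa|bs].
    by left; rewrite /= in_itv/= s0.
  by right; rewrite /= in_itv/= bs ltW.
- move=> [[s0 s3] sB]; split => //=; move: s0; rewrite /= in_itv/= => /andP[s0 sT].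
  rewrite win ?s0 ?(ltW sT)//; case: sB => /=; rewrite in_itv/= => /andP[h1 h2].
    by rewrite h2.
  by rewrite h1 orbT.
Qed.

Lemma measurable_far_params : measurable (far_params eps).
Proof.
rewrite far_params_window; apply: measurableI; first exact: measurable_period_dom.
by apply: measurableU.
Qed.

Lemma window_measurable (phi : R -> R) : {within `[0, a], continuous phi} ->
  {within `[b, T], continuous phi} -> measurable_fun B (EFin \o phi).
Proof.
move=> c1 c2; apply/measurable_funU => //.
by split; apply/measurable_EFinP; exact: subspace_continuous_measurable_fun.
Qed.

Lemma far_params_sub : far_params eps `<=` B.
Proof. by rewrite far_params_window => s []. Qed.

Let lowside s : 0 <= s <= a -> 0 <= s <= T /\ s != t.
Proof. move=> /andP[s0 sa]; have st := le_lt_trans sa a_lt; split; last by rewrite lt_eqF.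
by rewrite s0 ltW// (lt_trans st)//; case/andP: t0T. Qed.

Let highside s : b <= s <= T -> 0 <= s <= T /\ s != t.
Proof. move=> /andP[bs sT]; have ts := lt_le_trans b_gt bs; split; last by rewrite gt_eqF.
by rewrite sT andbT ltW// (lt_trans _ ts)//; case/andP: t0T. Qed.

Let Bside s : B s -> 0 <= s <= T /\ s != t.
Proof. by case => /=; rewrite in_itv/=; [exact: lowside|exact: highside]. Qed.

Lemma window_integral (phi : R -> R) : {within `[0, a], continuous phi} ->
  {within `[b, T], continuous phi} -> (forall s, B s -> 0 <= phi s) ->
  (\int[mu]_(s in far_params eps) (phi s)%:E =
   \int[mu]_(s in `[0%R, a]) (phi s)%:E + \int[mu]_(s in `[b, T]) (phi s)%:E)%E.
Proof.
move=> c1 c2 phi0; have mphi := window_measurable c1 c2.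
have [tau Htau] := inf_param_unique.
rewrite -(ge0_integral_setU mu _ _ mphi)//; last first.
  apply/disj_setPS => s [] /=; rewrite !in_itv/= => /andP[_ sa] /andP[bs _].
  by have := lt_trans (le_lt_trans sa a_lt) (lt_le_trans b_gt bs); rewrite ltxx.
(* The far parameters differ from the two closed intervals only by the parameter of infinity and by
   the end [T] of the half-open period. *)
pose N : set R := [set tau] `|` [set T].
have mN : measurable N by apply: measurableU; exact: measurable_set1.
have N0 : mu N = 0%E.
  by apply: countable_lebesgue_measure0; apply: finite_set_countable; exact: finite_set2.
have mB : measurable B by exact: measurableU.
have phiB s : B s -> (0 <= (EFin \o phi) s)%E by move=> Bs; rewrite lee_fin phi0.
rewrite (@ge0_negligible_integral _ _ R mu B N (EFin \o phi) mN mB mphi phiB N0).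
rewrite (@ge0_negligible_integral _ _ R mu (far_params eps) N (EFin \o phi) mN
  measurable_far_params (measurable_funS mB far_params_sub mphi) _ N0); last first.
  by move=> s /far_params_sub; exact: phiB.
congr (integral _ _ _); apply/seteqP; split => s [sA sN]; split => //.
  exact: far_params_sub.
rewrite far_params_window; split => //; split.
  have : 0 <= s <= T.
    by have [] := Bside sA.
  move=> /andP[s0 sT]; rewrite /= in_itv/= s0 lt_neqAle sT andbT.
  by apply/eqP => sT'; apply: sN; right.
move=> s3; have sT : s != T by apply/eqP => E; apply: (sN); right.
apply: (sN); left => /=; apply: Htau => //.
by have [/andP[-> sT'] _] := Bside sA; rewrite lt_neqAle sT.
Qed.

Let defect_within x y : (forall s, x <= s <= y -> 0 <= s <= T /\ s != t) ->
  {within `[x, y], continuous defect}.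
Proof.
move=> /within_kk[k w].
have -> : defect = (fun s => kk g s t / (2 * v)) - (fun s => (ww g s t).1 / (2 * v)).
  by apply/funext => s; rewrite /defect mulrBl.
exact: within_continuousB.
Qed.

Lemma defect_measurable : measurable_fun (far_params eps) (EFin \o defect).
Proof.
apply: (measurable_funS _ far_params_sub); first exact: measurableU.
by apply: window_measurable; apply: defect_within; [exact: lowside|exact: highside].
Qed.

Lemma defect_int_window : defect_int eps =
  (\int[mu]_(s in `[0%R, a]) (defect s)%:E + \int[mu]_(s in `[b, T]) (defect s)%:E)%E.
Proof.
apply: window_integral; [exact/defect_within/lowside|exact/defect_within/highside|].
by move=> s /Bside[s0 st]; exact: defect_ge0.
Qed.

Let defect_fin x y : (forall s, x <= s <= y -> 0 <= s <= T /\ s != t) ->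
  (\int[mu]_(s in `[x, y]) (defect s)%:E)%E \is a fin_num.
Proof.
move=> /defect_within c; apply: integrable_fin_num => //.
by apply: continuous_compact_integrable => //; exact: segment_compact.
Qed.

Lemma defect_int_fin : defect_int eps \is a fin_num.
Proof.
by rewrite defect_int_window fin_numD !defect_fin.
Qed.

Let kk_split x y : x < y -> (forall s, x <= s <= y -> 0 <= s <= T /\ s != t) ->
  (\int[mu]_(s in `[x, y]) (kk g s t / (2 * v))%:E =
   \int[mu]_(s in `[x, y]) (defect s)%:E +
   (((cdiv (kft g y t) (kf g y t)).1 - (cdiv (kft g x t) (kf g x t)).1) / (2 * v))%:E)%E.
Proof.
move=> xy H; rewrite -ww_integral//; have [_ w] := within_kk H.
rewrite -integralD_EFin//; last 2 first.
- by apply: continuous_compact_integrable; [exact: segment_compact|exact: defect_within].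
- by apply: continuous_compact_integrable => //; exact: segment_compact.
by apply: eq_integral => s _; rewrite -EFinD /defect -mulrDl subrK.
Qed.

Lemma V_eps_window : V_eps g T t eps = (defect_int eps +
  ((2^-1 * ((cdiv (kft g a t) (kf g a t)).1 - (cdiv (kft g b t) (kf g b t)).1)
    - 2 * v / eps) / v)%:E)%E.
Proof.
have -> : V_eps g T t eps =
    (\int[mu]_(s in far_params eps) (kk g s t / (2 * v))%:E - (2 / eps)%:E)%E.
  congr (_ - _)%E; apply: eq_integral => s /set_mem[[_ s3] _].
  by rewrite speed_over_dH.
have [k1 _] := within_kk lowside; have [k2 _] := within_kk highside.
rewrite window_integral//; last first.
  by move=> s _; rewrite divr_ge0 ?(kk_ge0 gK)// mulr_ge0// ltW.
rewrite kk_split// kk_split//.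
rewrite defect_int_window -(fineK (defect_fin lowside)) -(fineK (defect_fin highside)).
rewrite -!EFinD; congr EFin.
(* By periodicity the boundary terms at 0 and T cancel, which leaves those at [a] and [b]. *)
have kftT : kft g T t = kft g 0 t by rewrite /kft (knot_gT gK).
have kfT : kf g T t = kf g 0 t by rewrite /kf (knot_gT gK).
rewrite kftT kfT.
have v0 : v != 0 by rewrite gt_eqF.
(* For eps = 0 the counterterm is 0 on both sides, by the convention on inverses. *)
have [->|e0] := eqVneq eps 0; first by rewrite invr0 !mulr0; field.
by field; rewrite v0.
Qed.

End Window.

Lemma V_eps_defect (eta0 kap : R) : 0 < eta0 -> 0 < kap ->
  exists2 eps0 : R, 0 < eps0 & forall eps, 0 < eps < eps0 -> exists a b r,
  [/\ 0 < a, t - eta0 < a < t, t < b < t + eta0, b < T &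
  [/\ (forall s, 0 <= s <= T -> c3_3 (g s) <> czero R ->
        (eps <= dH (hpt g t) (hpt g s)) = (s <= a) || (b <= s)),
      V_eps g T t eps = (defect_int eps + r%:E)%E & `|r| < kap]].
Proof.
move=> eta00 kap0.
have [eps0 eps00 H] := knot_truncation gK t0T t3 eta00 (mulr_gt0 kap0 v_gt0).
exists eps0 => // eps /H[a [b [a0 at_ tb bT [win small]]]].
have /andP[_ a_lt] := at_; have /andP[b_gt _] := tb.
exists a, b, ((2^-1 * ((cdiv (kft g a t) (kf g a t)).1 - (cdiv (kft g b t) (kf g b t)).1)
    - 2 * v / eps) / v).
split; [exact: a0|exact: at_|exact: tb|exact: bT|split; first exact: win].
  exact: (V_eps_window a0 a_lt b_gt bT win).
by rewrite normrM normfV (gtr0_norm v_gt0) ltr_pdivrMr.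
Qed.

Let defect_int_ge0 eps : 0 < eps -> (0 <= defect_int eps)%E.
Proof.
move=> e0; apply: integral_ge0 => s [[s0 s3] /= es]; rewrite lee_fin defect_ge0//.
  by move: s0; rewrite /= in_itv/= => /andP[-> /ltW ->].
by apply: contraTneq es => ->; rewrite -ltNge dHxx.
Qed.

(** Up to a remainder tending to 0, [V_eps] is the integral of a nonnegative function over a domain
    that grows as eps decreases; the limit thus exists, possibly infinite, and is a supremum. Only
    eps < e0 is considered, where the far parameters form the complement of a window. *)
Lemma V_K_sup : exists2 e0 : R, 0 < e0 & V_K g T t =
  ereal_sup [set defect_int eps | eps in `]0, e0[].
Proof.
have [e0 e00 H] := V_eps_defect ltr01 ltr01; exists e0 => //.
have mono : {in `]0, e0[ &, {homo defect_int : x y / x <= y >-> (y <= x)%E}}.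
  move=> x y; rewrite !in_itv/= => x0 y0 xy.
  have [a [b [r [a0 /andP[_ a_lt] /andP[b_gt _] bT [winx _ _]]]]] := H _ x0.
  have [a' [b' [r' [a0' /andP[_ a_lt'] /andP[b_gt' _] bT' [winy _ _]]]]] := H _ y0.
  apply: ge0_subset_integral.
  - exact: measurable_far_params winy.
  - exact: measurable_far_params winx.
  - exact: defect_measurable winx.
  - move=> s sf; rewrite lee_fin; have := far_params_sub winx sf.
    move=> [] /=; rewrite in_itv/= => /andP[s1 s2]; apply: defect_ge0.
    + by rewrite s1 (le_trans s2)// ltW// (lt_trans a_lt)//; case/andP: t0T.
    + by rewrite lt_eqF// (le_lt_trans s2).
    + by rewrite s2 andbT (le_trans _ s1)// ltW// (lt_trans _ b_gt)//; case/andP: t0T.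
    + by rewrite gt_eqF// (lt_le_trans b_gt).
  - by move=> s [sD /= ys]; split => //=; exact: le_trans ys.
have := @nonincreasing_at_right_cvge R defect_int 0 (BLeft e0).
rewrite bnd_simp => /(_ e00 mono); set L := ereal_sup _ => cvJ.
have finJ eps : 0 < eps < e0 -> defect_int eps \is a fin_num.
  by move=> /H[a [b [r [a0 /andP[_ a_lt] /andP[b_gt _] bT [win _ _]]]]]; exact: defect_int_fin win.
(* The remainder [r] is given only existentially for each eps; since [defect_int] is finite,
   subtraction recovers it as a function of eps. *)
pose e eps := fine (V_eps g T t eps - defect_int eps)%E.
have eE eps (r : R) : 0 < eps < e0 -> V_eps g T t eps = (defect_int eps + r%:E)%E -> e eps = r.
  by move=> /finJ fJ Vr; rewrite /e Vr addeAC subee// add0e.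
have cve : (e eps)%:E @[eps --> 0^'+] --> 0%E.
  apply/cvg_EFin; first by near=> x.
  apply/cvgrPdist_lt => kap kap0.
  have [e1 e10 H1] := V_eps_defect ltr01 kap0.
  near=> eps; rewrite sub0r normrN.
  have h0 : 0 < eps by near: eps; exact: nbhs_right_gt.
  have h1 : eps < e0 by near: eps; exact: nbhs_right_lt.
  have h2 : eps < e1 by near: eps; exact: nbhs_right_lt.
  have /H1[a [b [r [_ _ _ _ [_ Vr rk]]]]] : 0 < eps < e1 by rewrite h0.
  by rewrite /= (eE _ r)// h0.
have cvV : V_eps g T t eps @[eps --> 0^'+] --> (L + 0)%E.
  have cvS : (defect_int eps + (e eps)%:E)%E @[eps --> 0^'+] --> (L + 0)%E.
    by apply: cvgeD cvJ cve; rewrite fin_num_adde_defl.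
  move: cvS; apply: cvg_trans; apply: near_eq_cvg; near=> eps.
  have h0 : 0 < eps by near: eps; exact: nbhs_right_gt.
  have h1 : eps < e0 by near: eps; exact: nbhs_right_lt.
  have h01 : 0 < eps < e0 by rewrite h0.
  have [a [b [r [_ _ _ _ [_ Vr _]]]]] := H _ h01.
  by rewrite /= (eE _ _ h01 Vr).
by rewrite /V_K (cvg_lim _ cvV)// adde0.
Unshelve. all: by end_near. Qed.

Lemma V_K_ge0 : (0 <= V_K g T t)%E.
Proof.
have [e0 e00 ->] := V_K_sup; apply: (le_trans (defect_int_ge0 (divr_gt0 e00 (ltr0Sn R 1)))).
apply: ereal_sup_ubound; exists (e0 / 2) => //=; rewrite in_itv/= divr_gt0//=.
by rewrite ltr_pdivrMr// ltr_pMr// ltr1n.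
Qed.

Lemma V_K_eq0 : (forall s, 0 <= s <= T -> s != t -> defect s = 0) -> V_K g T t = 0%E.
Proof.
move=> d0; have [e0 e00 ->] := V_K_sup.
have J0 eps : 0 < eps -> defect_int eps = 0%E.
  move=> eps0; apply: integral0_eq => s [[s0 s3] /= es]; rewrite d0//.
    by move: s0; rewrite /= in_itv/= => /andP[-> /ltW ->].
  by apply: contraTneq es => ->; rewrite -ltNge dHxx.
apply/eqP; rewrite eq_le; apply/andP; split.
  by apply: ge_ereal_sup => _ /= [eps + <-]; rewrite in_itv/= => /andP[/J0 -> _].
rewrite -(J0 (e0 / 2)) ?divr_gt0//.
apply: ereal_sup_ubound; exists (e0 / 2) => //=; rewrite in_itv/= divr_gt0//=.
by rewrite ltr_pdivrMr// ltr_pMr// ltr1n.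
Qed.

(** A window small enough to miss ]x, y[ leaves a contribution of at least c / (2 v) * (y - x), and
    larger truncations stay below the supremum. The factor [speed g t] then cancels [v], so the
    bound does not depend on [t]. *)
Lemma V_K_lower (x y c : R) : 0 <= x -> x < y -> y <= T -> (y < t \/ t < x) -> 0 <= c ->
  (forall s, x < s < y -> c <= kk g s t - (ww g s t).1) ->
  ((c * (y - x) / 2)%:E <= V_K g T t * (speed g t)%:E)%E.
Proof.
move=> x0 xy yT side c0 cE; have [e1 e10 VE] := V_K_sup.
(* [eta] is the distance from [t] to the interval. *)
have [eta eta0 far] : exists2 eta : R, 0 < eta & forall s, x < s < y -> s <= t - eta \/ t + eta <= s.
  case: side => [yt|tx].
    exists (t - y); rewrite ?subr_gt0// => s /andP[_ sy]; left; rewrite opprB addrC subrK; exact: ltW.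
  exists (x - t); rewrite ?subr_gt0// => s /andP[xs _]; right; rewrite addrC subrK; exact: ltW.
have [e0 e00 H] := V_eps_defect eta0 ltr01.
pose eps := Num.min e0 e1 / 2.
have [h0 h1 h2] : [/\ 0 < eps, eps < e0 & eps < e1].
  have : 0 < Num.min e0 e1 by rewrite lt_min e00.
  have : Num.min e0 e1 <= e0 by rewrite ge_min lexx.
  have : Num.min e0 e1 <= e1 by rewrite ge_min lexx orbT.
  rewrite /eps; set M := Num.min _ _ => *; split; lra.
have [|a [b [r [a0 /andP[ea a_lt] /andP[b_gt be] bT [win _ _]]]]] := H eps; first by rewrite h0.
have J1 : (((c / (2 * v)) * (y - x))%:E <= defect_int eps)%E.
  rewrite (defect_int_window a_lt b_gt win).
  have mI p q : measurable (`]p, q[ : set R) by exact: measurable_itv.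
  have vol : mu `]x, y[ = (y - x)%:E by rewrite lebesgue_measure_itv/= lte_fin xy EFinB.
  have dc s : x < s < y -> c / (2 * v) <= defect s.
    by move=> sxy; rewrite /defect ler_pM2r ?invr_gt0 ?mulr_gt0//; exact: cE.
  have dlo s : 0 <= s <= a -> 0 <= defect s.
    move=> /andP[s0 sa]; apply: defect_ge0; last by rewrite lt_eqF// (le_lt_trans sa).
    by rewrite s0 ltW// (le_lt_trans sa)// (lt_trans a_lt)//; case/andP: t0T.
  have dhi s : b <= s <= T -> 0 <= defect s.
    move=> /andP[bs sT]; apply: defect_ge0; last by rewrite gt_eqF// (lt_le_trans b_gt).
    by rewrite sT andbT ltW// (lt_le_trans _ bs)// (lt_trans _ b_gt)//; case/andP: t0T.
  have I1 : (0 <= \int[mu]_(s in `[0%R, a]) (defect s)%:E)%E.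
    by apply: integral_ge0 => s /=; rewrite in_itv/= lee_fin => /dlo.
  have I2 : (0 <= \int[mu]_(s in `[b, T]) (defect s)%:E)%E.
    by apply: integral_ge0 => s /=; rewrite in_itv/= lee_fin => /dhi.
  have k0 : 0 <= c / (2 * v) by rewrite divr_ge0// mulr_ge0// ltW.
  rewrite EFinM -vol; case: side => [yt|tx].
    rewrite -[leLHS]adde0; apply: leeD => //; apply: integral_ge_cst => //.
    move=> s /=; rewrite !in_itv/= => /andP[xs sy]; rewrite (le_trans x0 (ltW xs))/=.
      have [|h|h] := far s; first by rewrite xs.
        by rewrite (le_trans h)// ltW.
      by have := lt_trans (le_lt_trans h sy) yt; rewrite gtrDl ltNge (ltW eta0).
  rewrite -[leLHS]add0e; apply: leeD => //; apply: integral_ge_cst => //.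
  move=> s /=; rewrite !in_itv/= => /andP[xs sy]; rewrite (le_trans (ltW sy) yT) andbT.
    have [|h|h] := far s; first by rewrite xs.
      have := lt_le_trans (lt_trans tx xs) h; rewrite ltrDl ltNge.
      by rewrite oppr_le0 ltW.
    by rewrite (le_trans _ h)// ltW.
have J2 : (defect_int eps <= V_K g T t)%E.
  by rewrite VE; apply: ereal_sup_ubound; exists eps => //=; rewrite in_itv/= h0.
have -> : c * (y - x) / 2 = c / (2 * v) * (y - x) * v.
  by field; rewrite gt_eqF.
by rewrite EFinM; apply: lee_wpmul2r; [rewrite lee_fin ltW|exact: le_trans J1 J2].
Qed.

End Potential.

(** * Sign and positivity of the energy *)

Section Energy.
Variables (R : realType) (g : R -> C3 R) (T : R).
Hypothesis gK : legendrian_knot_param g T.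
Local Notation mu := (@lebesgue_measure R).
Local Open Scope ereal_scope.

Let E t := V_K g T t * (speed g t)%:E.
Let D := period_dom g T.

Let D_inner t : D t -> (t != 0)%R -> (0 < t < T)%R /\ c3_3 (g t) <> czero R.
Proof.
move=> [+ t3] t0; rewrite /= in_itv/= => /andP[t_ge0 tT]; split => //.
by rewrite tT andbT lt_neqAle eq_sym t0.
Qed.

Let E_ge0 t : D t -> (t != 0)%R -> 0 <= E t.
Proof.
move=> Dt /(D_inner Dt)[t0 t3]; apply: mule_ge0; first exact: V_K_ge0.
by rewrite lee_fin; exact/ltW/(speed_gt0 gK).
Qed.

(** The integrand is known to be nonnegative except perhaps at the parameter 0, so its negative part
    lives on a point. A pointwise nonnegative integrand is what [integral_ge_cst] can bound below
    without measurability. *)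
Lemma energy_pos_part : energy g T = \int[mu]_(t in D) (E^\+ t).
Proof.
rewrite /energy integralE [X in _ - X](@integral_point R D E^\- 0%R); last first.
  by move=> t Dt t0; rewrite funenegE; apply/max_idPr; rewrite leeNl oppe0 E_ge0.
by rewrite sube0.
Qed.

Lemma energy_ge0 : 0 <= energy g T.
Proof. by rewrite energy_pos_part; apply: integral_ge0 => t _; exact: funepos_ge0. Qed.

Lemma energy_eq0 : (forall t, (0 < t < T)%R -> c3_3 (g t) <> czero R -> V_K g T t = 0) ->
  energy g T = 0.
Proof.
move=> V0; apply: (@integral_point _ _ _ 0%R) => t Dt /(D_inner Dt)[t0 t3].
by rewrite V0// mul0e.
Qed.

Lemma energy_lower (x y c : R) : (0 < x)%R -> (x < y)%R -> (y < T)%R -> (0 < c)%R ->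
  (forall t, (x < t < y)%R -> c3_3 (g t) <> czero R) ->
  (forall t, (x < t < y)%R -> c%:E <= E t) -> 0 < energy g T.
Proof.
move=> x0 xy yT c0 t3 cE; rewrite energy_pos_part.
have mI : measurable (`]x, y[ : set R) by exact: measurable_itv.
apply: (@lt_le_trans _ _ (c%:E * mu `]x, y[)).
  by rewrite lebesgue_measure_itv/= lte_fin xy -EFinB -EFinM lte_fin mulr_gt0// subr_gt0.
apply: integral_ge_cst; [by move=> s _; exact: funepos_ge0|exact: mI| |exact: ltW|].
- move=> s /=; rewrite in_itv/= => sxy; split; last exact: t3.
  by move/andP: sxy => [xs sy]; rewrite /= in_itv/= (ltW (lt_trans x0 xs)) (lt_trans sy).
- move=> s /=; rewrite in_itv/= => /cE h; apply: (le_trans h).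
  by rewrite funeposE le_max lexx.
Qed.

End Energy.

Section PuncturedLimits.
Variable R : realType.
Implicit Types (f h : R -> R) (t a b : R).

Lemma dnbhsD f h t a b : f s @[s --> t^'] --> a -> h s @[s --> t^'] --> b ->
  f s + h s @[s --> t^'] --> a + b.
Proof. exact: cvgD. Qed.

Lemma dnbhsB f h t a b : f s @[s --> t^'] --> a -> h s @[s --> t^'] --> b ->
  f s - h s @[s --> t^'] --> a - b.
Proof. exact: cvgB. Qed.

Lemma dnbhsM f h t a b : f s @[s --> t^'] --> a -> h s @[s --> t^'] --> b ->
  f s * h s @[s --> t^'] --> a * b.
Proof. exact: cvgM. Qed.

Lemma dnbhsV f t a : a != 0 -> f s @[s --> t^'] --> a -> (f s)^-1 @[s --> t^'] --> a^-1.
Proof. exact: cvgV. Qed.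

Lemma dnbhsMr f t a (c : R) : f s @[s --> t^'] --> a -> f s * c @[s --> t^'] --> a * c.
Proof. by move=> fa; apply: cvgM => //; exact: cvg_cst. Qed.

End PuncturedLimits.

(** * Zero energy makes [w] real, and then all triple products *)

Section Rigidity.
Variables (R : realType) (g : R -> C3 R) (T : R).
Hypothesis gK : legendrian_knot_param g T.

Lemma herm_jointly_continuous (c c' d d' : R -> C3 R) (s t : R) :
  is_der_curve c c' -> is_der_curve d d' ->
  {for (s, t), continuous (fun p : R * R => (herm (c p.1) (d p.2)).1)} /\
  {for (s, t), continuous (fun p : R * R => (herm (c p.1) (d p.2)).2)}.
Proof.
move=> /(_ s)[[c1 c2] [c3 c4] [c5 c6]] /(_ t)[[d1 d2] [d3 d4] [d5 d6]].
have F (h : R -> R) a : is_derive s 1 h a -> h p.1 @[p --> (s, t)] --> h s.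
  move=> /der_continuous hc.
  by apply: (@cvg_comp _ _ _ (@fst R R) h (nbhs (s, t)) (nbhs s) (nbhs (h s))) => //; exact: cvg_fst.
have G (h : R -> R) a : is_derive t 1 h a -> h p.2 @[p --> (s, t)] --> h t.
  move=> /der_continuous hc.
  by apply: (@cvg_comp _ _ _ (@snd R R) h (nbhs (s, t)) (nbhs t) (nbhs (h t))) => //; exact: cvg_snd.
move: c1 c2 c3 c4 c5 c6 => /F c1 /F c2 /F c3 /F c4 /F c5 /F c6.
move: d1 d2 d3 d4 d5 d6 => /G d1 /G d2 /G d3 /G d4 /G d5 /G d6.
split; rewrite /continuous_at /herm /cadd /cmul /cconj /=.
- apply: cvgD; first by apply: cvgB; [exact: (cvgM c1 d5)|exact: (cvgM c2 (cvgN d6))].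
  apply: cvgD; first by apply: cvgB; [exact: (cvgM c3 d3)|exact: (cvgM c4 (cvgN d4))].
  by apply: cvgB; [exact: (cvgM c5 d1)|exact: (cvgM c6 (cvgN d2))].
- apply: cvgD; first by apply: cvgD; [exact: (cvgM c1 (cvgN d6))|exact: (cvgM c2 d5)].
  apply: cvgD; first by apply: cvgD; [exact: (cvgM c3 (cvgN d4))|exact: (cvgM c4 d3)].
  by apply: cvgD; [exact: (cvgM c5 (cvgN d2))|exact: (cvgM c6 d1)].
Qed.

Lemma defect_jointly_continuous (s t : R) : kf g s t <> czero R ->
  {for (s, t), continuous (fun p : R * R => kk g p.1 p.2 - (ww g p.1 p.2).1)}.
Proof.
move=> f0.
have [f1 f2] := herm_jointly_continuous s t (knot_der1 gK) (knot_der1 gK).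
have [a1 a2] := herm_jointly_continuous s t (knot_der2 gK) (knot_der1 gK).
have [b1 b2] := herm_jointly_continuous s t (knot_der1 gK) (knot_der2 gK).
have [h1 h2] := herm_jointly_continuous s t (knot_der2 gK) (knot_der2 gK).
have n0 : cnorm2 (kf g s t) != 0 by rewrite gt_eqF// cnorm2_gt0.
have sqrtc (h : R * R -> R) a : h p @[p --> (s, t)] --> a ->
    Num.sqrt (h p) @[p --> (s, t)] --> Num.sqrt a.
  move=> ha; apply: (@cvg_comp _ _ _ h (@Num.sqrt R) (nbhs (s, t)) (nbhs a)) => //.
  exact: sqrt_continuous.
have S1 : Num.sqrt (speed2 g p.1) @[p --> (s, t)] --> Num.sqrt (speed2 g s).
  have [d H] := speed2_der gK s.
  apply: sqrtc; apply: (@cvg_comp _ _ _ (@fst R R) (speed2 g) (nbhs (s, t)) (nbhs s)); first exact: cvg_fst.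
  exact: der_continuous H.
have S2 : Num.sqrt (speed2 g p.2) @[p --> (s, t)] --> Num.sqrt (speed2 g t).
  have [d H] := speed2_der gK t.
  apply: sqrtc; apply: (@cvg_comp _ _ _ (@snd R R) (speed2 g) (nbhs (s, t)) (nbhs t)); first exact: cvg_snd.
  exact: der_continuous H.
have N1 : cnorm2 (kf g p.1 p.2) @[p --> (s, t)] --> cnorm2 (kf g s t).
  by apply: cvgD; rewrite !expr2; [exact: (cvgM f1 f1)|exact: (cvgM f2 f2)].
have N2 : Num.sqrt (cnorm2 (kf g p.1 p.2)) @[p --> (s, t)] --> Num.sqrt (cnorm2 (kf g s t)).
  exact: sqrtc.
have q0 : Num.sqrt (cnorm2 (kf g s t)) != 0 by rewrite gt_eqF// sqrtr_gt0 cnorm2_gt0.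
apply: cvgB; first by apply: cvgM; [exact: (cvgM S1 S2)|exact: (cvgV q0 N2)].
have m0 : cnorm2 (cmul (kf g s t) (kf g s t)) != 0 by rewrite cnorm2M mulf_neq0.
have D1 : (cmul (kf g p.1 p.2) (kf g p.1 p.2)).1 @[p --> (s, t)] --> (cmul (kf g s t) (kf g s t)).1.
  by apply: cvgB; [exact: (cvgM f1 f1)|exact: (cvgM f2 f2)].
have D2 : (cmul (kf g p.1 p.2) (kf g p.1 p.2)).2 @[p --> (s, t)] --> (cmul (kf g s t) (kf g s t)).2.
  by apply: cvgD; [exact: (cvgM f1 f2)|exact: (cvgM f2 f1)].
have D3 : cnorm2 (cmul (kf g p.1 p.2) (kf g p.1 p.2)) @[p --> (s, t)] --> cnorm2 (cmul (kf g s t) (kf g s t)).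
  by apply: cvgD; rewrite !expr2; [exact: (cvgM D1 D1)|exact: (cvgM D2 D2)].
apply: cvgB; apply: cvgM.
- by apply: cvgB; apply: cvgB; [exact: (cvgM h1 f1)|exact: (cvgM h2 f2)|exact: (cvgM a1 b1)|exact: (cvgM a2 b2)].
- by apply: cvgM; [exact: D1|exact: (cvgV m0 D3)].
- by apply: cvgB; apply: cvgD; [exact: (cvgM h1 f2)|exact: (cvgM h2 f1)|exact: (cvgM a1 b2)|exact: (cvgM a2 b1)].
- by apply: cvgM; [exact: (cvgN D2)|exact: (cvgV m0 D3)].
Qed.

(** A non-real value of [ww] makes the defect positive there, hence by joint continuity on a
    rectangle, and [V_K_lower] turns this into a positive energy. *)
Lemma energy0_ww_real : energy g T = 0%E ->
  forall s t, 0 < s < T -> 0 < t < T -> s != t -> (ww g s t).2 = 0.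
Proof.
move=> E0 s0 t0 s0T t0T st.
have /andP[s0_gt0 s0_lt] := s0T; have /andP[t0_gt0 t0_lt] := t0T.
have f0 : kf g s0 t0 <> czero R by apply: (kf_neq0 gK) => //; rewrite !ltW.
apply: contrapT => w2.
have dpos : 0 < kk g s0 t0 - (ww g s0 t0).1.
  by rewrite subr_gt0 ltNge; apply/negP => /(ww_eq_kk gK f0).
set d0 := (X in 0 < X) in dpos.
have /cvgr_gt /(_ (d0 / 2)) := defect_jointly_continuous f0.
rewrite /= -/d0 ltr_pdivrMr// ltr_pMr// ltr1n => /(_ isT) /nbhs_ballP[rho /= rho0 Hrho].
have {}Hrho s t : `|s - s0| < rho -> `|t - t0| < rho -> d0 / 2 < kk g s t - (ww g s t).1.
  by move=> hs ht; apply: (Hrho (s, t)); split; rewrite /ball /= distrC.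
have [tau Htau] := inf_param_unique gK.
(* The rectangle ]s0, s0 + r[ x ]t0, t0 + r[ lies in the neighbourhood found above and inside one
   period; its sides are disjoint, so it avoids the diagonal, and the range of [t] avoids the
   parameter of infinity. *)
have [r [r0 r1 r2 r3 [r4 r5]]] : exists r : R, [/\ 0 < r, r <= rho, s0 + r <= T, t0 + r < T &
    (r <= `|s0 - t0|) /\ (t0 < tau -> t0 + r <= tau)].
  pose M := Num.min (Num.min rho (T - s0)) (Num.min (T - t0) (Num.min `|s0 - t0| (if t0 < tau then tau - t0 else 1))).
  have M0 : 0 < M.
    rewrite !lt_min rho0 !subr_gt0 s0_lt t0_lt normr_gt0 subr_eq0 st /=.
    by case: ifP => //; rewrite subr_gt0.
  have : M <= M by []. rewrite {2}/M !le_min => /andP[/andP[m1 m2] /andP[m3 /andP[m4 m5]]].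
  exists (M / 2); split; [lra|lra|lra|lra|split; first lra].
  by move=> tt; move: m5; rewrite tt; lra.
have : (0 < energy g T)%E.
  have sub (t : R) : t0 < t < t0 + r -> 0 < t < T.
    by move=> /andP[h1 h2]; rewrite (lt_trans t0_gt0 h1) (lt_trans h2 r3).
  have fin (t : R) : t0 < t < t0 + r -> c3_3 (g t) <> czero R.
    move=> tI t3; have /andP[h1 h2] := tI; have /andP[h3 h4] := sub _ tI.
    have E : t = tau by apply: Htau => //; rewrite (ltW h3).
    by move: h2; rewrite ltNge => /negP; apply; rewrite E; apply: r5; rewrite -E.
  apply: (@energy_lower R g T gK t0 (t0 + r) (d0 / 2 * (s0 + r - s0) / 2)) => //.
  - by rewrite ltrDl.
  - by rewrite addrC addKr !(mulr_gt0, divr_gt0).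
  move=> t tI; apply: V_K_lower => //; [exact: sub|exact: fin|exact: ltW|by rewrite ltrDl| | |].
  - have /andP[h1 h2] := tI; move: r4; have [st'|ts|E] := ltgtP s0 t0; last by rewrite E eqxx in st.
      by rewrite ltr0_norm ?subr_lt0// opprB => r4; left; lra.
    by rewrite gtr0_norm ?subr_gt0// => r4; right; lra.
  - by rewrite divr_ge0// ltW.
  - move=> s /andP[h1 h2]; have /andP[h3 h4] := tI; apply/ltW/Hrho.
      by rewrite gtr0_norm ?subr_gt0//; lra.
    by rewrite gtr0_norm ?subr_gt0//; lra.
by rewrite E0 ltxx.
Qed.

Lemma cmul0r (z : cpx R) : cmul z (czero R) = czero R.
Proof. by rewrite /cmul /czero /= !mulr0 subrr addr0. Qed.

(** This is <g s, g t><g t, g r><g r, g s>; the argument of its opposite is Cartan's angular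
    invariant of three points of the sphere. Rescaling a vector multiplies it by a nonnegative real
    factor. *)
Definition triple s t r := cmul (cmul (kf g s t) (cconj (kf g s r))) (kf g t r).

Definition triple_der s t r :=
  cmul (cadd (cmul (kfs g s t) (cconj (kf g s r))) (cmul (kf g s t) (cconj (kfs g s r)))) (kf g t r).

Lemma kfC s t : kf g t s = cconj (kf g s t).
Proof. exact: hermC. Qed.

Lemma tripleC s t r : triple s r t = cconj (triple s t r).
Proof.
rewrite /triple (kfC t r).
case: (kf g s t) => ? ?; case: (kf g s r) => ? ?; case: (kf g t r) => ? ?.
by rewrite /cmul /cconj /=; congr pair; ring.
Qed.

Lemma triple_rot s t r : triple t r s = triple s t r.
Proof.
rewrite /triple (kfC s t) (kfC s r).
case: (kf g s t) => ? ?; case: (kf g s r) => ? ?; case: (kf g t r) => ? ?.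
by rewrite /cmul /cconj /=; congr pair; ring.
Qed.

Lemma triple_is_der s t r : is_der_cpx (fun s => triple s t r) s (triple_der s t r).
Proof.
have d1 : is_der_cpx (fun s => kf g s t) s (kfs g s t) := herm_der_l (g t) s (knot_der1 gK).
have d2 : is_der_cpx (fun s => kf g s r) s (kfs g s r) := herm_der_l (g r) s (knot_der1 gK).
apply: der_cpx_eq (der_cpx_mul (der_cpx_mul d1 (der_cpx_conj d2)) (der_cpx_const (kf g t r) s)) _.
by rewrite cmul0r cadd0r.
Qed.

(** The derivative in [s] of the argument of <g s, g t>, expressed without choosing an argument. *)
Let A s t := (cdiv (kfs g s t) (kf g s t)).2.

(* The phase velocity of the triple product in [s] measures the variation of
   the argument derivative of [kf s] between the other two points. *)
Lemma triple_phase s t r : kf g s t <> czero R -> kf g s r <> czero R ->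
  (triple_der s t r).2 * (triple s t r).1 - (triple_der s t r).1 * (triple s t r).2 =
  cnorm2 (kf g t r) * cnorm2 (kf g s t) * cnorm2 (kf g s r) * (A s t - A s r).
Proof.
move=> /cnorm2_gt0/lt0r_neq0 + /cnorm2_gt0/lt0r_neq0.
rewrite /triple_der /triple /A /cdiv /cinv.
case: (kf g s t) => x1 x2; case: (kf g s r) => y1 y2; case: (kf g t r) => z1 z2.
case: (kfs g s t) => p1 p2; case: (kfs g s r) => q1 q2.
rewrite /cadd /cmul /cconj /cnorm2 /= => n1 n2.
by field; rewrite n1 n2.
Qed.

Lemma kf_neq0_r s t : 0 < s < T -> 0 <= t <= T -> s != t -> kf g s t <> czero R.
Proof.
move=> s0 t0 st; rewrite kfC => /cconj_eq0; apply: (kf_neq0 gK) => //.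
by rewrite eq_sym.
Qed.

Section RealMixed.
Hypothesis wwr : forall s t, 0 < s < T -> 0 < t < T -> s != t -> (ww g s t).2 = 0.

(** The derivative of [A s] in [t] is the imaginary part of [ww]. The mean value theorem evaluates
    it at an interior point only, so x = 0 and y = T are allowed. *)
Let A_segment s x y : 0 < s < T -> 0 <= x -> x < y -> y <= T -> (y < s \/ s < x) -> A s x = A s y.
Proof.
move=> s0 x0 xy yT side.
have ne (t : R) : x <= t <= y -> s != t.
  move=> /andP[xt ty]; case: side => h; first by rewrite gt_eqF// (le_lt_trans ty).
  by rewrite lt_eqF// (lt_le_trans h).
have Ad (t : R) : x <= t <= y -> is_derive t 1 (A s) (ww g s t).2.
  move=> xty; have /andP[xt ty] := xty.
  have [|_ h] := @log_der_t R g T gK s t; last exact: h.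
  by apply: kf_neq0_r => //; [rewrite (le_trans x0 xt) (le_trans ty yT)|exact: ne].
have H1 (t : R) : t \in `]x, y[ -> is_derive t 1 (A s) (ww g s t).2.
  by rewrite in_itv/= => /andP[/ltW xt /ltW ty]; apply: Ad; rewrite xt.
have H2 : {within `[x, y], continuous (A s)}.
  by apply: derivable_within_continuous => t; rewrite in_itv/= => /Ad; case.
have [c + H] := @MVT R (A s) (fun t => (ww g s t).2) x y xy H1 H2.
rewrite in_itv/= => /andP[xc cy]; move: H; rewrite wwr//.
- by rewrite mul0r => /eqP; rewrite subr_eq0 => /eqP.
- by rewrite (le_lt_trans x0 xc) (lt_le_trans cy yT).
- by apply: ne; rewrite !ltW.
Qed.

(** The parameter circle without [s] is connected: parameters above [s] are joined to [T], which is
    the same point of the knot as 0. *)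
Lemma arg_der_const s x y : 0 < s < T -> 0 <= x < T -> 0 <= y < T -> x != s -> y != s ->
  A s x = A s y.
Proof.
move=> s0 /andP[x0 xT] /andP[y0 yT] xs ys; have /andP[s_gt0 sT] := s0.
have AT : A s T = A s 0 by rewrite /A /kfs /kf (knot_gT gK).
have A0 z : 0 <= z < T -> z != s -> A s z = A s 0.
  move=> /andP[z0 zT]; case: (ltgtP z s) => // [zs|sz] _.
    have [->//|z0'] := eqVneq z 0; apply/esym; apply: A_segment => //.
    - by rewrite lt_neqAle eq_sym z0'.
    - exact: ltW.
    - by left.
  by rewrite -AT; apply: A_segment => //; right.
by rewrite (A0 x) ?x0// (A0 y) ?y0.
Qed.

(** As [s] moves between [t] and [r] the argument of the triple product is constant, by
    [triple_phase] and [arg_der_const]. When [s] tends to [t] the argument tends to that of a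
    negative real number. *)
Lemma triple_real_ordered s t r : 0 <= t -> t < s -> s < r -> r < T -> (triple s t r).2 = 0.
Proof.
move=> t0 ts sr rT.
(* [Y] is the squared sine of the argument, which avoids choosing a branch. *)
pose Y s := (triple s t r).2 ^+ 2 / cnorm2 (triple s t r).
have nz (z : R) : t < z < r -> [/\ kf g z t <> czero R, kf g z r <> czero R & kf g t r <> czero R].
  move=> /andP[tz zr]; split.
  - by apply: (kf_neq0_co gK); [rewrite (le_trans t0 (ltW tz)) (lt_trans zr)|rewrite t0 (lt_trans tz)// (lt_trans zr)|rewrite gt_eqF].
  - by apply: (kf_neq0_co gK); [rewrite (le_trans t0 (ltW tz)) (lt_trans zr)|rewrite (le_trans t0)// ltW// (lt_trans tz)|rewrite lt_eqF].
  - by apply: (kf_neq0_co gK); [rewrite t0 (lt_trans tz)// (lt_trans zr)|rewrite (le_trans t0)// ltW// (lt_trans tz)|rewrite lt_eqF// (lt_trans tz)].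
have tn0 (z : R) : t < z < r -> cnorm2 (triple z t r) != 0.
  move=> /nz[n1 n2 n3]; rewrite !cnorm2M !mulf_neq0// gt_eqF// cnorm2_gt0//.
  by move=> /cconj_eq0.
have Yd (z : R) : t < z < r -> is_derive z 1 Y 0.
  move=> zI; have [d1 d2] := triple_is_der z t r; have [n1 n2 n3] := nz z zI.
  have /andP[tz zr] := zI.
  have P : (triple_der z t r).2 * (triple z t r).1 - (triple_der z t r).1 * (triple z t r).2 = 0.
    rewrite triple_phase// (@arg_der_const z t r); first by rewrite subrr mulr0.
    - by rewrite (le_lt_trans t0 tz) (lt_trans zr).
    - by rewrite t0 (lt_trans tz)// (lt_trans zr).
    - by rewrite rT (le_trans t0)// ltW// (lt_trans tz).
    - by rewrite lt_eqF.
    - by rewrite gt_eqF.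
  have N := tn0 z zI.
  apply: (is_derive_eq (@der_quot R (fun s => (triple s t r).2 ^+ 2) (fun s => cnorm2 (triple s t r)) z _ _ N (derX 2 d2) (derD (derX 2 d1) (derX 2 d2)))).
  move: P N; rewrite /cnorm2; case: (triple z t r) => x y; case: (triple_der z t r) => x' y'.
  rewrite /= !expr1 => P N.
  transitivity (2 * y * x * (y' * x - x' * y) / (x ^+ 2 + y ^+ 2) ^+ 2); first by field.
  by rewrite P mulr0 mul0r.
have Yc (z : R) : t < z < s -> Y z = Y s.
  move=> /andP[tz zs].
  have H1 (c : R) : c \in `]z, s[ -> is_derive c 1 Y 0.
    rewrite in_itv/= => /andP[zc cs]; apply: Yd.
    by rewrite (lt_trans tz zc) (lt_trans cs sr).
  have H2 : {within `[z, s], continuous Y}.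
    apply: derivable_within_continuous => c; rewrite in_itv/= => /andP[zc cs].
    by have [] : is_derive c 1 Y 0 by apply: Yd; rewrite (lt_le_trans tz zc) (le_lt_trans cs sr).
  have [c _] := @MVT R Y (fun=> 0) z s zs H1 H2.
  by rewrite mul0r => /eqP; rewrite subr_eq0 => /eqP.
(* Divided by (z - t)^2, the factor <g z, g t> tends to the nonzero real number [a], and the product
   of the other two tends to |k|^2; so the imaginary part of the quotient tends to 0 and its modulus
   does not. *)
have Ylim : Y z @[z --> t^'] --> 0.
  have [h1 h2] : (kf g z r).1 @[z --> t^'] --> (kf g t r).1 /\ (kf g z r).2 @[z --> t^'] --> (kf g t r).2.
    have [e1 e2] := herm_der_l (g r) t (knot_der1 gK).
    by split; [exact: (dnbhs_cvgW (der_continuous e1) erefl)|exact: (dnbhs_cvgW (der_continuous e2) erefl)].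
  have [a1 a2] := diagonal_quotients gK t.
  set a := - (speed2 g t / 2) in a1.
  set k := kf g t r in h1 h2.
  have k0 : cnorm2 k != 0.
    by have [|_ _ kk0] := nz s; [rewrite ts|rewrite gt_eqF// cnorm2_gt0].
  have a0 : a != 0 by rewrite oppr_eq0 mulf_neq0// gt_eqF// (speed2_gt0 gK).
  have U1 := dnbhsD (dnbhsM a1 h1) (dnbhsM a2 h2).
  have U2 := dnbhsB (dnbhsM a2 h1) (dnbhsM a1 h2).
  have Q1 := dnbhsB (dnbhsMr (c := k.1) U1) (dnbhsMr (c := k.2) U2).
  have Q2 := dnbhsD (dnbhsMr (c := k.2) U1) (dnbhsMr (c := k.1) U2).
  have N := dnbhsD (dnbhsM Q1 Q1) (dnbhsM Q2 Q2).
  have Nl : ((a * k.1 + 0 * k.2) * k.1 - (0 * k.1 - a * k.2) * k.2) * ((a * k.1 + 0 * k.2) * k.1 - (0 * k.1 - a * k.2) * k.2)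
     + ((a * k.1 + 0 * k.2) * k.2 + (0 * k.1 - a * k.2) * k.1) * ((a * k.1 + 0 * k.2) * k.2 + (0 * k.1 - a * k.2) * k.1) != 0.
    rewrite (_ : _ + _ = (a * cnorm2 k) ^+ 2); last by rewrite /cnorm2; ring.
    by rewrite expf_neq0// mulf_neq0.
  apply: (dnbhs_cvg_eq_lim _ _ (dnbhsM (dnbhsM Q2 Q2) (dnbhsV Nl N))).
  - move=> z zt; have rn0 : z - t != 0 by rewrite subr_eq0.
    rewrite /Y /triple -/k.
    case: (kf g z t) => x1 x2; case: (kf g z r) => y1 y2; case: (k) => z1 z2.
    rewrite /cnorm2 /cmul /cconj /=.
    set X := _ * z1 - _ * z2; set Z := _ * z2 + _ * z1.
    have -> : (x1 / (z - t) ^+ 2 * y1 + x2 / (z - t) ^+ 2 * y2) * z2 +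
      (x2 / (z - t) ^+ 2 * y1 - x1 / (z - t) ^+ 2 * y2) * z1 = Z / (z - t) ^+ 2.
      by rewrite /Z; field.
    have -> : (x1 / (z - t) ^+ 2 * y1 + x2 / (z - t) ^+ 2 * y2) * z1 -
      (x2 / (z - t) ^+ 2 * y1 - x1 / (z - t) ^+ 2 * y2) * z2 = X / (z - t) ^+ 2.
      by rewrite /X; field.
    have [N0|N0] := eqVneq (X ^+ 2 + Z ^+ 2) 0.
      have /andP[/eqP -> /eqP ->] : (X == 0) && (Z == 0).
        by move/eqP: N0; rewrite paddr_eq0 ?sqr_ge0// !sqrf_eq0.
      by rewrite expr0n !mul0r.
    rewrite (_ : X / _ * _ + _ = (X ^+ 2 + Z ^+ 2) / (z - t) ^+ 4); last by field.
    by field; rewrite N0 rn0.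
  - by rewrite (_ : (a * k.1 + 0 * k.2) * k.2 + (0 * k.1 - a * k.2) * k.1 = 0) ?mul0r//; ring.
have sI : t < s < r by rewrite ts.
have : Y s = 0.
  apply: contrapT => /eqP Ys; have := dnbhs_dist Ylim (_ : 0 < `|Y s|).
  rewrite normr_gt0 => /(_ Ys)[eta eta0 H].
  pose z := t + Num.min eta (s - t) / 2.
  have M0 : 0 < Num.min eta (s - t) by rewrite lt_min eta0 subr_gt0.
  have M1 : Num.min eta (s - t) <= eta by rewrite ge_min lexx.
  have M2 : Num.min eta (s - t) <= s - t by rewrite ge_min lexx orbT.
  have tz : t < z by rewrite ltrDl divr_gt0.
  have := H z; rewrite gt_eqF// Yc; last by rewrite tz/= /z; lra.
  rewrite subr0 ltxx gtr0_norm ?subr_gt0// => /(_ isT).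
  have -> : z - t < eta by rewrite /z addrC addKr; lra.
  by move=> /(_ isT).
move=> /eqP; rewrite mulf_eq0 invr_eq0 (negbTE (tn0 _ sI)) orbF sqrf_eq0.
by move=> /eqP.
Qed.

(** Permuting the parameters at most conjugates the triple product, so the middle one can be moved
    to the first place; with two equal parameters the product is 0. *)
Lemma triple_real s t r : 0 <= s < T -> 0 <= t < T -> 0 <= r < T -> (triple s t r).2 = 0.
Proof.
move=> /andP[s0 sT] /andP[t0 tT] /andP[r0 rT].
have deg x y : (triple x x y).2 = 0 by rewrite /triple (kf_diag gK) /cmul /=; ring.
have cj x y z : (triple x y z).2 = 0 -> (triple x z y).2 = 0.
  by move=> H; rewrite tripleC; move: H; case: (triple x y z) => a b /= ->; rewrite oppr0.
have key := triple_real_ordered.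
case: (ltgtP s t) => [st|ts|<-]; last exact: deg.
- case: (ltgtP t r) => [tr|rt|<-]; last by rewrite -triple_rot; exact: deg.
  + by rewrite -triple_rot; apply: cj; apply: key.
  + case: (ltgtP s r) => [sr|rs|E]; last by rewrite -triple_rot -triple_rot -E; exact: deg.
    * by rewrite -triple_rot -triple_rot; apply: key.
    * by apply: cj; exact: key.
- case: (ltgtP s r) => [sr|rs|E]; last by rewrite -triple_rot -triple_rot -E; exact: deg.
  + exact: key.
  + case: (ltgtP t r) => [tr|rt|<-]; last by rewrite -triple_rot; exact: deg.
    * by rewrite -triple_rot -triple_rot; apply: cj; exact: key.
    * by rewrite -triple_rot; exact: key.
Qed.

End RealMixed.
End Rigidity.

(** The value halfway between h 0 and h (T / 2) is taken on each half of the period, and not at T /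
    2, where the halves meet. *)
Lemma continuous_loop_not_injective (R : realType) (h : R -> R) (T : R) :
  0 < T -> {within `[0, T], continuous h} -> h 0 = h T ->
  ~ (forall s t, 0 <= s < T -> 0 <= t < T -> h s = h t -> s = t).
Proof.
move=> T0 hc h0T inj.
have T2 : 0 < T / 2 by rewrite divr_gt0.
have T2T : T / 2 < T by rewrite ltr_pdivrMr// ltr_pMr// ltr1n.
have ne : h (T / 2) != h 0.
  apply/eqP => /inj; rewrite lexx T0 T2T (ltW T2) => /(_ isT isT) E.
  by rewrite E ltxx in T2.
pose z := (h 0 + h (T / 2)) / 2.
have zE : Num.min (h 0) (h (T / 2)) <= z <= Num.max (h 0) (h (T / 2)).
  rewrite /z; case: (ltgtP (h 0) (h (T / 2))) ne => // hh _; apply/andP; split; lra.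
have [c1 + h1] : exists2 c, c \in `[0, T / 2] & h c = z.
  apply: IVT zE; first exact: ltW.
  by apply: continuous_subspaceW hc => x /=; rewrite !in_itv/= => /andP[-> xT]; rewrite (le_trans xT)// ltW.
rewrite in_itv/= => /andP[c10 c1T].
have [c2 + h2] : exists2 c, c \in `[T / 2, T] & h c = z.
  apply: IVT; first exact: ltW.
    apply: continuous_subspaceW hc => x /=; rewrite !in_itv/= => /andP[xT ->].
    by rewrite (le_trans _ xT)// ltW.
  by rewrite -h0T minC maxC.
rewrite in_itv/= => /andP[c20 c2T].
have zT2 : z != h (T / 2) by apply: contraNneq ne; rewrite /z => E; apply/eqP; lra.
have zT : z != h T by apply: contraNneq zT2 => E; apply/eqP; move: E; rewrite -h0T /z; lra.
have c2lt : c2 < T by rewrite lt_neqAle c2T andbT; apply: contraNneq zT => <-; rewrite h2.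
have c1lt : c1 < T / 2 by rewrite lt_neqAle c1T andbT; apply: contraNneq zT2 => <-; rewrite h1.
have E : c1 = c2 by apply: inj; rewrite ?h1 ?h2// ?c10 ?(lt_trans c1lt)// c2lt (le_trans (ltW T2)).
by have := lt_le_trans c1lt c20; rewrite E ltxx.
Qed.

(** * Real spans on which the Hermitian form is real *)

Section RealSpan.
Variable R : realType.
Implicit Types (u v w : C3 R).

Definition real_span (e1 e2 e3 : C3 R) v := exists a1 a2 a3 : R,
  v = c3add (c3rscale a1 e1) (c3add (c3rscale a2 e2) (c3rscale a3 e3)).

Lemma herm_real_span_l e1 e2 e3 v w : real_span e1 e2 e3 v ->
  (herm e1 w).2 = 0 -> (herm e2 w).2 = 0 -> (herm e3 w).2 = 0 -> (herm v w).2 = 0.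
Proof.
move=> [a1 [a2 [a3 ->]]]; rewrite !hermDl /c3rscale !hermZl.
case: (herm e1 w) => ? ?; case: (herm e2 w) => ? ?; case: (herm e3 w) => ? ?.
by rewrite /cadd /cmul /= => -> -> ->; ring.
Qed.

Lemma herm_im_sym u v : (herm u v).2 = 0 -> (herm v u).2 = 0.
Proof. by rewrite (hermC u) /cconj /= => ->; rewrite oppr0. Qed.

Lemma herm_real_span (e1 e2 e3 v w : C3 R) :
  (forall x y, x \in [:: e1; e2; e3] -> y \in [:: e1; e2; e3] -> (herm x y).2 = 0) ->
  real_span e1 e2 e3 v -> real_span e1 e2 e3 w -> (herm v w).2 = 0.
Proof.
move=> E Sv Sw; apply: (herm_real_span_l Sv); apply: herm_im_sym;
  by apply: (herm_real_span_l Sw); apply: E; rewrite !inE eqxx ?orbT.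
Qed.

Lemma herm_real_eq u v : (herm u v).2 = 0 -> herm u v = ((herm u v).1, 0).
Proof. by move=> h; rewrite [LHS]surjective_pairing h. Qed.

Lemma cconj_real (x : R) : cconj (x, 0) = (x, 0).
Proof. by rewrite /cconj /= oppr0. Qed.

Lemma cmul_real (x y : R) : cmul (x, 0) (y, 0) = (x * y, 0).
Proof. by rewrite /cmul /=; congr pair; ring. Qed.

Lemma cdiv_real (x y : R) : y != 0 -> cdiv (x, 0) (y, 0) = (x / y, 0).
Proof. by move=> y0; rewrite /cdiv /cinv /cmul /cnorm2 /=; congr pair; field. Qed.

Lemma cdiv_scale (c x y : cpx R) : c <> czero R -> y <> czero R ->
  cdiv (cmul c x) (cmul c y) = cdiv x y.
Proof.
move=> c0 y0.
have := cnorm2_gt0 c0; have := cnorm2_gt0 y0 => /lt0r_neq0 n1 /lt0r_neq0 n2.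
have : cnorm2 (cmul c y) != 0 by rewrite cnorm2M mulf_neq0.
move: n1 n2; rewrite /cdiv /cinv /cnorm2 /cmul /= => n1 n2 n3.
by congr pair; field; rewrite n1 n3.
Qed.

End RealSpan.

(** * Knots with real triple products and R-circles *)

Section Knot.
Variables (R : realType) (g : R -> C3 R) (T : R).
Hypothesis gK : legendrian_knot_param g T.

Lemma fundamental_param t : exists2 t', 0 <= t' < T & g t' = g t.
Proof.
have T0 := knot_period_gt0 gK.
have per (n : nat) x : g (x + T *+ n) = g x.
  elim: n x => [|n IH] x; first by rewrite mulr0n addr0.
  by rewrite mulrSr addrA (knot_periodic gK) IH.
pose z := Num.floor (t / T).
have zl : z%:~R <= t / T by rewrite floor_le_tmp.
have zu : t / T < z%:~R + 1 by rewrite -intrD1 lt_succ_floor.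
exists (t - z%:~R * T).
  apply/andP; split; first by rewrite subr_ge0 -ler_pdivlMr.
  by move: zu; rewrite ltr_pdivrMr// mulrDl mul1r ltrBlDr addrC.
case: z {zl zu} => n.
  by rewrite -[in RHS](subrK (n%:~R * T) t) mulr_natl per.
by rewrite NegzE mulrNz mulNr opprK -[n.+1%:~R]/(n.+1%:R) mulr_natl per.
Qed.

Lemma knot_of_fundamental p : knot_of g p -> exists2 t, 0 <= t < T & p = bdry_pt (g t).
Proof.
move=> [t _ <-]; have [t' t'0 E] := fundamental_param t.
by exists t' => //; rewrite E.
Qed.

Lemma triple_real_R_circle :
  (forall s t r, 0 <= s < T -> 0 <= t < T -> 0 <= r < T -> (triple g s t r).2 = 0) ->
  R_circle (knot_of g).
Proof.
move=> TR; have T0 := knot_period_gt0 gK.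
pose a : R := 0; pose b := T / 3; pose c := 2 * T / 3.
have [aI bI cI] : [/\ 0 <= a < T, 0 <= b < T & 0 <= c < T].
  by split; apply/andP; split; rewrite /a /b /c; lra.
have [ab ac bc] : [/\ a != b, a != c & b != c].
  by split; rewrite lt_eqF// /a /b /c; lra.
have fab := kf_neq0_co gK aI bI ab; have fac := kf_neq0_co gK aI cI ac.
have fbc := kf_neq0_co gK bI cI bc.
(* The factors <e1, g b> and <e1, g c> make <e1,e2> and <e1,e3> positive; <e2,e3> then becomes a
   triple product, which is real. *)
pose e1 := g a; pose e2 := c3scale (kf g a b) (g b); pose e3 := c3scale (kf g a c) (g c).
have sq z : cmul (cconj z) z = (cnorm2 z, 0) :> cpx R.
  by rewrite /cmul /cconj /cnorm2 /=; congr pair; ring.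
have h12 : herm e1 e2 = (cnorm2 (kf g a b), 0) by rewrite /e1 /e2 hermZr sq.
have h13 : herm e1 e3 = (cnorm2 (kf g a c), 0) by rewrite /e1 /e3 hermZr sq.
have trip x y z : cmul (kf g x y) (cmul (cconj (kf g x z)) (kf g y z)) = triple g x y z.
  rewrite /triple; case: (kf g x y) => ? ?; case: (kf g x z) => ? ?; case: (kf g y z) => ? ?.
  by rewrite /cmul /cconj /=; congr pair; ring.
have h23 : herm e2 e3 = ((triple g a b c).1, 0).
  rewrite /e2 /e3 hermZl hermZr -/(kf g b c) trip.
  by rewrite [LHS]surjective_pairing TR.
have x0 : cnorm2 (kf g a b) != 0 by rewrite gt_eqF// cnorm2_gt0.
have y0 : cnorm2 (kf g a c) != 0 by rewrite gt_eqF// cnorm2_gt0.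
have z0 : (triple g a b c).1 != 0.
  apply/eqP => z0; have : triple g a b c = czero R.
    by rewrite [LHS]surjective_pairing z0 TR.
  by rewrite -trip => /cmul_eq0[//|/cmul_eq0[/cconj_eq0|]].
have n1 : is_null e1 by exact: (knot_null gK).
have n2 : is_null e2 by apply: is_null_scale; exact: (knot_null gK).
have n3 : is_null e3 by apply: is_null_scale; exact: (knot_null gK).
have E : forall v w, v \in [:: e1; e2; e3] -> w \in [:: e1; e2; e3] -> (herm v w).2 = 0.
  have h21 : (herm e2 e1).2 = 0 by apply: herm_im_sym; rewrite h12.
  have h31 : (herm e3 e1).2 = 0 by apply: herm_im_sym; rewrite h13.
  have h32 : (herm e3 e2).2 = 0 by apply: herm_im_sym; rewrite h23.
  move=> v w; rewrite !inE => /or3P[/eqP ->|/eqP ->|/eqP ->] /or3P[/eqP ->|/eqP ->|/eqP ->];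
    by rewrite ?n1 ?n2 ?n3 ?h12 ?h13 ?h23.
(* Scaled by <g a, g t>, the vector g t has real products with e1, e2 and e3, again squared moduli
   or triple products. The case t = a is separate because this factor is then 0. *)
have span t : 0 <= t < T -> exists2 l : cpx R, l <> czero R & real_span e1 e2 e3 (c3scale l (g t)).
  move=> tI; have [->|ta] := eqVneq t a.
    exists (1, 0); first by case=> /eqP; rewrite oner_eq0.
    exists 1, 0, 0; rewrite c3scale1 /c3rscale -/e1.
    case: (e1) => [[[? ?] [? ?]] [? ?]]; case: (e2) => [[[? ?] [? ?]] [? ?]].
    case: (e3) => [[[? ?] [? ?]] [? ?]].
    rewrite /c3add /c3scale /cmul /cadd /c3_1 /c3_2 /c3_3 /=.
    by congr (_, _, _); congr pair; ring.
  have at_ : a != t by rewrite eq_sym.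
  exists (kf g a t); first exact: (kf_neq0_co gK aI tI at_).
  have v1 : herm (c3scale (kf g a t) (g t)) e1 = (cnorm2 (kf g a t), 0).
    by rewrite hermZl -/(kf g t a) (kfC g a t) cmulC sq.
  have v2 : herm (c3scale (kf g a t) (g t)) e2 = ((triple g a t b).1, 0).
    by rewrite hermZl hermZr -/(kf g t b) trip [LHS]surjective_pairing TR.
  have v3 : herm (c3scale (kf g a t) (g t)) e3 = ((triple g a t c).1, 0).
    by rewrite hermZl hermZr -/(kf g t c) trip [LHS]surjective_pairing TR.
  exact: (null_triple_coord n1 n2 n3 h12 h13 h23 x0 y0 z0 v1 v2 v3).
exists e1, e2, e3; split.
  by split=> //; exact: (null_triple_indep n1 n2 n3 h12 h13 h23).
apply/seteqP; split => p.
  move=> /knot_of_fundamental[t tI ->]; have [l l0 S] := span t tI.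
  exists (c3scale l (g t)); last exact: bdry_pt_scale.
  have [a1 [a2 [a3 El]]] := S; exists a1, a2, a3; split=> //; split.
    by apply: c3scale_neq0 => //; exact: (knot_neq0 gK).
  by apply: is_null_scale; exact: (knot_null gK).
(* Suppose that the knot misses the point of [om]. Projection from this point maps the rest of the
   R-circle injectively to a line, where a closed injective curve cannot exist. *)
move=> [om [a1 [a2 [a3 [omE [om0 omn]]]]] <-]; apply: contrapT => notin.
have Som : real_span e1 e2 e3 om by exists a1, a2, a3.
have gom t : herm (g t) om <> czero R.
  move=> h; apply: notin; exists t => //.
  by apply: null_orthogonal => //; [exact: (knot_neq0 gK)|exact: (knot_null gK)].
have S_e (e : C3 R) : e \in [:: e1; e2; e3] -> (herm e om).2 = 0.
  move=> ee; apply: herm_im_sym.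
  by apply: (herm_real_span_l Som); apply: E => //; rewrite !inE eqxx ?orbT.
have r1 : herm e1 om = ((herm e1 om).1, 0) by apply/herm_real_eq/S_e; rewrite !inE eqxx.
have r2 : herm e2 om = ((herm e2 om).1, 0) by apply/herm_real_eq/S_e; rewrite !inE eqxx orbT.
have p0 : (herm e1 om).1 != 0.
  by apply/eqP => p0; apply: (gom a); rewrite -/e1 r1 p0.
have q0 : (herm e2 om).1 != 0.
  apply/eqP => q0; have : herm e2 om = czero R by rewrite r2 q0.
  by rewrite hermZl => /cmul_eq0[//|]; exact: gom.
set P := (herm e1 om).1 in r1 p0; set Q := (herm e2 om).1 in r2 q0.
clearbody e2 e3.
(* [xi] is the combination of e1 and e2 orthogonal to [om]; its self-product -2 P Q |f(a,b)|^2 is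
   nonzero, as [conic_projection] requires. *)
pose xi := c3add (c3rscale Q e1) (c3rscale (- P) e2).
have r1' : herm om e1 = (P, 0) by rewrite (hermC e1) r1 /cconj /= oppr0.
have r2' : herm om e2 = (Q, 0) by rewrite (hermC e2) r2 /cconj /= oppr0.
have oxi : herm om xi = czero R.
  by rewrite hermDr /c3rscale !hermZr r1' r2' /cadd /cmul /cconj /czero /=; congr pair; ring.
have h21 : herm e2 e1 = (cnorm2 (kf g a b), 0) by rewrite (hermC e1) h12 /cconj /= oppr0.
have xixi : (herm xi xi).1 != 0.
  rewrite (_ : (herm xi xi).1 = - 2 * P * Q * cnorm2 (kf g a b)); first by rewrite !mulf_neq0// oppr_eq0.
  rewrite /xi hermDl !hermDr /c3rscale !hermZl !hermZr h12 h21 n1 n2.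
  by rewrite /cadd /cmul /cconj /czero /=; ring.
have Sxi : real_span e1 e2 e3 xi.
  exists Q, (- P), 0; rewrite /xi /c3rscale.
  case: (e1) => [[[? ?] [? ?]] [? ?]]; case: (e2) => [[[? ?] [? ?]] [? ?]].
  case: (e3) => [[[? ?] [? ?]] [? ?]].
  rewrite /c3add /c3scale /cmul /cadd /c3_1 /c3_2 /c3_3 /=.
  by congr (_, _, _); congr pair; ring.
(* The projection from [om]. The quotient is unchanged when g t is rescaled, and it is real because
   some multiple of g t lies in the real span. *)
pose h t := (cdiv (herm (g t) xi) (herm (g t) om)).1.
have hd (t : R) : exists d : R, is_derive t 1 h d.
  have H := @der_cpx_div R (fun t => herm (g t) xi) (fun t => herm (g t) om) t _ _ (gom t)
    (herm_der_l xi t (knot_der1 gK)) (herm_der_l om t (knot_der1 gK)).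
  by eexists; exact: H.1.
apply: (@continuous_loop_not_injective R h T T0).
- by apply: derivable_within_continuous => t _; have [d []] := hd t.
- by rewrite /h (knot_gT gK).
move=> s t sI tI hst; apply/eqP; apply: contrapT => /negP st.
have := kf_neq0_co gK sI tI st; apply.
have [l l0 Ss] := span s sI; have [m m0 St] := span t tI.
set n := c3scale l (g s) in Ss; set n' := c3scale m (g t) in St.
have N1 : is_null n by apply: is_null_scale; exact: (knot_null gK).
have N2 : is_null n' by apply: is_null_scale; exact: (knot_null gK).
have no : herm n om <> czero R by rewrite hermZl => /cmul_eq0[//|]; exact: gom.
have no' : herm n' om <> czero R by rewrite hermZl => /cmul_eq0[//|]; exact: gom.
have R1 := herm_real_eq (herm_real_span E Ss Som).
have R2 := herm_real_eq (herm_real_span E St Som).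
have R3 := herm_real_eq (herm_real_span E Ss Sxi).
have R4 := herm_real_eq (herm_real_span E St Sxi).
have k1 : (herm n om).1 != 0 by apply/eqP => z; apply: no; rewrite R1 z.
have k2 : (herm n' om).1 != 0 by apply/eqP => z; apply: no'; rewrite R2 z.
have hs : h s = (herm n xi).1 / (herm n om).1.
  by rewrite /h -(cdiv_scale _ l0 (gom s)) -!hermZl -/n R1 R3 cdiv_real.
have ht : h t = (herm n' xi).1 / (herm n' om).1.
  by rewrite /h -(cdiv_scale _ m0 (gom t)) -!hermZl -/n' R2 R4 cdiv_real.
have proj : cmul (herm n xi) (herm n' om) = cmul (herm n' xi) (herm n om).
  rewrite R1 R2 R3 R4 !cmul_real; congr pair.
  by move/eqP: hst; rewrite hs ht eqr_div// => /eqP.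
have P0 : (cmul (herm n n') (cmul (herm n' om) (herm om n))).2 = 0.
  by rewrite (hermC n om) (herm_real_eq (herm_real_span E Ss St)) R1 R2 cconj_real !cmul_real.
have := conic_projection N1 N2 omn oxi xixi proj P0.
move=> /cmul_eq0[|/cmul_eq0[//|]]; last by rewrite (hermC n) => /cconj_eq0.
by rewrite /n hermZl hermZr => /cmul_eq0[//|/cmul_eq0[/cconj_eq0//|]].
Qed.

(** Points of an R-circle have representatives in the real form, whose products are real; passing to
    g only multiplies the triple product by squared moduli. *)
Lemma R_circle_triple_real : R_circle (knot_of g) -> forall s t r, (triple g s t r).2 = 0.
Proof.
move=> [e1 [e2 [e3 [[_ E] KE]]]] s t r.
have lift_span x : exists (l : cpx R) (w : C3 R), real_span e1 e2 e3 w /\ g x = c3scale l w.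
  have : knot_of g (bdry_pt (g x)) by exists x.
  rewrite KE => -[w [a1 [a2 [a3 [wE [w0 wn]]]]] bw].
  have [l El] := bdry_pt_eq (@knot_neq0 _ _ _ gK x) (knot_null gK x) w0 wn (esym bw).
  by exists l, w; split=> //; exists a1, a2, a3.
have [l1 [w1 [S1 E1]]] := lift_span s; have [l2 [w2 [S2 E2]]] := lift_span t.
have [l3 [w3 [S3 E3]]] := lift_span r.
rewrite /triple /kf E1 E2 E3 !hermZl !hermZr.
rewrite (herm_real_eq (herm_real_span E S1 S2)) (herm_real_eq (herm_real_span E S1 S3)).
rewrite (herm_real_eq (herm_real_span E S2 S3)) /cmul /cconj /=; ring.
Qed.

(** * Real triple products force [w] to be real and positive *)

Section RealTriples.
Hypothesis TR : forall s t r, (triple g s t r).2 = 0.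

(** By [triple_phase] the argument derivative in [s] is the same at [t] and at every nearby [x]; the
    imaginary part of [ww], its derivative in [t], is the limit of difference quotients that are all
    0. *)
Lemma real_triples_ww_im s t : 0 <= s <= T -> 0 < t < T -> s != t -> (ww g s t).2 = 0.
Proof.
move=> sI tI st; have /andP[t0 tT] := tI; have f0 := kf_neq0 gK sI tI st.
have [_ d] := log_der_t gK f0.
have lim := der_quotient_cvg d.
apply: contrapT => /eqP w0; have w1 : 0 < `|(ww g s t).2| by rewrite normr_gt0.
have [eta eta0 H] := dnbhs_dist lim w1.
have [x [xt xe xI sx]] : exists x : R, [/\ x != t, `|x - t| < eta, 0 < x < T & s != x].
  pose M := Num.min (Num.min eta `|s - t|) (T - t).
  have M0 : 0 < M by rewrite !lt_min eta0 normr_gt0 !subr_gt0 subr_eq0 st.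
  have : M <= M by []. rewrite {2}/M !le_min => /andP[/andP[m1 m2] m3].
  exists (t + M / 2); split.
  - by rewrite gt_eqF// ltrDl divr_gt0.
  - by rewrite addrC addKr gtr0_norm ?divr_gt0//; lra.
  - by apply/andP; split; lra.
  - apply/eqP => sE; move: m2; rewrite sE addrC addKr gtr0_norm ?divr_gt0//; lra.
have fx := kf_neq0 gK sI xI sx.
have txI : 0 <= t <= T by rewrite !ltW.
have ftx : kf g t x <> czero R by apply: (kf_neq0 gK txI xI); rewrite eq_sym.
have td : (triple_der g s t x).2 = 0.
  have [_ h] := triple_is_der gK s t x; rewrite -(der_val h).
  rewrite (_ : (fun s => (triple g s t x).2) = fun=> 0); first by rewrite (der_val (derC 0 s)).
  by apply/funext => z; rewrite TR.
have := triple_phase f0 fx; rewrite td TR mul0r mulr0 subrr => /esym/eqP.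
rewrite !mulf_eq0 (gt_eqF (cnorm2_gt0 ftx)) (gt_eqF (cnorm2_gt0 f0)) (gt_eqF (cnorm2_gt0 fx)) !orFb subr_eq0 => /eqP AE.
by have := H x xt xe; rewrite -AE subrr mul0r sub0r normrN ltxx.
Qed.

(** With q = <g', g'> and h = s - t, the leading terms -q h^2 / 2 of [kf], -q h of [kfs], q h of
    [kft] and q of [kfst] give (q^2 h^2 / 2) / (q^2 h^4 / 4). This fixes the sign of [ww] near the
    diagonal. *)
Lemma ww_diagonal t : (ww g s t).1 * (s - t) ^+ 2 @[s --> t^'] --> (2 : R).
Proof.
have fL := knot_legendrian gK t; have fL' := knot_legendrian' gK t.
have fA := herm_acceleration gK t; have fV := herm_velocity g t.
have [F1 F2] := diagonal_quotients gK t.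
have q0 := speed2_gt0 gK t; set q := speed2 g t in F1 q0 fA fV.
have T1 (c d e : R -> C3 R) v : is_der_curve c d -> is_der_curve d e -> herm (c t) v = czero R ->
    (herm (c s) v).1 / (s - t) @[s --> t^'] --> (herm (d t) v).1 /\
    (herm (c s) v).2 / (s - t) @[s --> t^'] --> (herm (d t) v).2.
  move=> cd de c0; have [e1 e2] := herm_der_l v t de; split.
  - notypeclasses refine (@taylor1 R (fun s => (herm (c s) v).1) (fun s => (herm (d s) v).1) t _ _ _).
    + by move=> s; have [] := herm_der_l v s cd.
    + exact: der_continuous e1.
    + by rewrite c0.
  - notypeclasses refine (@taylor1 R (fun s => (herm (c s) v).2) (fun s => (herm (d s) v).2) t _ _ _).
    + by move=> s; have [] := herm_der_l v s cd.
    + exact: der_continuous e2.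
    + by rewrite c0.
have [p1 p2] := T1 _ _ _ _ (knot_der2 gK) (knot_der3 gK) fL.
have [q1 q2] := T1 _ _ _ _ (knot_der1 gK) (knot_der2 gK) fL'.
rewrite fA in p1 p2; rewrite fV in q1 q2.
have [e1 e2] := herm_der_l (dcurve g t) t (knot_der2 gK).
have h1 := dnbhs_cvgW (der_continuous e1) (congr1 fst fV).
have h2 := dnbhs_cvgW (der_continuous e2) (congr1 snd fV).
have N1 := dnbhsB (dnbhsB (dnbhsM h1 F1) (dnbhsM h2 F2)) (dnbhsB (dnbhsM p1 q1) (dnbhsM p2 q2)).
have N2 := dnbhsB (dnbhsD (dnbhsM h1 F2) (dnbhsM h2 F1)) (dnbhsD (dnbhsM p1 q2) (dnbhsM p2 q1)).
have D1 := dnbhsB (dnbhsM F1 F1) (dnbhsM F2 F2).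
have D2 := dnbhsD (dnbhsM F1 F2) (dnbhsM F2 F1).
have D := dnbhsD (dnbhsM D1 D1) (dnbhsM D2 D2).
have qn : q != 0 by rewrite gt_eqF.
move: D; set Dl := (X in _ --> X) => D.
have DlE : Dl = q ^+ 4 / 16 by rewrite /Dl; field.
have Dl0 : Dl != 0 by rewrite DlE mulf_neq0 ?expf_neq0 ?invr_eq0.
apply: (dnbhs_cvg_eq_lim _ _ (dnbhsM (dnbhsD (dnbhsM N1 D1) (dnbhsM N2 D2)) (dnbhsV Dl0 D))).
- move=> s st; have rn0 : s - t != 0 by rewrite subr_eq0.
  rewrite /ww /kfst /kfs /kft /kf.
  case: (herm (dcurve g s) (dcurve g t)) => a1 a2; case: (herm (g s) (g t)) => f1 f2.
  case: (herm (dcurve g s) (g t)) => b1 b2; case: (herm (g s) (dcurve g t)) => c1 c2.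
  rewrite /cdiv /cinv /csub /cmul /cnorm2 /=.
  have [N0|N0] := eqVneq (f1 ^+ 2 + f2 ^+ 2) 0.
    have /andP[/eqP -> /eqP ->] : (f1 == 0) && (f2 == 0).
      by move/eqP: N0; rewrite paddr_eq0 ?sqr_ge0// !sqrf_eq0.
    by rewrite !(mul0r, mulr0, addr0, subr0, oppr0).
  have M0 : (f1 * f1 - f2 * f2) ^+ 2 + (f1 * f2 + f2 * f1) ^+ 2 != 0.
    by rewrite (_ : _ + _ = (f1 ^+ 2 + f2 ^+ 2) ^+ 2) ?expf_neq0//; ring.
  set Den := (X in _ / X = _); have -> : Den = ((f1 * f1 - f2 * f2) ^+ 2 + (f1 * f2 + f2 * f1) ^+ 2) / (s - t) ^+ 8.
    by rewrite /Den; field.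
  by field; rewrite M0 rn0.
- by rewrite DlE /=; field.
Qed.

(** A real [ww] has absolute value [kk], hence no zero off the diagonal. It is continuous and
    positive near the diagonal, so by the intermediate value theorem it is positive on each side of
    [t]. *)
Lemma real_triples_kk s t : 0 <= s <= T -> 0 < t < T -> s != t -> kk g s t = (ww g s t).1.
Proof.
move=> sI tI st; have f0 := kf_neq0 gK sI tI st; have /andP[s0 sT] := sI; have /andP[t0 tT] := tI.
apply: (kk_eq_ww gK f0); first exact: real_triples_ww_im.
rewrite leNgt; apply/negP => wneg.
have [eta eta0 H] := dnbhs_lt (ww_diagonal t) (ltr0Sn R 1).
have pos z : z != t -> `|z - t| < eta -> 0 < (ww g z t).1.
  move=> zt ze; have := H z zt ze.
  by rewrite pmulr_lgt0// exprn_even_gt0// subr_eq0.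
have nonzero z : 0 <= z <= T -> z != t -> (ww g z t).1 != 0.
  move=> zI zt; have fz := kf_neq0 gK zI tI zt; apply/eqP => w0.
  have := ww_norm gK fz; rewrite w0 (real_triples_ww_im zI tI zt) expr0n addr0 => /esym/eqP.
  by rewrite sqrf_eq0 gt_eqF// (kk_gt0 gK).
have cont x y : (forall z, x <= z <= y -> 0 <= z <= T /\ z != t) ->
    {within `[x, y], continuous (fun z => (ww g z t).1)}.
  move=> xy; apply: derivable_within_continuous => z; rewrite in_itv/= => /xy[zI zt].
  by have [d [[]]] := ww_der gK (kf_neq0 gK zI tI zt).
(* The point at distance [M] from [t] on the side of [s] lies strictly between them and is close
   enough to [t] for [ww] to be positive there. *)
have [M [M0 M1 M2]] : exists M : R, [/\ 0 < M, M < eta & M < `|s - t|].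
  exists (Num.min eta `|s - t| / 2).
  have : 0 < Num.min eta `|s - t| by rewrite lt_min eta0 normr_gt0 subr_eq0.
  have : Num.min eta `|s - t| <= eta by rewrite ge_min lexx.
  have : Num.min eta `|s - t| <= `|s - t| by rewrite ge_min lexx orbT.
  by set m := Num.min _ _ => *; split; lra.
case: (ltgtP s t) st M2 => // [st|ts] _ M2.
  move: M2; rewrite ltr0_norm ?subr_lt0// => M2.
  have zp : 0 < (ww g (t - M) t).1.
    apply: pos; first by rewrite lt_eqF// gtrBl.
    by rewrite addrC addKr normrN gtr0_norm.
  have inside z : s <= z <= t - M -> 0 <= z <= T /\ z != t.
    move=> /andP[sz zt]; split; first by apply/andP; split; lra.
    by rewrite lt_eqF//; lra.
  have [c + c0] : exists2 c, c \in `[s, t - M] & (ww g c t).1 = 0.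
    apply: IVT; [lra|exact: cont|].
    by rewrite ge_min (ltW wneg) le_max (ltW zp) orbT.
  by rewrite in_itv/= => /inside[cI ct]; have := nonzero c cI ct; rewrite c0 eqxx.
move: M2; rewrite gtr0_norm ?subr_gt0// => M2.
have zp : 0 < (ww g (t + M) t).1.
  apply: pos; first by rewrite gt_eqF// ltrDl.
  by rewrite addrC addKr gtr0_norm.
have inside z : t + M <= z <= s -> 0 <= z <= T /\ z != t.
  move=> /andP[tz zs]; split; first by apply/andP; split; lra.
  by rewrite gt_eqF//; lra.
have [c + c0] : exists2 c, c \in `[t + M, s] & (ww g c t).1 = 0.
  apply: IVT; [lra|exact: cont|].
  by rewrite ge_min (ltW wneg) orbT le_max (ltW zp).
by rewrite in_itv/= => /inside[cI ct]; have := nonzero c cI ct; rewrite c0 eqxx.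
Qed.

End RealTriples.
End Knot.

Theorem theorem4p3 (R : realType) (g : R -> C3 R) (T : R) :
  legendrian_knot_param g T ->
  (0 <= energy g T)%E /\ (energy g T = 0%E <-> R_circle (knot_of g)).
Proof.
move=> gK; split; first exact: energy_ge0.
split=> [E0|RC].
  by apply: (triple_real_R_circle gK); apply: (triple_real gK); exact: energy0_ww_real.
apply: energy_eq0 => t tI t3; apply: (V_K_eq0 gK tI t3) => s sI st.
rewrite /defect (real_triples_kk gK _ sI tI st) ?subrr ?mul0r//.
exact: (R_circle_triple_real gK RC).
Qed.
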